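(* Let $\gamma>0$ and $0<q<1$. Consider the discrete-time AWGN channel $Y_i=X_i+N_i$, $i=1,\dots,n$, where $N_1,N_2,\dots$ are i.i.d. standard Gaussian and independent of the input, and where every codeword $(x_1,\dots,x_n)$ must satisfy the idealized duty cycle constraint $\frac1n\sum_{i=1}^n 1_{\{x_i\neq 0\}}\le 1-q$ and the average power constraint $\frac1n\sum_{i=1}^n x_i^2\le\gamma$. The (operational) capacity of this channel is $$C(\gamma,q)=\max_{\mu\in\Lambda(\gamma,q)} I(\mu).$$ Moreover: (a) the maximum is attained by a unique distribution $\mu_0\in\Lambda(\gamma,q)$; (b) $\mu_0$ is symmetric about $0$ and $\mathbb{E}_{\mu_0}[X^2]=\gamma$; (c) $\mu_0$ is discrete with infinitely many probability mass points, while the number of mass points in any bounded interval is finite.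
   Context: $\phi(t)=\frac{1}{\sqrt{2\pi}}e^{-t^2/2}$ is the standard Gaussian density. For a Borel probability measure $\mu$ on $\mathbb{R}$ (the input distribution), the output density is $p_Y(y;\mu)=\mathbb{E}_\mu[\phi(y-X)]$, $d(x;\mu)=\int_{-\infty}^\infty \phi(y-x)\log\frac{\phi(y-x)}{p_Y(y;\mu)}\,dy$, and $I(\mu)=\int d(x;\mu)\,\mu(dx)$ is the input-output mutual information of the channel $Y=X+N$ with $X\sim\mu$, $N$ standard Gaussian independent of $X$. $\Lambda(\gamma,q)=\{\mu:\ \mu(\{0\})\ge q,\ \mathbb{E}_\mu[X^2]\le\gamma\}$. *)

(* Defs.v *)
From HB Require Import structures.
From mathcomp Require Import all_boot all_order all_algebra.
From mathcomp Require Import all_classical all_reals all_analysis.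
Set Implicit Arguments. Unset Strict Implicit. Unset Printing Implicit Defensive.
Import Order.TTheory GRing.Theory Num.Theory.
Import numFieldNormedType.Exports.
Local Open Scope classical_set_scope.
Local Open Scope ring_scope.

Section awgn.
Variable R : realType.

Definition phi (t : R) : R := (Num.sqrt (pi *+ 2))^-1 * expR (- (t ^+ 2) / 2).

Notation pmeasure := (probability R R).

(* output density p_Y(y; mu) = E_mu[phi(y - X)]  (finite, in [0, phi 0]) *)
Definition pY (mu : pmeasure) (y : R) : R :=
  fine (\int[mu]_x (phi (y - x))%:E)%E.

Definition dens (mu : pmeasure) (x : R) : \bar R :=
  (\int[@lebesgue_measure R]_y
     ((phi (y - x))%:E * (ln (phi (y - x) / pY mu y))%:E))%E.

Definition MI (mu : pmeasure) : \bar R := (\int[mu]_x dens mu x)%E.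

Definition Lambda (gamma q : R) : set pmeasure :=
  [set mu : pmeasure | (q%:E <= mu [set (0%R : R)])%E /\ (\int[mu]_x (x ^+ 2)%:E <= gamma%:E)%E].

(* Channel law of Y = x + N, N ~ N(0, I_n): for a nonnegative function F of
   the output n-tuple and an input tuple x, gint n F x = E[F(x + N)],
   computed as the iterated Lebesgue integral against the product density
   prod_i phi(y_i - x_i). *)
Fixpoint gint (n : nat) : (n.-tuple R -> \bar R) -> n.-tuple R -> \bar R :=
  match n return (n.-tuple R -> \bar R) -> n.-tuple R -> \bar R with
  | 0 => fun F _ => F [tuple]
  | n'.+1 => fun F x =>
      (\int[@lebesgue_measure R]_t
         ((phi (t - thead x))%:E *
          gint (fun y : n'.-tuple R => F [tuple of t :: y]) (behead_tuple x)))%E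
  end.

Definition good_code (gamma q : R) (n M : nat) (eps : R)
  (f : 'I_M -> n.-tuple R) (g : n.-tuple R -> 'I_M) : Prop :=
  [/\ forall m, (count (fun x : R => x != 0) (f m))%:R <= (1 - q) * n%:R,
      forall m, \sum_(x <- f m) x ^+ 2 <= n%:R * gamma,
      forall m, measurable (g @^-1` [set m])
    & forall m, ((1 - eps)%:E <= gint (fun y => (g y == m)%:R%:E) (f m))%E].

Definition achievable (gamma q r : R) : Prop :=
  forall eps : R, 0 < eps -> exists N : nat, forall n : nat, (N <= n)%N ->
    exists M : nat, exists f : 'I_M -> n.-tuple R, exists g : n.-tuple R -> 'I_M,
      expR (n%:R * r) <= M%:R /\ good_code gamma q eps f g.

Definition capacity (gamma q : R) : \bar R :=
  ereal_sup [set r%:E | r in [set r | achievable gamma q r]].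

Definition atoms (mu : pmeasure) : set R := [set x | (0 < mu [set x])%E].

End awgn.

(* Main.v *)
Require Import Defs.
From HB Require Import structures.
From mathcomp Require Import all_boot all_order all_algebra.
From mathcomp Require Import all_classical all_reals all_analysis.
From mathcomp Require Import measurable_realfun ring lra.
Set Implicit Arguments. Unset Strict Implicit. Unset Printing Implicit Defensive.
Import Order.TTheory GRing.Theory Num.Theory.
Import numFieldNormedType.Exports.
Local Open Scope classical_set_scope.
Local Open Scope ring_scope.

(** Existence of the maximizer [mu0] follows from Helly selection: the output densities converge
    pointwise, and Fatou's lemma gives upper semicontinuity of the information. Perturbing [mu0]
    along mixtures yields the Kuhn-Tucker condition [d(x; mu0) <= c + l x^2] with equality almost
    everywhere off 0. Comparison with Gaussian inputs forces [0 < l < 1/2], hence the power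
    constraint is tight. Up to a nonvanishing factor, both sides of the condition are entire in [x];
    equality at infinitely many points of a bounded interval would make it an identity, so [mu0]
    would have a Gaussian output density and no atom at 0. Hence [mu0] is discrete with locally
    finite support. The support is infinite, since for bounded support [d(x; mu0)] grows like
    [x^2 / 2]. Two maximizers have the same output density, which determines the atoms; this gives
    uniqueness, and symmetry.

    For the converse, the Donsker-Varadhan inequality, applied letter by letter with reference output
    density [p_Y(.; mu0)], bounds the log-size of a code by the sum of [d(x_i; mu0)], which the
    Kuhn-Tucker condition controls for every admissible codeword. For achievability, a finite
    truncation of [mu0], with a little mass moved to 0, drives Feinstein's greedy construction; the
    reference output measure is again [p_Y(.; mu0)], and exponential moments bound the atypical
    events, including the violation of the two input constraints. *)

(** * The standard Gaussian density *)

Section gaussian.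
Variable R : realType.
Notation leb := (@lebesgue_measure R).

(** The integrand of [dens] changes sign, so information is handled through [Lf], the surprisal
    shifted to be nonnegative: cross-entropies [J] are then integrals of nonnegative functions, for
    which Tonelli, additivity and Fatou need no integrability, and subtraction waits until
    finiteness follows from the second moment. Comparisons between inputs reduce to Gibbs'
    inequality for [J], which is affine in its first argument. A limit of inputs may lose second
    moment, so entropy does not pass to the limit directly; relative entropy to a Gaussian output of
    variance 1 + v does, and the lost moment is charged at rate 1 / (2 (1 + v)), which vanishes as v
    grows. The identity theorem is obtained by real means: the functions in question are Laplace
    transforms, determined by their moments, and the moments are limits of normalized Taylor
    remainders along a sequence of points of agreement. In the random coding part, moving mass to 0
    makes both input constraints strict on average, so that violating them is a large deviation, and
    costs only a factor close to 1 per letter in the output density. *)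

Lemma phi0_gt0 : 0 < phi 0 :> R.
Proof. by rewrite mulr_gt0// ?expR_gt0// invr_gt0 sqrtr_gt0 pmulrn_lgt0// pi_gt0. Qed.

Lemma phiE (t : R) : phi t = phi 0 * expR (- (t ^+ 2) / 2).
Proof. by rewrite /phi expr0n/= oppr0 mul0r expR0 mulr1. Qed.

Lemma phi_gt0 (t : R) : 0 < phi t.
Proof. by rewrite phiE mulr_gt0 ?phi0_gt0 ?expR_gt0. Qed.

Lemma phi_ge0 (t : R) : 0 <= phi t. Proof. exact/ltW/phi_gt0. Qed.

Lemma phi_le (t : R) : phi t <= phi 0.
Proof.
rewrite phiE ger_pMr ?phi0_gt0// -[leRHS]expR0 ler_expR mulNr oppr_le0.
by rewrite divr_ge0// sqr_ge0.
Qed.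

Lemma phiN (t : R) : phi (- t) = phi t.
Proof. by rewrite /phi sqrrN. Qed.

Lemma measurable_phi : measurable_fun setT (@phi R).
Proof.
apply: measurable_funM => //; apply: measurableT_comp => //.
by apply: measurable_funM => //; apply: measurableT_comp => //; exact: measurable_funX.
Qed.

Lemma phi_normal_pdf (x y : R) : phi (y - x) = normal_pdf x 1 y.
Proof.
rewrite normal_pdfE ?oner_neq0// /normal_peak /normal_fun /phi.
by rewrite expr1n mul1r.
Qed.

Lemma integral_phi (x : R) : (\int[leb]_y (phi (y - x))%:E = 1)%E.
Proof.
by under eq_integral do rewrite phi_normal_pdf; exact: integral_normal_pdf.
Qed.

End gaussian.

Ltac meas := repeat (lazymatch goal with
  | |- measurable_fun _ (fun x => x) => exact: measurable_id
  | |- measurable_fun _ fst => exact: measurable_fst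
  | |- measurable_fun _ snd => exact: measurable_snd
  | |- measurable_fun _ (fun x => fst x) => exact: measurable_fst
  | |- measurable_fun _ (fun x => snd x) => exact: measurable_snd
  | |- measurable_fun _ (fun _ => ?c) => exact: measurable_cst
  | |- measurable_fun _ (fun x => if _ then _ else _) => apply: measurable_fun_ifT
  | |- measurable_fun _ (fun x => (_ <= _)%R) => apply: measurable_fun_ler
  | |- measurable_fun _ (fun x => (_ < _)%R) => apply: measurable_fun_ltr
  | |- measurable_fun _ (EFin \o _) => apply/measurable_EFinP
  | |- measurable_fun _ (fun x => EFin _) => apply/measurable_EFinP
  | |- measurable_fun _ (fun x => (_ + - _)%R) =>
      first [apply: measurable_funB | apply: emeasurable_funB]
  | |- measurable_fun _ (fun x => (_ + _)%R) =>
      first [apply: measurable_funD | apply: emeasurable_funD]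
  | |- measurable_fun _ (fun x => (_ * _)%R) =>
      first [apply: measurable_funM | apply: emeasurable_funM]
  | |- measurable_fun _ (fun x => (- _)%R) => apply: measurableT_comp
  | |- measurable_fun _ (fun x => (_ ^+ _)%R) => apply: measurable_funX
  | |- measurable_fun _ (fun x => `|_|%R) =>
      apply: (measurableT_comp (@normr_measurable _ setT))
  | |- measurable_fun _ (fun x => expR _) =>
      apply: (measurableT_comp (@measurable_expR _))
  | |- measurable_fun _ (fun x => ln _) =>
      apply: (measurableT_comp (@measurable_ln _))
  | |- measurable_fun _ (fun x => (_ + _)%E) => apply: emeasurable_funD
  | |- measurable_fun _ (fun x => (_ * _)%E) => apply: emeasurable_funM
  | |- measurable_fun _ (@Order.le _ _ ?a) =>
      apply: (measurable_fun_ler (measurable_cst a) (@measurable_id _ _ _))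
  | |- measurable_fun _ (@Order.lt _ _ ?a) =>
      apply: (measurable_fun_ltr (measurable_cst a) (@measurable_id _ _ _))
  | |- measurable_fun _ (@phi _) => exact: measurable_phi
  | |- measurable_fun _ (fun x => phi _) =>
      apply: (measurableT_comp (@measurable_phi _))
  | |- measurable_fun _ _ => first [assumption | done
      | exact: (measurable_funD (measurable_cst _) (@measurable_id _ _ _)) ]
  end).

(** * Gaussian moments and output densities *)

Section gaussian_moments.
Variable R : realType.
Notation leb := (@lebesgue_measure R).

Lemma lebesgue_measureD (x : R) (A : set R) : measurable A ->
  pushforward leb ((+%R^~ x) : measurableTypeR R -> measurableTypeR R) A = leb A.
Proof.
move=> mA.
have mx : measurable_fun setT ((+%R^~ x) : measurableTypeR R -> measurableTypeR R).
  exact: measurable_funD.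
apply/esym/(@lebesgue_measure_unique _ (measure_function_pushforward__canonical__measure_function_Measure leb mx)) => //.
move=> _ [[a b]] _ <-; rewrite /= /pushforward.
have -> : (+%R^~ x) @^-1` `]a, b] = `]a - x, b - x]%classic.
  by apply/seteqP; split => y /=; rewrite !in_itv/= ltrBlDr lerBrDr.
rewrite !lebesgue_measure_itv/= !lte_fin ltrD2r; case: ifP => // _.
by congr (_%:E); ring.
Qed.

Lemma ge0_integral_translate (f : R -> \bar R) (x : R) :
  measurable_fun setT f -> (forall y, 0 <= f y)%E ->
  (\int[leb]_y f (y + x)%R = \int[leb]_y f y)%E.
Proof.
move=> mf f0.
transitivity (\int[pushforward leb ((+%R^~ x) : measurableTypeR R -> measurableTypeR R)]_y f y)%E.
  by rewrite ge0_integral_pushforward//; exact: measurable_funD.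
have mx : measurable_fun setT ((+%R^~ x) : measurableTypeR R -> measurableTypeR R).
  exact: measurable_funD.
apply: (@eq_measure_integral _ _ _ _ leb
  (measure_function_pushforward__canonical__measure_function_Measure leb mx)).
by move=> A mA _; exact: lebesgue_measureD.
Qed.

Lemma ge0_integral_opp (f : R -> \bar R) :
  measurable_fun setT f -> (forall y, 0 <= f y)%E ->
  (\int[leb]_y f (- y)%R = \int[leb]_y f y)%E.
Proof.
move=> mf f0.
transitivity (\int[pushforward leb (-%R : measurableTypeR R -> measurableTypeR R)]_y f y)%E.
  by rewrite ge0_integral_pushforward.
by apply: eq_measure_integral => A mA _; exact: lebesgue_measureN.
Qed.

(* Layer-cake form of the density; integrated against mu it expresses pY through the
   distribution function of mu. *)
Lemma integral_rphi (a : R) : 0 <= a ->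
  (\int[leb]_(r in `[a, +oo[) (r * phi r)%:E = (phi a)%:E)%E.
Proof.
move=> a0.
have dphi (r : R) : is_derive r 1 (fun t : R => - phi t) (r * phi r).
  rewrite /phi; apply: is_derive_eq; rewrite /GRing.scale /=.
  by move: (_^-1) (expR _) => c e; field.
have cphi : continuous (fun t : R => - phi t).
  by move=> r; apply/differentiable_continuous/derivable1_diffP; case: (dphi r).
have crphi : continuous (fun t : R => t * phi t).
  move=> r; apply: cvgM; first exact: cvg_id.
  have -> : @phi R = (fun t => - - phi t) by apply/funext => t; rewrite opprK.
  by apply: cvgN; exact: (cphi r).
rewrite (@ge0_continuous_FTC2y _ _ (fun t => - phi t) a 0).
- by rewrite EFinN sub0e oppeK.
- by move=> r ar; rewrite mulr_ge0 ?phi_ge0// (le_trans a0).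
- exact: continuous_subspaceT.
- rewrite -oppr0; apply: cvgN; rewrite -(mulr0 (Num.sqrt (pi *+ 2))^-1).
  apply: cvgMr; apply: (@squeeze_cvgr _ _ _ _ (fun=> 0) (fun t => expR (- t))).
  + near=> t; rewrite expR_ge0/= ler_expR.
    have t2 : 2 <= t by near: t; exact: nbhs_pinfty_ge.
    by nra.
  + exact: cvg_cst.
  + exact: cvgr_expR.
- by move=> r _; case: (dphi r).
- by apply: cvg_at_right_filter; exact: cphi.
- by move=> r _; rewrite derive1E; case: (dphi r).
Unshelve. all: by end_near. Qed.

Local Opaque phi.

(** Integrating the identity [integral_rphi] at [a = |v|] over [v] gives total mass 1. After
    exchanging the integrals, the section at [r >= 0] is [[-r, r]], of length [2 r], so the same
    quantity is twice the half-line integral of [r ^+ 2 * phi r]. *)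
Lemma integral_sqr_phi : (\int[leb]_r (r ^+ 2 * phi r)%:E = 1)%E.
Proof.
pose f (z : R * R) : \bar R := (if `|z.2| <= z.1 then z.1 * phi z.1 else 0)%:E.
have mf : measurable_fun setT f by rewrite /f; meas.
have f0 z : (0 <= f z)%E.
  rewrite lee_fin /f; case: ifPn => // h.
  by rewrite mulr_ge0 ?phi_ge0// (le_trans _ h).
have := fubini_tonelli (m1:=leb) (m2:=leb) _ mf f0.
rewrite [X in _ = X -> _](_ : _ = 1)%E; last first.
  rewrite -[RHS](integral_phi 0); apply: eq_integral => v _.
  rewrite /fubini_G subr0.
  transitivity (phi `|v|)%:E; last by rewrite phiE real_normK ?num_real// -phiE.
  rewrite -(@integral_rphi `|v|)//.
  rewrite [RHS]integral_mkcond; apply: eq_integral => r _.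
  rewrite /f patchE /=; case: ifPn => [h|/negP h].
    by rewrite ifT// inE/= in_itv/= h.
  by rewrite ifF//; apply/negP; rewrite inE/= in_itv/= andbT.
move=> <-.
pose h (r : R) : \bar R := (if 0 <= r then r ^+ 2 * phi r else 0)%:E.
have mh : measurable_fun setT h by rewrite /h; meas.
have h0 r : (0 <= h r)%E.
  by rewrite lee_fin; case: ifPn => // _; rewrite mulr_ge0 ?sqr_ge0 ?phi_ge0.
transitivity (\int[leb]_r (h r + h (- r)%R))%E.
  apply: eq_integral => r _; rewrite /h -EFinD; congr EFin.
  rewrite oppr_ge0 sqrrN phiN; case: (ltgtP r 0) => [_|_|->]; rewrite ?addr0 ?add0r//.
  by rewrite expr0n/= mul0r addr0.
rewrite ge0_integralD//; last first.
  by rewrite /h; meas.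
rewrite ge0_integral_opp// -ge0_integralD//.
apply: eq_integral => r _; rewrite /fubini_F /f /h /=.
case: ifPn => r0; last first.
  rewrite integral0_eq ?addr0// => v _; rewrite ifF//; apply/negP => vr.
  by move: r0; rewrite (le_trans _ vr).
transitivity (\int[leb]_(v in `[(- r)%R, r]) (r * phi r)%:E)%E.
  rewrite integral_cst//= lebesgue_measure_itv/= lte_fin; case: ifPn => hr.
    by rewrite -?EFinN -!EFinD -EFinM ?opprK; congr EFin; ring.
  have -> : r = 0 by lra.
  by rewrite mule0 expr0n/= mul0r addr0.
rewrite [LHS]integral_mkcond; apply: eq_integral => v _; rewrite patchE.
rewrite mem_setE in_itv/= -ler_norml; by case: ifPn.
Qed.

(** After centring, the cross term [2 u x] is odd; adding the integral to its reflection removes it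
    while all integrands stay nonnegative. *)
Lemma integral_phi_sqr (x : R) :
  (\int[leb]_y (phi (y - x) * y ^+ 2)%:E = (1 + x ^+ 2)%:E)%E.
Proof.
pose f (u : R) : \bar R := (phi u * (u + x) ^+ 2)%:E.
have mf : measurable_fun setT f by rewrite /f; meas.
have f0 u : (0 <= f u)%E by rewrite lee_fin mulr_ge0 ?phi_ge0 ?sqr_ge0.
have -> : (\int[leb]_y (phi (y - x) * y ^+ 2)%:E = \int[leb]_u f u)%E.
  rewrite -(ge0_integral_translate (- x) mf f0); apply: eq_integral => y _.
  by rewrite /f subrK.
have : (\int[leb]_u f u + \int[leb]_u f u = (2 * (1 + x ^+ 2))%:E)%E.
  rewrite -{1}(ge0_integral_opp mf f0) -ge0_integralD//; last first.
    by rewrite /f; meas.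
  transitivity (\int[leb]_u (((2 : R)%:E * (u ^+ 2 * phi u)%:E) + ((2 * x ^+ 2)%:E * (phi (u - 0))%:E)))%E.
    apply: eq_integral => u _; rewrite /f phiN subr0 -!EFinM -!EFinD.
    by congr EFin; ring.
  rewrite ge0_integralD//.
  - rewrite ge0_integralZl//; last 2 first.
    + by meas.
    + by move=> u _; rewrite lee_fin mulr_ge0 ?phi_ge0 ?sqr_ge0.
    rewrite ge0_integralZl//; last 3 first.
    + by meas.
    + by move=> u _; rewrite lee_fin phi_ge0.
    + by rewrite lee_fin mulr_ge0 ?sqr_ge0.
    by rewrite integral_sqr_phi integral_phi !mule1 -EFinD; congr EFin; ring.
  - move=> u _; apply: mule_ge0; rewrite lee_fin; first exact: ler0n.
    by apply: mulr_ge0; rewrite ?sqr_ge0 ?phi_ge0.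
  - by meas.
  - move=> u _; apply: mule_ge0; rewrite lee_fin ?phi_ge0//.
    by apply: mulr_ge0 => //; exact: sqr_ge0.
  - by meas.
have : (0 <= \int[leb]_u f u)%E by exact: integral_ge0.
case: (\int[leb]_u f u)%E => [a|//|//] _ [] /= h.
by congr EFin; lra.
Qed.

Section output.
Implicit Types mu nu : probability R R.

Lemma measurable_phi2 : measurable_fun setT (fun z : R * R => (phi (z.2 - z.1))%:E).
Proof. by meas. Qed.

Lemma integral_cst_prob mu (c : \bar R) : (\int[mu]_x c = c)%E.
Proof.
transitivity (c * mu setT)%E; first exact: integral_cst.
by rewrite (_ : mu setT = 1%E) ?mule1//; exact: probability_setT.
Qed.

Lemma pYE mu y : (pY mu y)%:E = (\int[mu]_x (phi (y - x))%:E)%E.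
Proof.
rewrite /pY fineK// ge0_fin_numE; last first.
  by apply: integral_ge0 => x _; rewrite lee_fin phi_ge0.
apply: (@le_lt_trans _ _ (\int[mu]_x (phi 0)%:E))%E.
  apply: ge0_le_integral => //.
  - by move=> x _; rewrite lee_fin phi_ge0.
  - by meas.
  - by move=> x _; rewrite lee_fin phi_le.
by rewrite integral_cst_prob ltry.
Qed.

Lemma measurable_pY mu : measurable_fun setT (pY mu).
Proof.
apply/measurable_EFinP.
have -> : EFin \o pY mu = fubini_G mu (fun z : R * R => (phi (z.2 - z.1))%:E).
  by apply/funext => y; rewrite /= pYE.
apply: measurable_fun_fubini_tonelli_G; first exact: measurable_phi2.
by move=> z; rewrite lee_fin phi_ge0.
Qed.

Lemma pY_le mu y : pY mu y <= phi 0.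
Proof.
rewrite -lee_fin pYE -[leRHS]mule1 -(probability_setT mu) -integral_cst//.
apply: ge0_le_integral => //.
- by move=> x _; rewrite lee_fin phi_ge0.
- by meas.
- by move=> x _; rewrite lee_fin phi_le.
Qed.

(** Since [(y - x) ^+ 2 / 2 <= x ^+ 2 + y ^+ 2], the constant is [phi 0] times the mean of
    [exp (- X ^+ 2)]. No moment is assumed, so every surprisal grows at most quadratically
    ([Lf_upper_bound]). *)
Lemma pY_lower_bound mu : exists2 c : R, 0 < c & forall y : R, c * expR (- y ^+ 2) <= pY mu y.
Proof.
pose I := (\int[mu]_x (expR (- x ^+ 2))%:E)%E.
have me : measurable_fun setT (fun x : R => (expR (- x ^+ 2))%:E) by meas.
have I0 : (0 < I)%E.
  rewrite lt_neqAle eq_sym integral_ge0 ?andbT; last by move=> x _; rewrite lee_fin expR_ge0.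
  apply/eqP => I0.
  have /iffLR := ae_eq_integral_abs mu measurableT me.
  rewrite (_ : \int[mu]_x _ = 0)%E; last first.
    by rewrite -[RHS]I0; apply: eq_integral => x _; rewrite gee0_abs// lee_fin expR_ge0.
  move=> /(_ erefl)[N [mN N0 sN]].
  have : mu N = 1%E.
    rewrite -(probability_setT mu); congr (mu _); apply/seteqP; split => // x _.
    by apply: sN => /= /(_ Logic.I)[]; apply/eqP; rewrite gt_eqF ?expR_gt0.
  by rewrite N0 => /eqP; rewrite eq_sym onee_eq0.
have If : (I < +oo)%E.
  apply: (@le_lt_trans _ _ (\int[mu]_x 1))%E.
    apply: ge0_le_integral => //.
    - by move=> x _; rewrite lee_fin -[leRHS]expR0 ler_expR oppr_le0 sqr_ge0.
  by rewrite integral_cst_prob ltry.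
exists (phi 0 * fine I); first by rewrite mulr_gt0 ?phi0_gt0// fine_gt0// I0.
move=> y; rewrite -lee_fin pYE mulrAC EFinM fineK; last by rewrite ge0_fin_numE// ltW.
rewrite -ge0_integralZl//; last by apply: mulr_ge0; rewrite ?phi_ge0 ?expR_ge0.
apply: ge0_le_integral => //.
- by move=> x _; rewrite -EFinM lee_fin !mulr_ge0 ?expR_ge0// ltW ?phi0_gt0.
- by meas.
- by meas.
- move=> x _; rewrite -EFinM lee_fin [phi (y - x)]phiE -mulrA ler_pM2l ?phi0_gt0// -expRD ler_expR.
  rewrite -subr_ge0 (_ : _ - _ = (x + y) ^+ 2 / 2); last by field.
  by rewrite divr_ge0// sqr_ge0.
Qed.

Lemma pY_gt0 mu y : 0 < pY mu y.
Proof.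
have [c c0 h] := pY_lower_bound mu.
by apply: lt_le_trans (h y); rewrite mulr_gt0 ?expR_gt0.
Qed.

Lemma pY_ge0 mu y : 0 <= pY mu y. Proof. exact/ltW/pY_gt0. Qed.

(* the output surprisal, normalised to be nonnegative *)
Definition Lf mu (y : R) : R := ln (phi 0 / pY mu y).

Lemma Lf_ge0 mu y : 0 <= Lf mu y.
Proof. by apply: ln_ge0; rewrite ler_pdivlMr ?pY_gt0// mul1r pY_le. Qed.

Lemma measurable_Lf mu : measurable_fun setT (Lf mu).
Proof.
rewrite (_ : Lf mu = fun y => ln (phi 0) - ln (pY mu y)).
  by have mp := measurable_pY mu; meas.
by apply/funext => y; rewrite /Lf ln_div// posrE ?pY_gt0 ?phi0_gt0.
Qed.

Lemma Lf_upper_bound mu : exists2 C : R, 0 <= C & forall y, Lf mu y <= y ^+ 2 + C.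
Proof.
have [c c0 h] := pY_lower_bound mu.
have cp : c <= phi 0.
  by have := le_trans (h 0) (pY_le mu 0); rewrite expr0n/= oppr0 expR0 mulr1.
exists (ln (phi 0 / c)) => [|y].
  by apply: ln_ge0; rewrite ler_pdivlMr// mul1r.
have p0 := @phi0_gt0 R; have py := pY_gt0 mu y; have e0 := expR_gt0 (y ^+ 2).
rewrite -[y ^+ 2]expRK -lnM ?posrE ?divr_gt0//.
rewrite ler_ln ?posrE; [|exact: divr_gt0|by apply: mulr_gt0 => //; exact: divr_gt0].
rewrite mulrCA ler_pM2l// -[expR _]invrK -expRN -invfM.
rewrite lef_pV2 ?posrE//; first by rewrite mulrC.
by apply: mulr_gt0 => //; exact: expR_gt0.
Qed.

Lemma pY_integral mu (f : R -> R) : measurable_fun setT f -> (forall y, 0 <= f y) ->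
  (\int[leb]_y (pY mu y * f y)%:E = \int[mu]_x \int[leb]_y (phi (y - x) * f y)%:E)%E.
Proof.
move=> mf f0.
pose g (z : R * R) : \bar R := (phi (z.2 - z.1) * f z.2)%:E.
have mg : measurable_fun setT g.
  by have mf2 := measurableT_comp mf (@measurable_snd _ _ R R); rewrite /g; meas.
have g0 z : (0 <= g z)%E by rewrite lee_fin mulr_ge0 ?phi_ge0.
rewrite (fubini_tonelli (m1:=mu) (m2:=leb) _ mg g0).
apply: eq_integral => y _; rewrite /g/= EFinM pYE muleC.
under [RHS]eq_integral do rewrite EFinM muleC.
rewrite ge0_integralZl//.
- by meas.
- by move=> x _; rewrite lee_fin phi_ge0.
- by rewrite lee_fin.
Qed.

Lemma integral_pY mu : (\int[leb]_y (pY mu y)%:E = 1)%E.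
Proof.
have := @pY_integral mu (cst 1) (measurable_cst _) (fun=> ler01).
under eq_integral do rewrite mulr1.
move=> ->; under eq_integral => x _.
  under eq_integral do rewrite mulr1.
  rewrite integral_phi; over.
by rewrite integral_cst_prob.
Qed.

Lemma pY_second_moment mu :
  (\int[leb]_y (pY mu y * y ^+ 2)%:E = 1 + \int[mu]_x (x ^+ 2)%:E)%E.
Proof.
rewrite (@pY_integral mu (fun y => y ^+ 2)); [|by meas|by move=> y; exact: sqr_ge0].
under eq_integral do rewrite integral_phi_sqr EFinD.
rewrite ge0_integralD//; last 2 first.
- by move=> x _; rewrite lee_fin sqr_ge0.
- by meas.
by rewrite integral_cst_prob.
Qed.

End output.
End gaussian_moments.

Local Opaque phi.

Ltac nonneg := repeat first [ done | exact: phi_ge0 | exact: pY_ge0 | exact: Lf_ge0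
  | exact: expR_ge0 | exact: sqr_ge0 | rewrite lee_fin | apply: divr_ge0 | apply: mulr_ge0
  | apply: mule_ge0 | apply: addr_ge0 | apply: adde_ge0 ].

Ltac ig := try solve [by meas | by move=> ? _; nonneg].

(** * Cross-entropy, relative entropy and Gibbs' inequality *)

Section divergence.
Variable R : realType.
Notation leb := (@lebesgue_measure R).
Implicit Types mu nu : probability R R.

Lemma ln_phi (t : R) : ln (phi t) = ln (phi 0) - t ^+ 2 / 2.
Proof. by rewrite phiE lnM ?posrE ?expR_gt0 ?phi0_gt0// expRK mulNr. Qed.

Lemma integral_norm_ge0 d (T : measurableType d) (m : {measure set T -> \bar R}) (f : T -> R) :
  (forall x, 0 <= f x) -> (\int[m]_x `|(EFin \o f) x| = \int[m]_x (f x)%:E)%E.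
Proof. by move=> f0; apply: eq_integral => x _; rewrite gee0_abs// lee_fin. Qed.

(* With D nu x = d(x; nu), the shift by 1/2 being the mean of (Y - x)^2 / 2 under N(x, 1), and J
   the cross-entropy up to a constant, I(mu) = J mu mu - 1/2. *)
Definition Dg nu (x : R) : \bar R := (\int[leb]_y (phi (y - x) * Lf nu y)%:E)%E.
Definition D nu (x : R) : R := fine (Dg nu x) - 1 / 2.
Definition J mu nu : \bar R := (\int[leb]_y (pY mu y * Lf nu y)%:E)%E.
Definition E2 mu : \bar R := (\int[mu]_x (x ^+ 2)%:E)%E.

Lemma Dg_le nu : exists2 C : R, 0 <= C & forall x, (Dg nu x <= (1 + x ^+ 2 + C)%:E)%E.
Proof.
have [C C0 hC] := Lf_upper_bound nu; exists C => // x.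
have mL := measurable_Lf nu.
apply: (@le_trans _ _ (\int[leb]_y ((phi (y - x) * y ^+ 2)%:E + C%:E * (phi (y - x))%:E))%E).
  apply: ge0_le_integral => //.
  - by move=> y _; nonneg.
  - by meas.
  - by meas.
  - move=> y _; rewrite -EFinM -EFinD lee_fin (mulrC C) -mulrDr.
    by rewrite ler_wpM2l ?phi_ge0.
rewrite ge0_integralD//; last 4 first.
- by move=> y _; nonneg.
- by meas.
- by move=> y _; nonneg.
- by meas.
rewrite ge0_integralZl//; last 2 first.
- by meas.
- by move=> y _; nonneg.
by rewrite integral_phi integral_phi_sqr mule1 -EFinD.
Qed.

Lemma Dg_ge0 nu x : (0 <= Dg nu x)%E.
Proof. by apply: integral_ge0 => y _; nonneg. Qed.

Lemma DgE nu x : Dg nu x = (D nu x + 1 / 2)%:E.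
Proof.
rewrite /D subrK fineK// ge0_fin_numE ?Dg_ge0//.
by have [C _ /(_ x) h] := Dg_le nu; apply: le_lt_trans h _; rewrite ltry.
Qed.

Lemma D_le nu : exists2 C : R, 0 <= C & forall x, D nu x <= x ^+ 2 + C.
Proof.
have [C C0 h] := Dg_le nu; exists (1 + C) => [|x]; first by rewrite addr_ge0.
by have := h x; rewrite DgE lee_fin; lra.
Qed.

Lemma measurable_Dg nu : measurable_fun setT (Dg nu).
Proof.
have mL := measurable_Lf nu.
have mL2 := measurableT_comp mL (@measurable_snd _ _ R R).
apply: (@measurable_fun_fubini_tonelli_F _ _ _ _ _ leb
  (fun z : R * R => (phi (z.2 - z.1) * Lf nu z.2)%:E)).
  by meas.
by move=> z; nonneg.
Qed.

Lemma measurable_D nu : measurable_fun setT (D nu).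
Proof.
apply: measurable_funB => //; apply: (measurableT_comp (fine_measurable measurableT)).
exact: measurable_Dg.
Qed.

Lemma integral_phi_half (x : R) : (\int[leb]_y (phi (y - x) * ((y - x) ^+ 2 / 2))%:E = (1 / 2)%:E)%E.
Proof.
rewrite (@ge0_integral_translate _ (fun y : R => (phi y * (y ^+ 2 / 2))%:E) (- x)); last 2 first.
- by meas.
- by move=> y; nonneg.
transitivity (\int[leb]_y ((1 / 2)%:E * (y ^+ 2 * phi y)%:E))%E.
  by apply: eq_integral => y _; rewrite -EFinM; congr EFin; field.
rewrite ge0_integralZl//; first by rewrite integral_sqr_phi mule1.
- by meas.
- by move=> y _; nonneg.
Qed.

Lemma integrable_ge0 (f : R -> R) : measurable_fun setT f -> (forall y, 0 <= f y) ->
  (\int[leb]_y (f y)%:E < +oo)%E -> leb.-integrable setT (EFin \o f).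
Proof.
move=> mf f0 fi; apply/integrableP; split; first by meas.
by rewrite integral_norm_ge0.
Qed.

Lemma integrable_phi (x : R) : leb.-integrable setT (EFin \o (fun y => phi (y - x))).
Proof. by apply: integrable_ge0; [by meas|by move=> y; nonneg|by rewrite integral_phi ltry]. Qed.

Lemma Rintegral_phi (x : R) : (\int[leb]_y phi (y - x))%R = 1.
Proof. by rewrite /Rintegral integral_phi. Qed.

(** The logarithm splits into [Lf nu y] minus [(y - x) ^+ 2 / 2]; each has a finite integral against
    the channel density, the second one equal to 1/2. *)
Lemma dens_D nu x : dens nu x = (D nu x)%:E.
Proof.
have mL := measurable_Lf nu.
have i1 : leb.-integrable setT (EFin \o (fun y => phi (y - x) * Lf nu y)).
  apply: integrable_ge0; first by meas.
  - by move=> y; nonneg.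
  - by have := DgE nu x; rewrite /Dg => ->; rewrite ltry.
have i2 : leb.-integrable setT (EFin \o (fun y => phi (y - x) * ((y - x) ^+ 2 / 2))).
  apply: integrable_ge0; first by meas.
  - by move=> y; nonneg.
  - by rewrite integral_phi_half ltry.
transitivity (\int[leb]_y ((phi (y - x) * Lf nu y)%:E - (phi (y - x) * ((y - x) ^+ 2 / 2))%:E))%E.
  apply: eq_integral => y _; rewrite -EFinM -EFinB; congr EFin.
  rewrite -mulrBr; congr (_ * _).
  have q0 : 0 < phi 0 / pY nu y by apply: divr_gt0; rewrite ?phi0_gt0 ?pY_gt0.
  have f0 := @phi0_gt0 R; have p0 := pY_gt0 nu y; have fx := phi_gt0 (y - x).
  by rewrite /Lf !ln_div ?posrE// ln_phi; ring.
rewrite integralB_EFin// integral_phi_half.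
by have := DgE nu x; rewrite /Dg => ->; rewrite -EFinB; congr EFin; lra.
Qed.

Lemma J_D mu nu : J mu nu = (\int[mu]_x (D nu x + 1 / 2)%:E)%E.
Proof.
rewrite /J pY_integral//; [|exact: measurable_Lf|by move=> y; nonneg].
by apply: eq_integral => x _; exact: DgE.
Qed.

Lemma D_half_ge0 nu x : 0 <= D nu x + 1 / 2.
Proof. by rewrite -lee_fin -DgE Dg_ge0. Qed.

Lemma J_ge0 mu nu : (0 <= J mu nu)%E.
Proof. by apply: integral_ge0 => y _; nonneg. Qed.

Lemma J_fin mu nu : (E2 mu < +oo)%E -> J mu nu \is a fin_num.
Proof.
move=> fE; rewrite ge0_fin_numE ?J_ge0// J_D.
have [C C0 h] := D_le nu; have mD := measurable_D nu.
apply: (@le_lt_trans _ _ (\int[mu]_x ((x ^+ 2)%:E + (C + 1 / 2)%:E))%E).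
  apply: ge0_le_integral => //.
  - by move=> x _; rewrite lee_fin D_half_ge0.
  - by meas.
  - by meas.
  - by move=> x _; rewrite -EFinD lee_fin; have := h x; lra.
rewrite ge0_integralD//; ig.
by rewrite integral_cst_prob lte_add_pinfty// ltry.
Qed.

(** Integrand of the relative entropy of the two output laws. The terms [- pY mu y + pY nu y]
    integrate to zero and make it nonnegative at every point. *)
Definition kl mu nu (y : R) : R := pY mu y * (Lf nu y - Lf mu y) - pY mu y + pY nu y.

Lemma ln_lt_subr1 (t : R) : 0 < t -> t != 1 -> ln t < t - 1.
Proof.
move=> t0 t1; have := @expR_gt1Dx _ (ln t); rewrite ln_eq0// => /(_ t1).
by rewrite lnK ?posrE//; lra.
Qed.

Lemma kl_factor mu nu y :
  kl mu nu y = pY mu y * (pY nu y / pY mu y - 1 - ln (pY nu y / pY mu y)).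
Proof.
have p0 := pY_gt0 mu y; have q0 := pY_gt0 nu y; have f0 := @phi0_gt0 R.
rewrite /kl /Lf !ln_div ?posrE//.
by field; rewrite gt_eqF.
Qed.

Lemma kl_ge0 mu nu y : 0 <= kl mu nu y.
Proof.
rewrite kl_factor mulr_ge0 ?pY_ge0// subr_ge0.
have t0 : 0 < pY nu y / pY mu y by apply: divr_gt0; exact: pY_gt0.
have [->|t1] := eqVneq (pY nu y / pY mu y) 1; first by rewrite ln1 subrr.
exact/ltW/ln_lt_subr1.
Qed.

Lemma kl_eq0 mu nu y : kl mu nu y = 0 -> pY nu y = pY mu y.
Proof.
rewrite kl_factor => /eqP; rewrite mulf_eq0 gt_eqF ?pY_gt0//= subr_eq0 => /eqP h.
have t0 : 0 < pY nu y / pY mu y by apply: divr_gt0; exact: pY_gt0.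
have [e|/(ln_lt_subr1 t0)] := eqVneq (pY nu y / pY mu y) 1; last by rewrite h ltxx.
by rewrite -[LHS](@divfK _ (pY mu y)) ?e ?mul1r// gt_eqF// pY_gt0.
Qed.

Lemma measurable_kl mu nu : measurable_fun setT (kl mu nu).
Proof.
have m1 := measurable_Lf mu; have m2 := measurable_Lf nu.
have m3 := measurable_pY mu; have m4 := measurable_pY nu.
by rewrite /kl; meas.
Qed.

(** Adding 1 to both sides, as the integral of [pY nu] or of [pY mu], leaves only nonnegative
    integrands, so the identity holds even when [J mu nu] is infinite. *)
Lemma gibbsE mu nu : (J mu nu = J mu mu + \int[leb]_y (kl mu nu y)%:E)%E.
Proof.
have m1 := measurable_Lf mu; have m2 := measurable_Lf nu.
have m3 := measurable_pY mu; have m4 := measurable_pY nu.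
have m5 := measurable_kl mu nu.
have : (J mu nu + 1 = J mu mu + \int[leb]_y (kl mu nu y)%:E + 1)%E.
  rewrite -{1}(integral_pY nu) -(integral_pY mu) /J.
  rewrite -ge0_integralD//; last 4 first.
  - by move=> y _; nonneg.
  - by meas.
  - by move=> y _; nonneg.
  - by meas.
  rewrite -ge0_integralD//; last 4 first.
  - by move=> y _; nonneg.
  - by meas.
  - by move=> y _; rewrite lee_fin kl_ge0.
  - by meas.
  rewrite -ge0_integralD//; last 4 first.
  - by move=> y _; rewrite adde_ge0// lee_fin ?kl_ge0//; nonneg.
  - by meas.
  - by move=> y _; nonneg.
  - by meas.
  by apply: eq_integral => y _; rewrite -!EFinD /kl; congr EFin; ring.
by move=> h; have := congr1 (fun z => (z - 1)%E) h; rewrite !addeK.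
Qed.

Lemma gibbs mu nu : (J mu mu <= J mu nu)%E.
Proof.
rewrite [leRHS]gibbsE leeDl//.
by apply: integral_ge0 => y _; rewrite lee_fin kl_ge0.
Qed.

Lemma gibbs_eq mu nu : (E2 mu < +oo)%E -> (J mu nu <= J mu mu)%E ->
  {ae leb, forall y, pY nu y = pY mu y}.
Proof.
move=> fE; rewrite gibbsE -[leRHS]adde0 leeD2lE; last exact: J_fin.
move=> K0; have m5 := measurable_kl mu nu.
have me : measurable_fun setT (EFin \o kl mu nu) by meas.
have [+ _] := ae_eq_integral_abs leb measurableT me; case.
  apply/eqP; rewrite eq_le integral_ge0 ?andbT//.
  by rewrite integral_norm_ge0// => y; exact: kl_ge0.
move=> N [mN N0 sN]; exists N; split => // y /= hy; apply: sN => /= h; apply: hy.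
by apply: kl_eq0; case: (h Logic.I).
Qed.

Lemma pY_dirac (x y : R) : pY (dirac x : probability R R) y = phi (y - x).
Proof.
apply: EFin_inj; rewrite pYE integral_dirac//; last by meas.
by rewrite diracT mul1e.
Qed.

(** [D nu x] is the relative entropy of N(x, 1) to the output law of [nu], so this is Gibbs'
    inequality for a point-mass input, whose own cross-entropy is 1/2. *)
Lemma D_ge0 nu x : 0 <= D nu x.
Proof.
have := gibbs (dirac x : probability R R) nu.
have -> : J (dirac x : probability R R) nu = Dg nu x.
  by apply: eq_integral => y _; rewrite pY_dirac.
have -> : J (dirac x : probability R R) (dirac x : probability R R) = (1 / 2)%:E.
  rewrite -(integral_phi_half x); apply: eq_integral => y _.
  have f0 := @phi0_gt0 R; have fx := phi_gt0 (y - x).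
  by rewrite /Lf pY_dirac ln_div ?posrE// [ln (phi (y - x))]ln_phi; congr EFin; field.
by rewrite DgE lee_fin; lra.
Qed.

Lemma J_intD mu nu : (J mu nu = \int[mu]_x (D nu x)%:E + (1 / 2)%:E)%E.
Proof.
have mD := measurable_D nu; rewrite J_D.
under eq_integral do rewrite EFinD.
rewrite ge0_integralD//; ig; first by rewrite integral_cst_prob.
by move=> x _; rewrite lee_fin D_ge0.
Qed.

Lemma integral_D mu nu : (\int[mu]_x (D nu x)%:E = J mu nu - (1 / 2)%:E)%E.
Proof. by rewrite J_intD addeK. Qed.

Lemma MI_J mu : MI mu = (J mu mu - (1 / 2)%:E)%E.
Proof. by rewrite /MI; under eq_integral do rewrite dens_D; exact: integral_D. Qed.

End divergence.

(** * Mixtures, images and Gaussian inputs *)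

Section constructions.
Variable R : realType.
Notation leb := (@lebesgue_measure R).
Implicit Types mu nu : probability R R.

Lemma probability_of_measure (m : {measure set R -> \bar R}) : m setT = 1%E ->
  exists mu : probability R R, forall A, mu A = m A.
Proof.
(* The Dirac mass is what [mnormalize] falls back on when the total mass is 0 or infinite; here it
   is 1. *)
move=> m1; exists (mnormalize m (dirac (0 : R) : probability R R)) => A.
by rewrite /= /mnormalize m1 onee_eq0/= invr1 mule1.
Qed.

Lemma mixture_exists mu nu (t : R) : 0 <= t <= 1 ->
  exists mix : probability R R,
    (forall A, mix A = (1 - t)%:E * mu A + t%:E * nu A)%E /\
    (forall f : R -> \bar R, measurable_fun setT f -> (forall x, 0 <= f x)%E ->
      \int[mix]_x f x = (1 - t)%:E * \int[mu]_x f x + t%:E * \int[nu]_x f x)%E.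
Proof.
move=> /andP[t0 t1].
have t1' : 0 <= 1 - t by rewrite subr_ge0.
pose m := measure_add (mscale (NngNum t1') mu) (mscale (NngNum t0) nu).
have mE A : m A = ((1 - t)%:E * mu A + t%:E * nu A)%E by rewrite /m measure_addE.
have m1 : m setT = 1%E.
  rewrite mE (_ : mu setT = 1%E); last exact: probability_setT.
  by rewrite (_ : nu setT = 1%E) ?mule1 -?EFinD ?subrK//; exact: probability_setT.
have [mix mixE] := probability_of_measure m1.
exists mix; split => [A|f mf f0]; first by rewrite mixE; exact: mE.
transitivity (\int[m]_x f x)%E; first by apply: eq_measure_integral => A _ _; exact: mixE.
by rewrite ge0_integral_measure_add// !ge0_integral_mscale.
Qed.

Lemma pushforward_exists d (S : measurableType d) (mu : probability S R) (T : S -> R) :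
  measurable_fun setT T ->
  exists nu : probability R R,
    (forall A, nu A = mu (T @^-1` A)) /\
    (forall f : R -> \bar R, measurable_fun setT f -> (forall x, 0 <= f x)%E ->
      \int[nu]_x f x = \int[mu]_x f (T x))%E.
Proof.
move=> mT.
pose m : {measure set R -> \bar R} := measure_function_pushforward__canonical__measure_function_Measure mu mT.
have m1 : m setT = 1%E by rewrite /m/= /pushforward preimage_setT; exact: probability_setT.
have [nu nuE] := probability_of_measure m1.
exists nu; split => [A|f mf f0]; first exact: nuE.
transitivity (\int[m]_x f x)%E; first by apply: eq_measure_integral => A _ _; exact: nuE.
by rewrite ge0_integral_pushforward.
Qed.

(* by Tonelli on the subgraph of f *)
Lemma ge0_integral_density (mu : probability (measurableTypeR R) R) (p f : R -> R) :
  measurable_fun setT p -> (forall x, 0 <= p x) ->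
  measurable_fun setT f -> (forall x, 0 <= f x) ->
  (forall A, measurable A -> mu A = \int[leb]_(x in A) (p x)%:E)%E ->
  (\int[mu]_x (f x)%:E = \int[leb]_x (p x * f x)%:E)%E.
Proof.
move=> mp p0 mf f0 muE.
have mf1 := measurableT_comp mf (@measurable_fst _ _ R R).
have mp1 := measurableT_comp mp (@measurable_fst _ _ R R).
pose b (z : R * R) : bool := (0 <= z.2) && (z.2 < f z.1).
have mb : measurable_fun setT b by apply: measurable_and; meas.
pose g (z : R * R) : R := if b z then 1 else 0.
have mg : measurable_fun setT g by rewrite /g; meas.
have g0 z : 0 <= g z by rewrite /g; case: ifP.
have gf x : (\int[leb]_t (g (x, t))%:E = (f x)%:E)%E.
  transitivity (\int[leb]_(t in `[0%R, f x[) 1%:E)%E.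
    rewrite [RHS]integral_mkcond; apply: eq_integral => t _.
    by rewrite patchE mem_setE in_itv/= /g /b/=; case: ifP.
  rewrite integral_cst//= mul1e lebesgue_measure_itv/= lte_fin.
  by case: ltgtP (f0 x) => // [_|<-] _; rewrite ?oppr0 ?adde0.
transitivity (\int[mu]_x \int[leb]_t (g (x, t))%:E)%E.
  by apply: eq_integral => x _; rewrite gf.
rewrite (@fubini_tonelli _ _ _ _ _ mu leb (fun z => (g z)%:E)); [|by meas|by move=> z; rewrite lee_fin].
transitivity (\int[leb]_t \int[leb]_x (p x * g (x, t))%:E)%E; last first.
  rewrite -(@fubini_tonelli _ _ _ _ _ leb leb (fun z => (p z.1 * g z)%:E)); last 2 first.
  - by meas.
  - by move=> z; rewrite lee_fin mulr_ge0.
  apply: eq_integral => x _; rewrite EFinM -gf -ge0_integralZl//.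
  - have mgx : measurable_fun setT (fun t => g (x, t)).
      by apply: (measurableT_comp mg); exact: pair1_measurable.
    by meas.
  - by move=> t _; rewrite lee_fin.
  - by rewrite lee_fin.
apply: eq_integral => t _.
pose A := [set x | b (x, t)].
have mbt : measurable_fun setT (fun x => b (x, t)).
  by apply: (measurableT_comp mb); exact: pair2_measurable.
have mA : measurable A by rewrite -[A]setTI; exact: mbt.
transitivity (mu A).
  rewrite -[RHS]mul1e -integral_cst// [RHS]integral_mkcond; apply: eq_integral => x _.
  by rewrite patchE /g /= (_ : x \in A = b (x, t)) ?mem_setE//; case: ifP.
rewrite muE// [LHS]integral_mkcond; apply: eq_integral => x _.
by rewrite patchE (_ : x \in A = b (x, t)) ?mem_setE// /g; case: ifP; rewrite ?mulr1 ?mulr0.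
Qed.

Lemma integral_standard_normal (f : R -> R) : measurable_fun setT f -> (forall x, 0 <= f x) ->
  (\int[@normal_prob R 0 1]_x (f x)%:E = \int[leb]_x (phi x * f x)%:E)%E.
Proof.
move=> mf f0; rewrite (@ge0_integral_density (@normal_prob R 0 1) (@phi R) f)//.
- exact: measurable_phi.
- by move=> x; nonneg.
- move=> A mA; rewrite /= /normal_prob; apply: eq_integral => x _.
  by rewrite -phi_normal_pdf subr0.
Qed.

Lemma normal_pdf_phi (m s x : R) : 0 < s -> normal_pdf m s x = phi ((x - m) / s) / s.
Proof.
move=> s0; have h : phi 0 = (Num.sqrt (pi *+ 2))^-1 :> R.
  by have := phi_normal_pdf (0 : R) 0; rewrite subr0 => ->; rewrite normal_pdfE ?oner_neq0//
    /normal_peak /normal_fun subrr expr0n/= oppr0 mul0r expR0 mulr1 expr1n mul1r.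
rewrite normal_pdfE ?gt_eqF// /normal_peak /normal_fun phiE h.
rewrite -mulrnAr sqrtrM ?sqr_ge0// sqrtr_sqr gtr0_norm// invfM.
rewrite [s^-1 * _]mulrC -!mulrA; congr (_ * _); rewrite mulrC; congr (expR _ * _).
by field; rewrite gt_eqF.
Qed.

(** The input is a standard Gaussian scaled by the square root of [v], which covers [v = 0]; its
    output is N(0, 1 + v). The absence of atoms for [0 < v] is what later contradicts the required
    mass at 0. *)
Lemma gaussian_input (v : R) : 0 <= v -> exists nu : probability R R,
  [/\ E2 nu = v%:E, (forall y, Lf nu y = ln (1 + v) / 2 + y ^+ 2 / (2 * (1 + v)))
    & 0 < v -> forall x, nu [set x] = 0%E].
Proof.
move=> v0.
have [nu [nuE nuI]] := @pushforward_exists _ _ (@normal_prob R 0 1)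
  (fun x => Num.sqrt v * x) (ltac:(by meas)).
have w0 : 0 < 1 + v by lra.
have sw0 : 0 < Num.sqrt (1 + v) by rewrite sqrtr_gt0.
have f0 := @phi0_gt0 R.
exists nu; split.
- rewrite /E2 nuI; [|by meas|by move=> x; nonneg].
  rewrite integral_standard_normal; [|by meas|by move=> x; nonneg].
  transitivity (\int[leb]_x (v%:E * (x ^+ 2 * phi x)%:E))%E.
    apply: eq_integral => x _; rewrite -EFinM exprMn sqr_sqrtr//; congr EFin; ring.
  by rewrite ge0_integralZl//; ig; rewrite integral_sqr_phi mule1.
- move=> y.
  have pYn : pY nu y = phi (y / Num.sqrt (1 + v)) / Num.sqrt (1 + v).
    apply: EFin_inj; rewrite pYE nuI; [|by meas|by move=> x; nonneg].
    rewrite integral_standard_normal; [|by meas|by move=> x; nonneg].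
    (* Completing the square in [x]: the product of the two densities is the output density times a
       Gaussian density of mean [m] and standard deviation [1 / sqrt (1 + v)]. *)
    pose m := y * Num.sqrt v / (1 + v).
    transitivity (\int[leb]_x ((phi (y / Num.sqrt (1 + v)) / Num.sqrt (1 + v))%:E
       * (normal_pdf m (Num.sqrt (1 + v))^-1 x)%:E))%E.
      apply: eq_integral => x _; rewrite -EFinM; congr EFin.
      rewrite normal_pdf_phi ?invr_gt0// invrK.
      rewrite [phi x]phiE [phi (y - _)]phiE [phi (y / _)]phiE [phi ((x - m) * _)]phiE.
      set c := phi 0; set w := Num.sqrt (1 + v).
      have -> : c * expR (- (y / w) ^+ 2 / 2) / w * (c * expR (- ((x - m) * w) ^+ 2 / 2) * w) =
        c * c * (expR (- (y / w) ^+ 2 / 2) * expR (- ((x - m) * w) ^+ 2 / 2)).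
        by field; rewrite gt_eqF.
      rewrite -expRD.
      rewrite mulrACA -expRD; congr (_ * expR _).
      rewrite !exprMn exprVn sqr_sqrtr ?ltW// /m.
      have := sqr_sqrtr v0; set u := Num.sqrt v => uv.
      rewrite -uv; field; rewrite uv; lra.
    rewrite ge0_integralZl//.
    + by rewrite integral_normal_pdf mule1.
    + by have mn := measurable_normal_pdf m (Num.sqrt (1 + v))^-1; meas.
    + by move=> x _; rewrite lee_fin normal_pdf_ge0.
    + by rewrite lee_fin; apply: divr_ge0; [exact: phi_ge0|exact: ltW].
  have e : ln (Num.sqrt (1 + v)) = ln (1 + v) / 2.
    have : ln (Num.sqrt (1 + v) ^+ 2) = ln (1 + v) by rewrite sqr_sqrtr// ltW.
    by rewrite lnXn// mulr2n => h; lra.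
  rewrite /Lf pYn; have fy := phi_gt0 (y / Num.sqrt (1 + v)).
  have := ln_phi (y / Num.sqrt (1 + v)).
  move: fy; set a := phi (y / _); move: a f0; set c := phi 0; move: c => c a f0 fy la.
  have fq : 0 < a / Num.sqrt (1 + v) by exact: divr_gt0.
  rewrite (@ln_div R c _) ?posrE// (@ln_div R a _) ?posrE// e la.
  rewrite exprMn exprVn sqr_sqrtr ?ltW//.
  by field; lra.
- move=> vp x; rewrite nuE.
  have -> : (fun x0 => Num.sqrt v * x0) @^-1` [set x] = [set x / Num.sqrt v].
    have sv : Num.sqrt v != 0 by rewrite gt_eqF// sqrtr_gt0.
    apply/seteqP; split => z /=; first by move=> <-; field.
    by move=> ->; field.
  rewrite /= /normal_prob.
  by rewrite integral_set1.
Qed.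

End constructions.

(** * Distribution functions and Helly selection *)

Section cdf_probability.
Variables (R : realType) (f : R -> R).
Hypotheses (f_nd : nondecreasing f) (f_rc : right_continuous f).
Hypotheses (f_Ny : f @ -oo --> (0 : R)) (f_y : f @ +oo --> (1 : R)).

Let g := f.
#[local] HB.instance Definition _ := isCumulative.Build R _ R g f_nd f_rc.
#[local] HB.instance Definition _ := isCumulativeBounded.Build R 0 1 g f_Ny f_y.

Lemma probability_of_cdf : exists mu : probability R R, forall x, mu `]-oo, x]%classic = (f x)%:E.
Proof.
have [mu [muE _]] := @pushforward_exists R _ (measurableTypeR R)
  (lebesgue_stieltjes_measure g) id (@measurable_id _ _ setT).
exists mu => x; rewrite muE.
by rewrite -(cdf_lebesgue_stieltjes_id g x).
Qed.

End cdf_probability.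

Section helly.
Variable R : realType.
Notation leb := (@lebesgue_measure R).
Implicit Types mu nu : probability R R.

Lemma natSinv_lt (e : R) : 0 < e -> exists n : nat, n.+1%:R^-1 < e.
Proof. by move=> e0; have /filter_ex[n] := near_infty_natSinv_lt (PosNum e0); exists n. Qed.

(** An ultrafilter finer than the cofinite filter gives the limits at all rationals at once; then
    [k m >= m] is an index at which the first [m] rationals of an enumeration lie within
    [1 / (m + 1)] of their limits. *)
Lemma diagonal_selection (F : nat -> R -> R) : (forall n x, 0 <= F n x <= 1) ->
  exists k : nat -> nat, (forall m, (m <= k m)%N) /\
  exists G : rat -> R, forall r : rat, (fun m => F (k m) (ratr r)) @ \oo --> G r.
Proof.
move=> F01.
have [U [uU sU]] := ultraFilterLemma (eventually_filter : ProperFilter \oo).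
have key (r : rat) : exists g : R, F n (ratr r) @[n --> U] --> g.
  pose T := [set t : R | U [set n | t <= F n (ratr r)]].
  have T0 : T 0 by apply: filterE => n /=; case/andP: (F01 n (ratr r)).
  have T1 : ubound T 1.
    move=> t /(@filter_ex _ U)[n /= tn]; apply: le_trans tn _.
    by case/andP: (F01 n (ratr r)).
  have hT : has_sup T by split; [exists 0|exists 1].
  exists (sup T); apply/cvgrPdist_lt => e e0.
  have [t Tt te] := sup_adherent e0 hT.
  have nT : ~ T (sup T + e / 2).
    move=> h; have := ub_le_sup hT.2 h.
    by rewrite leNgt ltrDl divr_gt0.
  have {}nT : U (~` [set n | sup T + e / 2 <= F n (ratr r)]).
    by have [] := in_ultra_setVsetC [set n | sup T + e / 2 <= F n (ratr r)] uU.
  apply: filterS2 Tt nT => n /= h1 /negP; rewrite -ltNge => h2.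
  by rewrite ltr_distl; apply/andP; split; lra.
pose G r := sval (cid (key r)).
have hG r : F n (ratr r) @[n --> U] --> G r by rewrite /G; case: cid.
pose r_ (j : nat) : rat := odflt 0 (unpickle j).
have cond m : exists n, (m <= n)%N /\
    forall j : 'I_m, `|G (r_ j) - F n (ratr (r_ j))| < m.+1%:R^-1.
  apply: (@filter_ex _ U); apply: filterI.
    by apply: sU; exact: nbhs_infty_ge.
  apply: filter_forall => j; move/cvgrPdist_lt : (hG (r_ j)); apply.
  by rewrite invr_gt0.
exists (fun m => sval (cid (cond m))); split.
  by move=> m; case: cid => /= n [].
exists G => r; apply/cvgrPdist_lt => e e0.
near=> m.
case: cid => /= n [_ hn].
have jm : (pickle r < m)%N by near: m; exact: nbhs_infty_gt.
have rE : r_ (Ordinal jm) = r by rewrite /r_ pickleK.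
have := hn (Ordinal jm); rewrite rE => /lt_trans; apply.
near: m; exact: near_infty_natSinv_lt (PosNum e0).
Unshelve. all: by end_near. Qed.

Lemma markov_second_moment mu (g a : R) : (E2 mu <= g%:E)%E -> 0 < a ->
  (mu [set x : R | (a <= `|x|)%R] <= (g / a ^+ 2)%:E)%E.
Proof.
move=> hE a0.
have a20 : 0 < a ^+ 2 by rewrite exprn_gt0.
have m2 : measurable_fun setT (fun x : R => (x ^+ 2)%:E) by meas.
have := le_integral_abse mu measurableT m2 a20.
rewrite setTI (_ : [set x | _] = [set x : R | a <= `|x|]); last first.
  by apply/seteqP; split => x /=; rewrite lee_fin [`|x ^+ 2|]ger0_norm ?sqr_ge0//
    -[x ^+ 2]real_normK ?num_real// ler_sqr ?nnegrE// ltW.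
rewrite (_ : (\int[mu]_x _)%E = E2 mu); last first.
  by apply: eq_integral => x _; rewrite gee0_abs// lee_fin sqr_ge0.
rewrite -lee_pdivlMl// => /le_trans; apply.
by rewrite mulrC EFinM lee_pmul2l// lte_fin invr_gt0.
Qed.

(** By Tonelli, the set where [x = T r] is null because its sections in [r] are preimages of points.
    So for almost every [r], [T r] is a continuity point of the distribution function. *)
Lemma ae_no_atom mu (T : R -> R) : measurable_fun setT T ->
  (forall x, leb (T @^-1` [set x]) = 0%E) ->
  {ae leb, forall r, mu [set T r] = 0%E}.
Proof.
move=> mT T0.
have mT2 := measurableT_comp mT (@measurable_snd _ _ R R).
pose b (z : R * R) : bool := z.1 == T z.2.
have mb : measurable_fun setT b by apply: measurable_fun_eqr; meas.
pose g (z : R * R) : \bar R := (if b z then 1 else 0)%:E.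
have mg : measurable_fun setT g by rewrite /g; meas.
have g0 z : (0 <= g z)%E by rewrite /g lee_fin; case: ifP.
have gE r : (\int[mu]_x g (x, r) = mu [set T r])%E.
  rewrite -[RHS]mul1e -integral_cst// [RHS]integral_mkcond; apply: eq_integral => x _.
  rewrite patchE /g /b/=; case: ifPn => [/eqP ->|/eqP h]; first by rewrite mem_set.
  by rewrite memNset.
have mm : measurable_fun setT (fun r => mu [set T r]).
  apply: (eq_measurable_fun (fubini_G mu g)); first by move=> r _; exact: gE.
  exact: measurable_fun_fubini_tonelli_G.
have [+ _] := ae_eq_integral_abs leb measurableT mm; case.
  transitivity (\int[leb]_r \int[mu]_x g (x, r))%E.
    by apply: eq_integral => r _; rewrite gE gee0_abs.
  rewrite -(fubini_tonelli (m1:=mu) (m2:=leb) _ mg g0).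
  apply: integral0_eq => x _.
  transitivity (leb (T @^-1` [set x])); last exact: T0.
  rewrite -[RHS]mul1e -integral_cst//; last first.
    by rewrite -[X in measurable X]setTI; exact: mT.
  rewrite [RHS]integral_mkcond; apply: eq_integral => r _.
  rewrite patchE /g /b/=; case: ifPn => [/eqP h|/eqP h]; first by rewrite mem_set//= h.
  by rewrite memNset//= => h'; apply: h; rewrite h'.
move=> N [mN N0 sN]; exists N; split => // r /= hr; apply: sN => /= h; apply: hr.
exact: (h Logic.I).
Qed.

Definition cumul mu (x : R) : R := fine (mu `]-oo, x]%classic).

Lemma cumulE mu x : mu `]-oo, x]%classic = (cumul mu x)%:E.
Proof. by rewrite fineK// fin_num_measure. Qed.

Lemma cumul_itv mu x : 0 <= cumul mu x <= 1.
Proof. by rewrite -!lee_fin -cumulE measure_ge0 probability_le1. Qed.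

Lemma cumul_le mu (x y : R) : x <= y -> cumul mu x <= cumul mu y.
Proof.
move=> xy; rewrite -lee_fin -!cumulE le_measure ?inE//.
by apply: subset_itvl; rewrite bnd_simp.
Qed.

Lemma measurable_cumul mu : measurable_fun setT (cumul mu).
Proof.
by apply: nondecreasing_measurable => // x y xy; exact: cumul_le.
Qed.

Lemma cumulB mu (a b : R) : a <= b -> mu `]a, b]%classic = (cumul mu b - cumul mu a)%:E.
Proof.
move=> ab; rewrite EFinB -!cumulE.
have -> : `]a, b]%classic = `]-oo, b] `\` `]-oo, a].
  by rewrite -[RHS]setCK setCD setCitvl setUC -[LHS]setCK setCitv.
rewrite measureD ?setIidr//; first exact: subset_itvl.
by rewrite -ge0_fin_numE// fin_num_measure.
Qed.

(** In this form the output density depends on [mu] only through [cumul], with the integrable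
    dominating function [r * phi r]; convergence of distribution functions at almost every radius
    then suffices. *)
Lemma pY_cumul mu y : ((pY mu y)%:E = \int[leb]_r
  (if (0 < r)%R then r * phi r * (cumul mu (y + r) - cumul mu (y - r)) else 0)%R%:E)%E.
Proof.
pose b (z : R * R) : bool := [&& 0 < z.2, y - z.2 < z.1 & z.1 <= y + z.2].
have mb : measurable_fun setT b.
  by apply: measurable_and; [meas|apply: measurable_and; meas].
pose g (z : R * R) : \bar R := (if b z then z.2 * phi z.2 else 0)%:E.
have mg : measurable_fun setT g by rewrite /g; meas.
have g0 z : (0 <= g z)%E.
  by rewrite /g lee_fin; case: ifP => // /and3P[z0 _ _]; apply: mulr_ge0; [exact: ltW|exact: phi_ge0].
have mrp : measurable_fun setT (fun r : R => (r * phi r)%:E) by meas.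
rewrite pYE; transitivity (\int[mu]_x \int[leb]_r g (x, r))%E.
  apply: eq_integral => x _.
  have -> : phi (y - x) = phi `|y - x| by rewrite phiE [RHS]phiE real_normK ?num_real.
  rewrite -integral_rphi//.
  (* []y - r, y + r]] is half-open: a point left of [y] needs [r > y - x], a point right of it only
     [r >= x - y]. The open and closed rays differ by a null set. *)
  have [xy|xy|xy] := ltgtP x y.
  - rewrite -integral_itv_obnd_cbnd; last exact: measurable_funTS.
    rewrite [LHS]integral_mkcond; apply: eq_integral => r _.
    rewrite patchE /g /b /= mem_setE in_itv/= andbT.
    rewrite (_ : (_ < r) = [&& 0 < r, y - r < x & x <= y + r]); first by case: ifP.
    rewrite gtr0_norm ?subr_gt0//; apply/idP/and3P => [h|[]]; last by lra.
    by split; lra.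
  - rewrite [LHS]integral_mkcond; apply: eq_integral => r _.
    rewrite patchE /g /b /= mem_setE in_itv/= andbT.
    rewrite (_ : (_ <= r) = [&& 0 < r, y - r < x & x <= y + r]); first by case: ifP.
    rewrite ltr0_norm ?subr_lt0//; apply/idP/and3P => [h|[]]; last by lra.
    by split; lra.
  - rewrite -xy subrr normr0 -integral_itv_obnd_cbnd; last exact: measurable_funTS.
    rewrite [LHS]integral_mkcond; apply: eq_integral => r _.
    rewrite patchE /g /b /= mem_setE in_itv/= andbT -xy.
    rewrite (_ : [&& _, _ & _] = (0 < r)); first by case: ifP.
    by apply/and3P/idP => [[]//|h]; split; lra.
rewrite (fubini_tonelli (m1:=mu) (m2:=leb) _ mg g0).
apply: eq_integral => r _; case: ifPn => r0; last first.
  by apply: integral0_eq => x _; rewrite /g /b/= (negbTE r0).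
rewrite EFinM -cumulB; last by lra.
rewrite -integral_cst// [RHS]integral_mkcond; apply: eq_integral => x _.
by rewrite patchE /g /b/= mem_setE in_itv/= r0/=; case: ifP.
Qed.

Lemma cumul_markov mu (g x : R) : (E2 mu <= g%:E)%E -> 0 < x ->
  1 - g / x ^+ 2 <= cumul mu x /\ cumul mu (- x) <= g / x ^+ 2.
Proof.
move=> hE x0; have := markov_second_moment hE x0; set A := [set z | _] => hA.
have mA : measurable A.
  rewrite -[A]setTI; apply: (@measurable_fun_ler _ _ _ setT (cst x) (fun z : R => `|z|)) => //.
split; rewrite -lee_fin -cumulE.
  have -> : `]-oo, x]%classic = ~` `]x, +oo[%classic by rewrite setCitvr.
  rewrite probability_setC// EFinB leeB// (le_trans _ hA)// le_measure ?inE//.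
  by move=> z /=; rewrite in_itv/= andbT => xz; rewrite /A/= (le_trans (ltW xz))// ler_norm.
rewrite (le_trans _ hA)// le_measure ?inE// => z /=; rewrite in_itv/= /A/= => zx.
by rewrite -normrN (le_trans _ (ler_norm _))// lerNr.
Qed.

(** Convergence is stated for output densities, the form in which Fatou's lemma is applied. The
    uniform second moment bound prevents mass from escaping, and mass at the closed set {0} cannot
    drop in the limit, so the duty cycle constraint survives. *)
Lemma helly (mu_ : nat -> probability R R) (g q : R) :
  (forall n, E2 (mu_ n) <= g%:E)%E -> (forall n, q%:E <= mu_ n [set 0%R])%E ->
  exists (k : nat -> nat) (mu : probability R R),
    [/\ forall m, (m <= k m)%N, forall y, pY (mu_ (k m)) y @[m --> \oo] --> pY mu y
      & (q%:E <= mu [set 0%R])%E].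
Proof.
move=> hE hq.
have g0 : 0 <= g.
  by rewrite -lee_fin (le_trans _ (hE 0%N))//; apply: integral_ge0 => x _; nonneg.
have [k [km [G hG]]] := diagonal_selection (fun n x => cumul_itv (mu_ n) x).
have G01 r : 0 <= G r <= 1.
  apply/andP; split.
    apply: (ler_cvg_to (cvg_cst _) (hG r)); apply: nearW => m.
    by case/andP: (cumul_itv (mu_ (k m)) (ratr r)).
  apply: (ler_cvg_to (hG r) (cvg_cst _)); apply: nearW => m.
  by case/andP: (cumul_itv (mu_ (k m)) (ratr r)).
have Gle r s : ratr r <= ratr s :> R -> G r <= G s.
  move=> rs; apply: (ler_cvg_to (hG r) (hG s)); apply: nearW => m.
  exact: cumul_le.
(* Limits are known only at rationals; the infimum over rationals strictly to the right makes the
   candidate right-continuous. *)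
pose S (x : R) := [set G r | r in [set r : rat | x < ratr r]].
have Slb x : has_lbound (S x) by exists 0 => _ [r _ <-]; case/andP: (G01 r).
have rat_gt (x y : R) : x < y -> exists r : rat, x < ratr r < y.
  by move=> /rat_in_itvoo[r]; rewrite in_itv/= => h; exists r.
have S0 x : S x !=set0.
  have [|r /andP[xr _]] := rat_gt x (x + 1); first by lra.
  by exists (G r), r.
pose f x := inf (S x).
have f_le x r : x < ratr r -> f x <= G r by move=> xr; apply: ge_inf => //; exists r.
have f_ge x c : (forall r, x < ratr r -> c <= G r) -> c <= f x.
  by move=> h; apply: lb_le_inf => // _ [r xr <-]; exact: h.
have f_adh x e : 0 < e -> exists2 r, x < ratr r & G r < f x + e.
  by move=> e0; have [|_ [r xr <-] h] := @inf_adherent R (S x) e e0 _; [split|exists r].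
have G_f x r : ratr r <= x -> G r <= f x.
  by move=> rx; apply: f_ge => s xs; apply: Gle; apply: le_trans rx (ltW xs).
have f_nd : nondecreasing f.
  by move=> x y xy; apply: f_ge => r yr; apply: f_le; apply: le_lt_trans xy yr.
have f_rc : right_continuous f.
  move=> x; apply/cvgrPdist_lt => e e0.
  have [r xr Gr] := f_adh x e e0.
  near=> t.
  have xt : x < t by near: t; exact: nbhs_right_gt.
  have tr : t < ratr r by near: t; exact: nbhs_right_lt.
  have := f_le _ _ tr; have := f_nd _ _ (ltW xt) => h1 h2.
  by rewrite distrC ger0_norm; lra.
have f_hi (x : R) : 0 < x -> 1 - g / x ^+ 2 <= f x.
  move=> x0; apply: f_ge => r xr.
  apply: (ler_cvg_to (cvg_cst _) (hG r)); apply: nearW => m.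
  apply: le_trans (cumul_le _ (ltW xr)).
  by have [] := cumul_markov (hE (k m)) x0.
(* The factor 2 leaves room for a rational between [- (2 * x)] and [- x], where the tail bound
   applies. *)
have f_lo (x : R) : 0 < x -> f (- (2 * x)) <= g / x ^+ 2.
  move=> x0; have [|r /andP[xr rx]] := rat_gt (- (2 * x)) (- x); first by lra.
  apply: le_trans (f_le _ _ xr) _.
  apply: (ler_cvg_to (hG r) (cvg_cst _)); apply: nearW => m.
  apply: le_trans (cumul_le _ (ltW rx)) _.
  by have [] := cumul_markov (hE (k m)) x0.
have f01 x : 0 <= f x <= 1.
  apply/andP; split; first by apply: f_ge => r _; case/andP: (G01 r).
  have [s xs _] := f_adh x 1 ltr01.
  by apply: le_trans (f_le _ _ xs) _; case/andP: (G01 s).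
have small e : 0 < e -> exists2 x : R, 0 < x & forall y, x <= y -> g / y ^+ 2 < e.
  move=> e0; exists (1 + g / e); first by rewrite ltr_pwDl// divr_ge0// ltW.
  move=> y hy; have ge0 : 0 <= g / e by rewrite divr_ge0// ltW.
  have y1 : 1 <= y by lra.
  rewrite ltr_pdivrMr ?exprn_gt0//; last by lra.
  apply: (@lt_le_trans _ _ (e * (1 + g / e))).
    by rewrite mulrDr mulrCA divff ?gt_eqF// mulr1 mulr1; lra.
  rewrite ler_pM2l// (le_trans hy)// expr2 ler_peMr//; lra.
have f_Ny : f @ -oo --> (0 : R).
  apply/cvgrPdist_lt => e e0; have [x x0 hx] := small e e0.
  near=> t; have tx : t <= - (2 * x) by near: t; exact: (nbhs_ninfty_le (num_real _)).
  have := f_lo (- t / 2); rewrite (_ : - (2 * _) = t); last by field.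
  move=> /(_ ltac:(lra)); have /(_ ltac:(lra)) := hx (- t / 2).
  by case/andP: (f01 t) => f0 _ h1 h2; rewrite sub0r normrN ger0_norm//; lra.
have f_y : f @ +oo --> (1 : R).
  apply/cvgrPdist_lt => e e0; have [x x0 hx] := small e e0.
  near=> t; have tx : x <= t by near: t; exact: (nbhs_pinfty_ge (num_real _)).
  have := f_hi t; move=> /(_ ltac:(lra)); have /(_ ltac:(lra)) := hx t.
  by case/andP: (f01 t) => _ f1 h1 h2; rewrite ger0_norm//; lra.
have [mu muE] := probability_of_cdf f_nd f_rc f_Ny f_y.
have cE x : cumul mu x = f x by rewrite /cumul muE.
exists k, mu; split => //.
- have conv x : mu [set x] = 0%E -> cumul (mu_ (k m)) x @[m --> \oo] --> f x.
    move=> x0; apply/cvgrPdist_lt => e e0.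
    (* A point without mass is a point of left continuity, seen by exhausting []-oo, x[] by closed
       rays; [cumul (mu_ (k m)) x] is then squeezed between values at rationals [r < x < s]. *)
    have [x' xx' fx'] : exists2 x', x' < x & f x - e / 2 < f x'.
      pose A n : set R := `]-oo, x - n.+1%:R^-1]%classic.
      have AU : \bigcup_n A n = `]-oo, x[%classic.
        apply/seteqP; split => [t [n _]|t]; rewrite /A/= !in_itv/=.
          by move=> /le_lt_trans; apply; rewrite ltrBlDr ltrDl.
        rewrite -subr_gt0 => /natSinv_lt[n hn].
        by exists n => //; rewrite /A/= in_itv/= lerBrDr addrC -lerBrDr ltW.
      have hm : mu `]-oo, x[%classic = (f x)%:E.
        have -> : (f x)%:E = mu (`]-oo, x[%classic `|` [set x]) by rewrite setUitv1// muE.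
        by apply/esym/measureU0.
      have hA n : mu (A n) = (f (x - n.+1%:R^-1))%:E by rewrite muE.
      have hc : (mu \o A) n @[n --> \oo] --> (f x)%:E.
        rewrite -hm -AU; apply: nondecreasing_cvg_mu.
        - by move=> n; exact: measurable_itv.
        - by rewrite AU; exact: measurable_itv.
        - move=> a b ab; apply/subsetPset; apply: subset_itvl; rewrite bnd_simp.
          by rewrite lerD2l lerN2 lef_pV2 ?posrE// ler_nat.
      have {}hc : fine (mu (A n)) @[n --> \oo] --> f x by exact: fine_cvg.
      have e20 : 0 < e / 2 by rewrite divr_gt0.
      move/cvgrPdist_lt : hc => /(_ _ e20) /filter_ex[n].
      rewrite hA /= => h; exists (x - n.+1%:R^-1); first by rewrite ltrBlDr ltrDl.
      by move: h; rewrite ltr_distl; lra.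
    have [r /andP[x'r rx]] := rat_gt _ _ xx'.
    have [s xs hs] : exists2 s : rat, x < ratr s & G s < f x + e / 2.
      by apply: f_adh; rewrite divr_gt0.
    have hr := f_le _ _ x'r.
    near=> m.
    have h1 : `|G r - cumul (mu_ (k m)) (ratr r)| < e / 2.
      by near: m; move/cvgrPdist_lt : (hG r); apply; rewrite divr_gt0.
    have h2 : `|G s - cumul (mu_ (k m)) (ratr s)| < e / 2.
      by near: m; move/cvgrPdist_lt : (hG s); apply; rewrite divr_gt0.
    have h3 := cumul_le (mu_ (k m)) (ltW rx).
    have h4 := cumul_le (mu_ (k m)) (ltW xs).
    move: h1 h2; rewrite !ltr_distl => /andP[h5 h6] /andP[h7 h8].
    by apply/andP; split; lra.
  move=> y.
  pose h (nu : probability R R) (r : R) : \bar R :=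
    (if (0 < r)%R then r * phi r * (cumul nu (y + r) - cumul nu (y - r)) else 0)%R%:E.
  have mh nu : measurable_fun setT (h nu).
    have mc := measurable_cumul nu.
    have m1 : measurable_fun setT (fun r : R => cumul nu (y + r)).
      by apply: (measurableT_comp mc); meas.
    have m2 : measurable_fun setT (fun r : R => cumul nu (y - r)).
      by apply: (measurableT_comp mc); meas.
    by rewrite /h; meas.
  pose dom (r : R) : \bar R := (if 0 < r then r * phi r else 0)%:E.
  have dom0 r : (0 <= dom r)%E.
    by rewrite /dom lee_fin; case: ifPn => // r0; apply: mulr_ge0; [exact: ltW|exact: phi_ge0].
  have mdom : measurable_fun setT dom by rewrite /dom; meas.
  have idom : leb.-integrable setT dom.
    apply/integrableP; split => //.
    rewrite (_ : (\int[leb]_x `|dom x|)%E = (phi 0)%:E) ?ltry//.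
    transitivity (\int[leb]_x dom x)%E; first by apply: eq_integral => r _; rewrite gee0_abs.
    rewrite -integral_rphi// -integral_itv_obnd_cbnd; last by apply: measurable_funTS; meas.
    rewrite [RHS]integral_mkcond; apply: eq_integral => r _.
    by rewrite patchE /dom mem_setE in_itv/= andbT; case: ifP.
  have ae1 : {ae leb, forall r, mu [set y + r] = 0%E}.
    apply: ae_no_atom; first by meas.
    move=> x; rewrite (_ : _ @^-1` _ = [set x - y]) ?lebesgue_measure_set1//.
    by apply/seteqP; split => r /= h'; lra.
  have ae2 : {ae leb, forall r, mu [set y - r] = 0%E}.
    apply: ae_no_atom; first by meas.
    move=> x; rewrite (_ : _ @^-1` _ = [set y - x]) ?lebesgue_measure_set1//.
    by apply/seteqP; split => r /= h'; lra.
  have cvh : {ae leb, forall r, setT r -> h (mu_ (k m)) r @[m --> \oo] --> h mu r}.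
    apply: (@filterS2 _ _ (ae_filter_ringOfSetsType leb) _ _ _ _ ae1 ae2) => r h1 h2 _; rewrite /h; case: ifPn => r0; last exact: cvg_cst.
    apply: cvg_EFin; first exact: nearW.
    by apply: cvgMr; rewrite !cE; apply: cvgB; exact: conv.
  have leh : {ae leb, forall r (n : nat), setT r -> (`|h (mu_ (k n)) r| <= dom r)%E}.
    apply: aeW => r n _; rewrite /h /dom; case: ifPn => r0; last by rewrite abse0.
    have rp : 0 <= r * phi r by apply: mulr_ge0; [exact: ltW|exact: phi_ge0].
    rewrite lee_fin normrM [`|r * phi r|]ger0_norm//.
    have /andP[a1 a2] := cumul_itv (mu_ (k n)) (y + r).
    have /andP[a3 a4] := cumul_itv (mu_ (k n)) (y - r).
    by rewrite ler_piMr// ler_norml; apply/andP; split; lra.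
  have [_ _] := @dominated_convergence _ _ _ leb setT measurableT
    (fun m => h (mu_ (k m))) (h mu) dom (fun m => mh (mu_ (k m))) (mh mu) cvh idom leh.
  rewrite /= -pY_cumul.
  under eq_fun do rewrite -pY_cumul.
  by move=> h'; exact: (fine_cvg h').
(* The mass at 0 of each [mu_ n] lies in []r, s]] for rationals [r < 0 < s], so at least [q] stays
   in []- e, e]]; shrinking [e] leaves the atom. *)
have qe (e : R) : 0 < e -> q <= f e - f (- e).
  move=> e0; have [|r /andP[r1 r2]] := rat_gt (- e) 0; first by lra.
  have [s /andP[s1 s2]] := rat_gt _ _ e0.
  have h1 := f_le _ _ r1; have h2 := G_f _ _ (ltW s2).
  suff : q <= G s - G r by lra.
  apply: (ler_cvg_to (cvg_cst _) (cvgB (hG s) (hG r))); apply: nearW => m.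
  rewrite -lee_fin -cumulB; last by lra.
  apply: le_trans (hq (k m)) _; apply: le_measure; rewrite ?inE//.
  by move=> _ ->; rewrite /= in_itv/= r2 ltW.
pose A n : set R := `](- n.+1%:R^-1), n.+1%:R^-1]%classic.
have AU : \bigcap_n A n = [set 0].
  apply/seteqP; split => [t ht|t -> n _]; rewrite /A/= ?in_itv/=; last first.
    by rewrite oppr_lt0 invr_gt0 ltr0n/= invr_ge0.
  apply/eqP/negPn/negP; rewrite -normr_gt0 => /natSinv_lt[n].
  have := ht n Logic.I; rewrite /A/= in_itv/= => /andP[a1 a2].
  by rewrite ltNge ler_norml (ltW a1) a2.
have hc : (mu \o A) n @[n --> \oo] --> mu [set 0].
  rewrite -AU; apply: nonincreasing_cvg_mu.
  - by rewrite (le_lt_trans (probability_le1 _ _)) ?ltry//; exact: measurable_itv.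
  - by move=> n; exact: measurable_itv.
  - by rewrite AU.
  - move=> a b ab; apply/subsetPset => t; rewrite /A/= !in_itv/=.
    have : b.+1%:R^-1 <= a.+1%:R^-1 :> R by rewrite lef_pV2 ?posrE// ler_nat.
    move=> ba /andP[t1 t2]; apply/andP; split; last exact: le_trans t2 ba.
    by apply: le_lt_trans t1; rewrite lerN2.
apply: (lee_cvg_to (cvg_cst q%:E) hc); apply: nearW => n /=.
rewrite cumulB ?lee_fin ?cE; first by apply: qe; rewrite invr_gt0.
have i0 : 0 < n.+1%:R^-1 :> R by rewrite invr_gt0.
by apply: le_trans (ltW i0); rewrite oppr_le0 ltW.
Unshelve. all: by end_near. Qed.

End helly.

(** * Existence of a maximizer *)

Section maximizer.
Variable R : realType.
Notation leb := (@lebesgue_measure R).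
Implicit Types mu nu : probability R R.

Lemma fatou_bound (f_ : nat -> R -> R) (f : R -> R) (c_ : nat -> R) (c : R) :
  (forall n, measurable_fun setT (f_ n)) -> (forall n y, 0 <= f_ n y) ->
  (forall y, f_ n y @[n --> \oo] --> f y) ->
  (forall n, \int[leb]_y (f_ n y)%:E <= (c_ n)%:E)%E -> c_ n @[n --> \oo] --> c ->
  (\int[leb]_y (f y)%:E <= c%:E)%E.
Proof.
move=> mf f0 ff fc cc.
have := @fatou _ _ _ leb setT measurableT (fun n y => (f_ n y)%:E).
move=> /(_ (fun n => iffRL (measurable_EFinP _ _) (mf n)) _).
have h0 (n : nat) (x : measurableTypeR R) : [set: measurableTypeR R] x -> (0 <= (f_ n x)%:E)%E.
  by rewrite lee_fin.
move=> /(_ h0) h.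
have -> : (\int[leb]_y (f y)%:E = \int[leb]_y limn_einf (fun n => (f_ n y)%:E))%E.
  apply: eq_integral => y _; apply/esym/(cvg_limn_einf_sup _).1.
  by apply: cvg_EFin; [exact: nearW|exact: ff].
apply: le_trans h _; apply/lee_addgt0Pr => e e0.
rewrite limn_einf_lim; apply: lime_le; first exact: is_cvg_einfs.
apply: nearW => n.
have [m nm hm] : exists2 m, (n <= m)%N & c_ m < c + e.
  have : \forall m \near \oo, (n <= m)%N /\ c_ m < c + e.
    near=> m; split; first by near: m; exact: nbhs_infty_ge.
    have : `|c - c_ m| < e by near: m; move/cvgrPdist_lt : cc; exact.
    by rewrite ltr_distl; lra.
  by move=> /filter_ex[m [? ?]]; exists m.
apply: (@le_trans _ _ (\int[leb]_y (f_ m y)%:E)%E).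
  by apply: ereal_inf_lbound; exists m.
by apply: le_trans (fc m) _; rewrite -EFinD lee_fin ltW.
Unshelve. all: by end_near. Qed.

Lemma Lf_ln nu y : Lf nu y = ln (phi 0) - ln (pY nu y).
Proof. by rewrite /Lf ln_div// posrE ?phi0_gt0 ?pY_gt0. Qed.

Lemma cvg_Lf (mu_ : nat -> probability R R) mu y :
  pY (mu_ n) y @[n --> \oo] --> pY mu y -> Lf (mu_ n) y @[n --> \oo] --> Lf mu y.
Proof.
move=> h; rewrite Lf_ln; under eq_fun do rewrite Lf_ln.
apply: cvgB; first exact: cvg_cst.
by apply: continuous_cvg => //; apply: continuous_ln; exact: pY_gt0.
Qed.

Lemma E2_ge0 mu : (0 <= E2 mu)%E.
Proof. by apply: integral_ge0 => x _; nonneg. Qed.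

Lemma J_quadratic mu nu (a b : R) : 0 <= a -> 0 <= b -> (forall y, Lf nu y = a + b * y ^+ 2) ->
  (J mu nu = a%:E + b%:E * (1 + E2 mu))%E.
Proof.
move=> a0 b0 hL; have mp := measurable_pY mu.
rewrite /J -pY_second_moment.
transitivity (\int[leb]_y (a%:E * (pY mu y)%:E + b%:E * (pY mu y * y ^+ 2)%:E))%E.
  by apply: eq_integral => y _; rewrite hL -!EFinM -EFinD; congr EFin; ring.
rewrite ge0_integralD//; ig.
by rewrite !ge0_integralZl//; ig; rewrite integral_pY mule1.
Qed.

(** The surprisal of a Gaussian output is quadratic, so [J mu nu] sees [mu] only through its second
    moment, with slope [1 / (2 (1 + v))]. *)
Lemma gaussian_reference (v : R) : 0 <= v -> exists nu : probability R R,
  [/\ E2 nu = v%:E,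
      forall mu (e : R), E2 mu = e%:E -> J mu nu = (ln (1 + v) / 2 + (2 * (1 + v))^-1 * (1 + e))%:E
    & 0 < v -> forall x, nu [set x] = 0%E].
Proof.
move=> v0; have [nu [h1 h2 h3]] := gaussian_input v0; exists nu; split => // mu e he.
transitivity ((ln (1 + v) / 2)%:E + ((2 * (1 + v))^-1)%:E * (1 + E2 mu))%E; last first.
  by rewrite he.
apply: J_quadratic.
- by rewrite divr_ge0// ln_ge0//; lra.
- by rewrite invr_ge0; lra.
- by move=> y; rewrite h2 mulrC [in RHS]mulrC; congr (_ + _); rewrite mulrC.
Qed.

(** Gibbs' inequality against the Gaussian reference; in terms of [MI] this is the classical bound
    [ln (1 + v) / 2]. *)
Lemma J_self_le mu (v : R) : 0 <= v -> (E2 mu <= v%:E)%E ->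
  (J mu mu <= (ln (1 + v) / 2 + 1 / 2)%:E)%E.
Proof.
move=> v0 hE; have [nu [_ hJ _]] := gaussian_reference v0.
have fE : E2 mu = (fine (E2 mu))%:E.
  by rewrite fineK// ge0_fin_numE ?E2_ge0// (le_lt_trans hE)// ltry.
apply: le_trans (gibbs mu nu) _; rewrite (hJ _ _ fE) lee_fin lerD2l.
have b0 : 0 < (2 * (1 + v))^-1 by rewrite invr_gt0; lra.
apply: (@le_trans _ _ ((2 * (1 + v))^-1 * (1 + v))).
  by rewrite ler_pM2l// lerD2l -lee_fin -fE.
rewrite le_eqVlt; apply/orP; left; apply/eqP.
by field; lra.
Qed.

Lemma E2_dirac0 : E2 (dirac (0 : R) : probability R R) = 0%E.
Proof. by rewrite /E2 integral_dirac//; [rewrite expr0n/= mule0|meas]. Qed.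

Lemma maximizer_exists (g q : R) : 0 <= g -> q <= 1 -> exists mu0 : probability R R,
  Lambda g q mu0 /\ forall mu, Lambda g q mu -> (J mu mu <= J mu0 mu0)%E.
Proof.
move=> g0 q1.
have Lfin mu : Lambda g q mu -> (E2 mu < +oo)%E.
  by move=> [_ h]; apply: le_lt_trans h _; rewrite ltry.
pose S := [set fine (J mu mu) | mu in Lambda g q].
have S0 : S !=set0.
  exists (fine (J (dirac (0 : R) : probability R R) (dirac (0 : R) : probability R R))).
  exists (dirac (0 : R) : probability R R) => //; split; last by rewrite [X in (X <= _)%E]E2_dirac0 lee_fin.
  by rewrite /= diracE mem_set// lee_fin.
have Sub : ubound S (ln (1 + g) / 2 + 1 / 2).
  move=> _ [mu Lmu <-]; rewrite -lee_fin fineK; last exact: J_fin (Lfin _ Lmu).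
  by apply: J_self_le => //; case: Lmu.
have hS : has_sup S by split => //; exists (ln (1 + g) / 2 + 1 / 2).
have pick n : exists mu, Lambda g q mu /\ sup S - n.+1%:R^-1 < fine (J mu mu).
  have [|_ [mu Lmu <-] h] := @sup_adherent R S n.+1%:R^-1 _ hS; first by rewrite invr_gt0.
  by exists mu.
pose mu_ n := sval (cid (pick n)).
have Lmu_ n : Lambda g q (mu_ n) by rewrite /mu_; case: cid => ? [].
have Jmu_ n : sup S - n.+1%:R^-1 < fine (J (mu_ n) (mu_ n)) by rewrite /mu_; case: cid => ? [].
have [k [mu [km hp hq]]] := helly (fun n => (Lmu_ n).2) (fun n => (Lmu_ n).1).
have E2mu : (E2 mu <= g%:E)%E.
  have := @fatou_bound (fun n y => pY (mu_ (k n)) y * y ^+ 2) (fun y => pY mu y * y ^+ 2)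
     (fun=> 1 + g) (1 + g).
  rewrite pY_second_moment => h.
  have : (1 + E2 mu <= 1%:E + g%:E)%E.
    rewrite -EFinD; apply: h.
    - by move=> n; have mp := measurable_pY (mu_ (k n)); meas.
    - by move=> n y; nonneg.
    - by move=> y; apply: cvgMl; exact: hp.
    - by move=> n; rewrite pY_second_moment EFinD leeD2l//; exact: (Lmu_ (k n)).2.
    - exact: cvg_cst.
  by rewrite leeD2lE.
have Lmu : Lambda g q mu by split.
have fJ := J_fin mu (Lfin _ Lmu).
(* Fatou is applied to [kl (mu_ (k n)) nu] with a Gaussian reference [nu]; the second moment lost in
   the limit costs at most [g / (2 * (1 + v))]. *)
have key (v : R) : 0 <= v -> sup S <= fine (J mu mu) + g / (2 * (1 + v)).
  move=> v0; have [nu [_ hJ _]] := gaussian_reference v0.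
  have {hJ}[a [b [b0 bE hJ]]] : exists a b : R, [/\ 0 <= b, b = (2 * (1 + v))^-1 &
      forall mu e, E2 mu = e%:E -> J mu nu = (a + b * (1 + e))%:E].
    by exists (ln (1 + v) / 2), (2 * (1 + v))^-1; split => //; rewrite invr_ge0; lra.
  have fE mu' : Lambda g q mu' -> (E2 mu' = (fine (E2 mu'))%:E)%E.
    by move=> h; rewrite fineK// ge0_fin_numE ?E2_ge0//; exact: Lfin.
  have h : (\int[leb]_y (kl mu nu y)%:E <= (a + b * (1 + g) - sup S)%:E)%E.
    apply: (@fatou_bound (fun n => kl (mu_ (k n)) nu) _
       (fun n => a + b * (1 + g) - sup S + n.+1%:R^-1)).
    - by move=> n; exact: measurable_kl.
    - by move=> n y; exact: kl_ge0.
    - move=> y; rewrite /kl; apply: cvgD; last exact: cvg_cst.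
      apply: cvgB; last exact: hp.
      apply: cvgM; first exact: hp.
      by apply: cvgB; [exact: cvg_cst|exact: cvg_Lf].
    - move=> n; have L := Lmu_ (k n).
      have := gibbsE (mu_ (k n)) nu; rewrite (hJ _ _ (fE _ L)) -(fineK (J_fin (mu_ (k n)) (Lfin _ L))).
      have K0 : (0 <= \int[leb]_y (kl (mu_ (k n)) nu y)%:E)%E.
        by apply: integral_ge0 => y _; rewrite lee_fin kl_ge0.
      have E2g : fine (E2 (mu_ (k n))) <= g by rewrite -lee_fin -(fE _ L); exact: L.2.
      have Jn := Jmu_ (k n).
      have nk : (k n).+1%:R^-1 <= n.+1%:R^-1 :> R by rewrite lef_pV2 ?posrE// ler_nat ltnS.
      move: K0; case: (\int[leb]_y _)%E => [K|//|//] K0; rewrite -EFinD.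
      move=> [] e; rewrite lee_fin.
      have : b * (1 + fine (E2 (mu_ (k n)))) <= b * (1 + g) by rewrite ler_wpM2l// lerD2l.
      by move: nk Jn; move: ((k n).+1%:R^-1) (n.+1%:R^-1) => i j; lra.
    - rewrite -[X in _ --> X]addr0; apply: cvgD; first exact: cvg_cst.
      exact: cvg_harmonic.
  have := gibbsE mu nu; rewrite (hJ _ _ (fE _ Lmu)) -(fineK fJ).
  have K0 : (0 <= \int[leb]_y (kl mu nu y)%:E)%E.
    by apply: integral_ge0 => y _; rewrite lee_fin kl_ge0.
  have E0 : 0 <= fine (E2 mu) by rewrite fine_ge0// E2_ge0.
  move: K0 h; case: (\int[leb]_y _)%E => [K|//|//] K0; rewrite -EFinD lee_fin.
  move=> h [] e; rewrite -bE.
  have : 0 <= b * fine (E2 mu) by rewrite mulr_ge0.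
  by lra.
exists mu; split => // mu' Lmu'.
rewrite -(fineK fJ) -(fineK (J_fin mu' (Lfin _ Lmu'))) lee_fin.
apply: (@le_trans _ _ (sup S)); first by apply: ub_le_sup; [exact: hS.2|exists mu'].
rewrite leNgt; apply/negP => h.
pose d := sup S - fine (J mu mu).
have d0 : 0 < d by rewrite subr_gt0.
(* With [d] the supposed gap, [v = g / d] makes the cost [g d / (2 (d + g))], which is smaller than
   [d]. *)
have := key (g / d); rewrite divr_ge0 ?(ltW d0)// => /(_ isT).
have -> : g / (2 * (1 + g / d)) = g * d / (2 * (d + g)) by field; rewrite /d; apply/andP; split; lra.
suff : g * d / (2 * (d + g)) < d by rewrite /d; lra.
rewrite ltr_pdivrMr; last by lra.
by rewrite mulrC ltr_pM2l//; lra.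
Qed.

End maximizer.

(** A supporting line for [DD] as a function of [x ^+ 2]: by the two-point inequality, every slope
    from [(G, v)] to a point beyond [G] is at most every slope to a point before [G]. The supremum
    of the former, cut off at 0, serves as [l]. *)
Lemma multiplier_of_two_point (R : realType) (DD : R -> R) (v G : R) : 0 < G ->
  (forall w a b : R, 0 <= w <= 1 -> (1 - w) * a ^+ 2 + w * b ^+ 2 <= G ->
    (1 - w) * DD a + w * DD b <= v) ->
  exists2 l : R, 0 <= l & forall x, DD x <= v + l * (x ^+ 2 - G).
Proof.
move=> G0 two_pt.
have one (a : R) : a ^+ 2 <= G -> DD a <= v.
  move=> ha; have := @two_pt 0 a a; rewrite lexx ler01 => /(_ isT).
  by rewrite subr0 !mul1r !mul0r !addr0; exact.
pose S := [set (DD b - v) / (b ^+ 2 - G) | b in [set b : R | G < b ^+ 2]].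
have cmp (a b : R) : a ^+ 2 < G -> G < b ^+ 2 ->
    (DD b - v) / (b ^+ 2 - G) <= (v - DD a) / (G - a ^+ 2).
  move=> ha hb; rewrite ler_pdivrMr ?subr_gt0// mulrAC ler_pdivlMr ?subr_gt0//.
  (* The weight that brings the mean square of the two-point law to exactly [G]. *)
  pose w := (G - a ^+ 2) / (b ^+ 2 - a ^+ 2).
  have d0 : 0 < b ^+ 2 - a ^+ 2 by lra.
  have w01 : 0 <= w <= 1.
    by rewrite /w divr_ge0 ?(ltW d0)//=; [rewrite ler_pdivrMr// mul1r|]; lra.
  have wE : w * (b ^+ 2 - a ^+ 2) = G - a ^+ 2 by rewrite /w divfK// gt_eqF.
  have := @two_pt w a b w01.
  have -> : (1 - w) * a ^+ 2 + w * b ^+ 2 = G by lra.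
  rewrite lexx => /(_ isT); rewrite -(ler_pM2r d0).
  have -> : ((1 - w) * DD a + w * DD b) * (b ^+ 2 - a ^+ 2) =
     (b ^+ 2 - a ^+ 2 - w * (b ^+ 2 - a ^+ 2)) * DD a + w * (b ^+ 2 - a ^+ 2) * DD b by ring.
  by rewrite wE; lra.
pose b0 := Num.sqrt (G + 1).
have b0G : G < b0 ^+ 2 by rewrite sqr_sqrtr; lra.
have z0 : (0 : R) ^+ 2 < G by rewrite expr0n.
have hS : has_sup S.
  split; first by exists ((DD b0 - v) / (b0 ^+ 2 - G)), b0.
  by exists ((v - DD 0) / (G - 0 ^+ 2)) => _ [b hb <-]; exact: cmp.
exists (Num.max 0 (sup S)); first by rewrite le_max lexx.
move=> x; have [hx|hx|hx] := ltgtP (x ^+ 2) G.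
- have [h|h] := leP 0 (sup S); last by rewrite mul0r addr0 one// ltW.
  have : sup S <= (v - DD x) / (G - x ^+ 2).
    by apply: ge_sup; [exact: hS.1|move=> _ [b hb <-]; exact: cmp].
  by rewrite ler_pdivlMr ?subr_gt0//; lra.
- have : (DD x - v) / (x ^+ 2 - G) <= Num.max 0 (sup S).
    by rewrite le_max; apply/orP; right; apply: ub_le_sup; [exact: hS.2|exists x].
  by rewrite ler_pdivrMr ?subr_gt0//; lra.
- by rewrite hx subrr mulr0 addr0; apply: one; rewrite hx.
Qed.

Lemma convex_cancel (R : realType) (t x y z : R) : 0 < t -> t <= 1 ->
  x <= y -> (1 - t) * y + t * z <= x -> z <= x.
Proof.
move=> t0 t1 xy h; rewrite -(ler_pM2l t0).
have : (1 - t) * x <= (1 - t) * y by rewrite ler_wpM2l// subr_ge0.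
by lra.
Qed.

(** * First-order optimality and the power multiplier *)

Section optimality.
Variable R : realType.
Notation leb := (@lebesgue_measure R).
Implicit Types mu nu : probability R R.
Variables (g q : R) (mu0 : probability R R).
Hypotheses (q0 : 0 <= q) (q1 : q < 1) (g0 : 0 < g).
Hypothesis L0 : Lambda g q mu0.
Hypothesis max0 : forall mu, Lambda g q mu -> (J mu mu <= J mu0 mu0)%E.

Lemma Lambda_E2_fin mu : Lambda g q mu -> (E2 mu < +oo)%E.
Proof. by move=> [_ h]; apply: le_lt_trans h _; rewrite ltry. Qed.

(** Mix [mu1] into [mu0] with weight [t]. The mixture has [J] at most that of [mu0], Gibbs bounds
    its [mu0] part from below, and [J] is affine in its first argument, so [J mu1 mix <= J mu0 mu0].
    Fatou as [t] tends to 0 takes the place of differentiation. *)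
Lemma J_optimal mu1 : Lambda g q mu1 -> (J mu1 mu0 <= J mu0 mu0)%E.
Proof.
move=> L1.
have f0 := J_fin mu0 (Lambda_E2_fin L0).
pose t_ n : R := n.+1%:R^-1.
have t01 n : 0 <= t_ n <= 1 by rewrite /t_ invr_ge0 ler0n/= invf_le1 ?ltr0n// ler1n.
pose mix n := sval (cid (mixture_exists mu0 mu1 (t01 n))).
have mixA n A : (mix n A = (1 - t_ n)%:E * mu0 A + (t_ n)%:E * mu1 A)%E.
  by rewrite /mix; case: cid => m [].
have mixI n (f : R -> \bar R) : measurable_fun setT f -> (forall x, 0 <= f x)%E ->
   (\int[mix n]_x f x = (1 - t_ n)%:E * \int[mu0]_x f x + (t_ n)%:E * \int[mu1]_x f x)%E.
  exact: (svalP (cid (mixture_exists mu0 mu1 (t01 n)))).2.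
have split_cst n (c : R) : c%:E = ((1 - t_ n)%:E * c%:E + (t_ n)%:E * c%:E)%E.
  by rewrite -!EFinM -EFinD; congr EFin; ring.
have mixL n : Lambda g q (mix n).
  have /andP[h1 h2] := t01 n; split; last first.
    rewrite mixI; [|by meas|by move=> x; nonneg].
    rewrite (split_cst n g).
    by apply: leeD; apply: lee_wpmul2l; rewrite ?lee_fin ?subr_ge0//; [exact: L0.2|exact: L1.2].
  rewrite mixA (split_cst n q).
  by apply: leeD; apply: lee_wpmul2l; rewrite ?lee_fin ?subr_ge0//; [exact: L0.1|exact: L1.1].
have mixp n y : pY (mix n) y = (1 - t_ n) * pY mu0 y + t_ n * pY mu1 y.
  apply: EFin_inj; rewrite EFinD !EFinM !pYE mixI//; first by meas.
  by move=> x; nonneg.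
have mixJ n nu : (J (mix n) nu = (1 - t_ n)%:E * J mu0 nu + (t_ n)%:E * J mu1 nu)%E.
  rewrite !J_D mixI//; first by have mD := measurable_D nu; meas.
  by move=> x; rewrite lee_fin D_half_ge0.
rewrite -[X in (_ <= X)%E](fineK f0).
apply: (@fatou_bound R (fun n y => pY mu1 y * Lf (mix n) y) _ (fun=> fine (J mu0 mu0))).
- by move=> n; have mp := measurable_pY mu1; have mL := measurable_Lf (mix n); meas.
- by move=> n y; nonneg.
- move=> y; apply: cvgMr; apply: cvg_Lf.
  have ht : t_ n @[n --> \oo] --> (0 : R) by exact: cvg_harmonic.
  have : (1 - t_ n) * pY mu0 y + t_ n * pY mu1 y @[n --> \oo] -->
      (1 - 0) * pY mu0 y + 0 * pY mu1 y.
    by apply: cvgD; apply: cvgMl => //; apply: cvgB => //; exact: cvg_cst.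
  rewrite subr0 mul1r mul0r addr0.
  by have -> : (fun n => pY (mix n) y) = (fun n => (1 - t_ n) * pY mu0 y + t_ n * pY mu1 y)
    by apply/funext => n; exact: mixp.
- move=> n; have := max0 (mixL n); rewrite mixJ -/(J mu1 (mix n)).
  have := gibbs mu0 (mix n).
  have f1 := J_fin (mix n) (Lambda_E2_fin L0); have f2 := J_fin (mix n) (Lambda_E2_fin L1).
  rewrite -(fineK f0) -(fineK f1) -(fineK f2) -!EFinM -EFinD !lee_fin.
  have t0 : 0 < t_ n by rewrite invr_gt0.
  have /andP[_ t1] := t01 n.
  by move=> h1 h2; exact: convex_cancel t0 t1 h1 h2.
- exact: cvg_cst.
Qed.

Local Notation DD := (D mu0).
Local Notation I := (fine (J mu0 mu0) - 1 / 2).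
Local Notation V := ((I - q * DD 0) / (1 - q)).
Local Notation G := (g / (1 - q)).

Lemma MI_I : MI mu0 = I%:E.
Proof. by rewrite MI_J -(fineK (J_fin mu0 (Lambda_E2_fin L0))). Qed.

(** [J_optimal] is tested on mass [q] at 0 with the rest split between [a] and [b]. [G] is the mean
    square available to the remaining fraction [1 - q], and [V] the corresponding share of the
    information. *)
Lemma two_point_bound (w a b : R) : 0 <= w <= 1 -> (1 - w) * a ^+ 2 + w * b ^+ 2 <= G ->
  (1 - w) * DD a + w * DD b <= V.
Proof.
move=> w01 hG; have [q0' q1' g0'] : [/\ 0 <= q, q < 1 & 0 < g] by split.
have [m2 [m2A m2I]] := mixture_exists (dirac a : probability R R) (dirac b : probability R R) w01.
have q01 : 0 <= 1 - q <= 1 by lra.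
have [m [mA mI]] := mixture_exists (dirac (0 : R) : probability R R) m2 q01.
have int (f : R -> R) : measurable_fun setT f -> (forall x, 0 <= f x) ->
  (\int[m]_x (f x)%:E = (q * f 0 + (1 - q) * ((1 - w) * f a + w * f b))%:E)%E.
  move=> mf f0; have mef : measurable_fun setT (EFin \o f) by meas.
  have f0' x : (0 <= (f x)%:E)%E by rewrite lee_fin.
  rewrite mI// m2I// !integral_dirac// !diracT !mul1e subKr.
  by [].
have Lm : Lambda g q m.
  split.
    have d1 : (dirac (0 : R) : probability R R) [set (0 : R)] = 1%E by rewrite /= diracE mem_set.
    by rewrite mA subKr [X in (_ * X + _)%E]d1 mule1 leeDl// mule_ge0// lee_fin; lra.
  rewrite int; [|by meas|by move=> x; nonneg].
  rewrite lee_fin expr0n/= mulr0 add0r.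
  by move: hG; rewrite ler_pdivlMr; [rewrite mulrC|lra].
have := J_optimal Lm; rewrite J_intD int; [|exact: measurable_D|by move=> x; exact: D_ge0].
rewrite -(fineK (J_fin mu0 (Lambda_E2_fin L0))) -EFinD lee_fin.
move: (fine (J mu0 mu0)) (D mu0 0) (D mu0 a) (D mu0 b) => x y z t h.
by rewrite /= ler_pdivlMr; [rewrite mulrC; lra|lra].
Qed.

Lemma multiplier_exists : exists2 l : R, 0 <= l & forall x, DD x <= V + l * (x ^+ 2 - G).
Proof.
by apply: multiplier_of_two_point; [rewrite divr_gt0// subr_gt0|exact: two_point_bound].
Qed.

End optimality.

(** * Taylor remainders of the exponential *)

Section exponential_remainder.
Variable R : realType.

Definition expsum (k : nat) (u : R) : R := \sum_(0 <= j < k) u ^+ j / j`!%:R.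

Lemma expsum_cvg (u : R) : expsum k u @[k --> \oo] --> expR u.
Proof. exact: is_cvg_series_exp_coeff. Qed.

Lemma expsum_le (k : nat) (a : R) : 0 <= a -> expsum k a <= expR a.
Proof.
move=> a0; apply: (nondecreasing_cvgn_le (u_ := fun k => expsum k a)).
- apply/nondecreasing_seqP => n; rewrite /expsum big_nat_recr//= lerDl.
  by rewrite divr_ge0// exprn_ge0.
- exact: is_cvg_series_exp_coeff.
Qed.

Lemma expsum_tail (k n : nat) (u : R) : (k <= n)%N ->
  `|expsum n u - expsum k u| <= \sum_(k <= j < n) `|u| ^+ j / j`!%:R.
Proof.
move=> kn; rewrite /expsum (big_cat_nat _ kn)//= addrAC subrr add0r.
apply: le_trans (ler_norm_sum _ _ _) _; apply: ler_sum => j _.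
by rewrite normrM normrX normfV (ger0_norm (ler0n _ _)).
Qed.

Lemma expsum_remainder_of (k : nat) (u c : R) :
  (forall n, (k <= n)%N -> \sum_(k <= j < n) `|u| ^+ j / j`!%:R <= c) ->
  `|expR u - expsum k u| <= c.
Proof.
move=> h.
have hc : `|expsum n u - expsum k u| @[n --> \oo] --> `|expR u - expsum k u|.
  by apply: cvg_norm; apply: cvgB; [exact: expsum_cvg|exact: cvg_cst].
apply: (ler_cvg_to hc (cvg_cst c)).
near=> n; have kn : (k <= n)%N by near: n; exact: nbhs_infty_ge.
exact: le_trans (expsum_tail _ kn) (h _ kn).
Unshelve. all: by end_near. Qed.

Lemma expsum_remainder_exp (k : nat) (u : R) : `|expR u - expsum k u| <= expR `|u|.
Proof.
apply: expsum_remainder_of => n kn; apply: le_trans (expsum_le n (normr_ge0 u)).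
rewrite [leRHS](big_cat_nat _ kn)//= lerDr.
by apply: sumr_ge0 => j _; rewrite divr_ge0// exprn_ge0.
Qed.

(** The factor [|u| ^+ k] permits division by [h ^+ k] in [laplace_order], whereas
    [expsum_remainder_exp] dominates uniformly in [k]. *)
Lemma expsum_remainder (k : nat) (u : R) : `|expR u - expsum k u| <= `|u| ^+ k * expR `|u|.
Proof.
apply: expsum_remainder_of => n kn.
apply: (@le_trans _ _ (`|u| ^+ k * expsum (n - k) `|u|)); last first.
  by rewrite ler_wpM2l ?exprn_ge0// expsum_le.
rewrite /expsum -{1}[k]add0n big_addn mulr_sumr; apply: ler_sum => j _.
rewrite exprD mulrCA -mulrA; apply: ler_wpM2l; first exact: exprn_ge0.
apply: ler_wpM2l; first exact: exprn_ge0.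
by rewrite lef_pV2 ?posrE ?ltr0n ?fact_gt0// ler_nat leq_fact// leq_addr.
Qed.

Lemma expr_le_expR (k : nat) (x : R) : 0 <= x -> x ^+ k <= k`!%:R * expR x.
Proof.
move=> x0; case: k => [|k]; first by rewrite expr0 mul1r -[leLHS]expR0 ler_expR.
have := @expR_ge1Dxn R x k x0; rewrite -ler_pdivrMl ?ltr0n ?fact_gt0// mulrC.
by apply: le_trans; rewrite lerDr.
Qed.

End exponential_remainder.

(** * Moments and Laplace transforms *)

Section moments.
Context d (T : measurableType d) (R : realType) (m : {measure set T -> \bar R}).
Implicit Types (f g Y w : T -> R).

Lemma dominated_Rcvg (f_ : nat -> T -> R) f g :
  (forall n, measurable_fun setT (f_ n)) -> (forall t, f_ n t @[n --> \oo] --> f t) ->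
  m.-integrable setT (EFin \o g) -> (forall n t, `|f_ n t| <= g t) ->
  (\int[m]_t f_ n t)%R @[n --> \oo] --> (\int[m]_t f t)%R.
Proof.
move=> mf ff ig fg.
have mf' n : measurable_fun setT (EFin \o f_ n) by meas.
have mff : measurable_fun setT f by apply: (measurable_fun_cvg mf) => t _; exact: ff.
have mff' : measurable_fun setT (EFin \o f) by meas.
have ff' : {ae m, forall x, setT x -> (EFin \o f_ n) x @[n --> \oo] --> (EFin \o f) x}.
  by apply: aeW => x _; apply: cvg_EFin; [exact: nearW|exact: ff].
have fg' : {ae m, forall x n, setT x -> (`|(EFin \o f_ n) x| <= (EFin \o g) x)%E}.
  by apply: aeW => x n _; rewrite lee_fin.
have [fi _ fc] := dominated_convergence measurableT mf' mff' ff' ig fg'.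
apply: fine_cvg; rewrite fineK; first exact: fc.
exact: integrable_fin_num.
Qed.

Lemma integrable_dom f g : measurable_fun setT f -> m.-integrable setT (EFin \o g) ->
  (forall t, `|f t| <= g t) -> m.-integrable setT (EFin \o f).
Proof.
move=> mf ig h; apply: le_integrable ig => //; first by meas.
by move=> t _; rewrite lee_fin (le_trans (h t))// ler_norm.
Qed.

Lemma integrable_scale (c : R) f : m.-integrable setT (EFin \o f) ->
  m.-integrable setT (EFin \o (fun t => c * f t)).
Proof. by move=> fi; apply: eq_integrable (integrableZl measurableT c fi) => // t _ /=. Qed.

Lemma Rintegral_scale (c : R) f : m.-integrable setT (EFin \o f) ->
  (\int[m]_t (c * f t) = c * \int[m]_t f t)%R.
Proof. by move=> fi; rewrite RintegralZl. Qed.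

(** Measure space, statistic [Y] and weight [w] stay abstract because the same results serve for
    input laws, for Lebesgue measure, and for [Y] a squared distance. *)
Definition expint Y w (K : R) :=
  m.-integrable setT (EFin \o (fun t => expR (K * `|Y t|) * `|w t|)).

Definition mom Y w (k : nat) : R := (\int[m]_t (Y t ^+ k * w t))%R.
Definition laplace Y w (h : R) : R := (\int[m]_t (expR (h * Y t) * w t))%R.

Variables (Y w : T -> R).
Hypotheses (mY : measurable_fun setT Y) (mw : measurable_fun setT w).

Lemma integrable_mom K k : 0 < K -> expint Y w K ->
  m.-integrable setT (EFin \o (fun t => Y t ^+ k * w t)).
Proof.
move=> K0 hK.
apply: (@integrable_dom _ (fun t => (k`!%:R / K ^+ k) * (expR (K * `|Y t|) * `|w t|))).
- by meas.
- apply: (eq_integrable measurableT (fun t => (k`!%:R / K ^+ k)%:E *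
    (expR (K * `|Y t|) * `|w t|)%:E)%E); first by move=> t _; rewrite -EFinM.
  exact: integrableZl.
- move=> t; rewrite normrM normrX mulrA ler_wpM2r//.
  rewrite mulrAC ler_pdivlMr ?exprn_gt0// -exprMn [`|Y t| * K]mulrC.
  by apply: expr_le_expR; rewrite mulr_ge0// ltW.
Qed.

Lemma integrable_laplace h K : `|h| <= K -> expint Y w K ->
  m.-integrable setT (EFin \o (fun t => expR (h * Y t) * w t)).
Proof.
move=> hK eK; apply: (integrable_dom _ eK); first by meas.
move=> t; rewrite normrM (ger0_norm (expR_ge0 _)) ler_wpM2r// ler_expR.
apply: le_trans (ler_norm _) _; rewrite normrM; exact: ler_wpM2r.
Qed.

Lemma laplace_remainder h K k : 0 < K -> `|h| <= K -> expint Y w K ->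
  laplace Y w h - \sum_(0 <= j < k) h ^+ j / j`!%:R * mom Y w j =
  (\int[m]_t ((expR (h * Y t) - expsum k (h * Y t)) * w t))%R.
Proof.
move=> K0 hK eK.
have ij j : m.-integrable setT (EFin \o (fun t => h ^+ j / j`!%:R * (Y t ^+ j * w t))).
  apply: (eq_integrable measurableT (fun t => (h ^+ j / j`!%:R)%:E * (Y t ^+ j * w t)%:E)%E).
    by move=> t _; rewrite -EFinM.
  by apply: integrableZl => //; exact: integrable_mom eK.
have isum : m.-integrable setT (EFin \o (fun t => expsum k (h * Y t) * w t)) /\
    (\int[m]_t (expsum k (h * Y t) * w t))%R = \sum_(0 <= j < k) h ^+ j / j`!%:R * mom Y w j.
  elim: k => [|k [IHi IH]].
    rewrite big_geq//; under eq_fun do rewrite /expsum big_geq// mul0r.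
    split; first exact: integrable0.
    by rewrite /Rintegral integral0.
  have E t : expsum k.+1 (h * Y t) * w t =
      expsum k (h * Y t) * w t + h ^+ k / k`!%:R * (Y t ^+ k * w t).
    by rewrite /expsum big_nat_recr//= exprMn; field; rewrite pnatr_eq0 -lt0n fact_gt0.
  split.
    have := integrableD measurableT IHi (ij k); apply: eq_integrable => // t _ /=.
    by rewrite E.
  under eq_Rintegral do rewrite E.
  rewrite RintegralD// IH big_nat_recr//=; congr (_ + _).
  by rewrite RintegralZl//; exact: integrable_mom eK.
rewrite -isum.2 /laplace -RintegralB//; last 2 first.
- exact: integrable_laplace eK.
- exact: isum.1.
by apply: eq_Rintegral => t _; rewrite mulrBl.
Qed.

Lemma measurable_expsum k h : measurable_fun setT (fun t => expsum k (h * Y t)).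
Proof.
elim: k => [|k IH].
  have -> : (fun t => expsum 0 (h * Y t)) = cst 0 by apply/funext => t; rewrite /expsum big_geq.
  exact: measurable_cst.
under eq_fun do rewrite /expsum big_nat_recr//=.
by apply: measurable_funD => //; meas.
Qed.

Lemma laplace_cvg h : h != 0 -> expint Y w `|h| ->
  \sum_(0 <= j < k) h ^+ j / j`!%:R * mom Y w j @[k --> \oo] --> laplace Y w h.
Proof.
move=> h0 eh.
suff : laplace Y w h - \sum_(0 <= j < k) h ^+ j / j`!%:R * mom Y w j @[k --> \oo] --> (0 : R).
  move=> /cvgrPdist_lt H; apply/cvgrPdist_lt => e e0.
  by apply: filterS (H e e0) => k; rewrite sub0r normrN.
have n0 : 0 < `|h| by rewrite normr_gt0.
under eq_fun do rewrite (laplace_remainder _ n0 (lexx _) eh).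
rewrite (_ : 0 = (\int[m]_t 0)%R); last by rewrite /Rintegral integral0.
apply: (dominated_Rcvg _ _ eh).
- by move=> k; have me := measurable_expsum k h; meas.
- move=> t; rewrite -(mul0r (w t)); apply: cvgMl.
  rewrite -(subrr (expR (h * Y t))); apply: cvgB; [exact: cvg_cst|exact: expsum_cvg].
- move=> k t; rewrite normrM ler_wpM2r// -normrM.
  exact: expsum_remainder_exp.
Qed.

(** The [k]-th moment is read off along a sequence tending to 0 and not from derivatives, since
    agreement of two transforms is known only along a sequence. *)
Lemma laplace_order (h_ : nat -> R) k : (forall n, h_ n != 0) -> (forall n, `|h_ n| <= 1) ->
  h_ n @[n --> \oo] --> (0 : R) -> expint Y w 2 ->
  (laplace Y w (h_ n) - \sum_(0 <= j < k) h_ n ^+ j / j`!%:R * mom Y w j) / h_ n ^+ k @[n --> \oo]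
   --> mom Y w k / k`!%:R.
Proof.
move=> hn0 hn1 hc e2.
pose f n t := (expR (h_ n * Y t) - expsum k (h_ n * Y t)) / h_ n ^+ k * w t.
have fE n : (laplace Y w (h_ n) - \sum_(0 <= j < k) h_ n ^+ j / j`!%:R * mom Y w j) / h_ n ^+ k =
    (\int[m]_t f n t)%R.
  have h2 : `|h_ n| <= 2 by apply: le_trans (hn1 n) _; rewrite ler1n.
  rewrite (laplace_remainder _ (ltr0n _ 2) h2 e2) mulrC -RintegralZl//.
    by apply: eq_Rintegral => t _; rewrite /f mulrA [_ / _]mulrC.
  apply: (integrable_dom _ e2).
    by have me := measurable_expsum k (h_ n); meas.
  move=> t; rewrite normrM ler_wpM2r//.
  apply: le_trans (expsum_remainder_exp _ _) _.
  by rewrite ler_expR normrM ler_wpM2r.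
under eq_fun do rewrite fE.
have -> : mom Y w k / k`!%:R = (\int[m]_t (Y t ^+ k * w t / k`!%:R))%R.
  by rewrite RintegralZr//; exact: integrable_mom e2.
(* After division by [|h_ n| ^+ k] the remainder is at most [|Y| ^+ k exp |Y|], hence at most
   [k! exp (2 |Y|)]: this is why integrability is asked at exponent 2. *)
apply: (@dominated_Rcvg f _ (fun t => k`!%:R * (expR (2 * `|Y t|) * `|w t|))).
- by move=> n; have me := measurable_expsum k (h_ n); rewrite /f; meas.
- move=> t; rewrite mulrAC.
  pose r n := expR (h_ n * Y t) - expsum k.+1 (h_ n * Y t).
  have -> : f ^~ t = (fun n => (Y t ^+ k / k`!%:R + r n / h_ n ^+ k) * w t).
    apply/funext => n; rewrite /f /r /expsum big_nat_recr//= exprMn; congr (_ * _); field.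
    by rewrite pnatr_eq0 -lt0n fact_gt0 expf_neq0.
  apply: cvgMl; suff r0 : r n / h_ n ^+ k @[n --> \oo] --> (0 : R).
    have := cvgD (cvg_cst (Y t ^+ k / k`!%:R)) r0; rewrite addr0; exact.
  apply/norm_cvg0P.
  apply: (@squeeze_cvgr _ _ _ _ (fun=> 0) (fun n => `|h_ n| * (`|Y t| ^+ k.+1 * expR `|Y t|))).
  + apply: nearW => n; rewrite normr_ge0/= normrM normfV normrX ler_pdivrMr ?exprn_gt0 ?normr_gt0//.
    apply: le_trans (expsum_remainder _ _) _; rewrite normrM.
    apply: (@le_trans _ _ ((`|h_ n| * `|Y t|) ^+ k.+1 * expR `|Y t|)).
      by rewrite ler_wpM2l ?exprn_ge0 ?mulr_ge0// ler_expR ler_piMl.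
    rewrite exprMn [`|h_ n| ^+ k.+1]exprS.
    move: (`|h_ n| ^+ k) (`|Y t| ^+ k.+1) (expR _) => a b c.
    by rewrite le_eqVlt; apply/orP; left; apply/eqP; ring.
  + exact: cvg_cst.
  + rewrite -(mul0r (`|Y t| ^+ k.+1 * expR `|Y t|)); apply: cvgMl.
    by rewrite -(@normr0 _ R); exact: cvg_norm.
- apply: (eq_integrable measurableT (fun t => (k`!%:R)%:E * (expR (2 * `|Y t|) * `|w t|)%:E)%E).
    by move=> t _; rewrite -EFinM.
  exact: integrableZl.
- move=> n t; rewrite /f normrM mulrA ler_wpM2r// normrM normfV normrX.
  rewrite ler_pdivrMr ?exprn_gt0 ?normr_gt0//.
  apply: le_trans (expsum_remainder _ _) _.
  rewrite normrM exprMn (mulrDl 1 1) mul1r expRD mulrA mulrAC -mulrA mulrC.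
  apply: ler_pM; rewrite ?exprn_ge0 ?mulr_ge0 ?expR_ge0//.
  rewrite [leLHS]mulrC; apply: ler_pM; rewrite ?exprn_ge0 ?expR_ge0//.
    exact: expr_le_expR.
  by rewrite ler_expR ler_piMl.
Qed.

End moments.

Section moment_problem.
Context d0 d1 (T0 : measurableType d0) (T1 : measurableType d1) (R : realType).
Variables (m0 : {measure set T0 -> \bar R}) (m1 : {measure set T1 -> \bar R}).
Variables (Y0 w0 : T0 -> R) (Y1 w1 : T1 -> R).
Hypotheses (mY0 : measurable_fun setT Y0) (mw0 : measurable_fun setT w0).
Hypotheses (mY1 : measurable_fun setT Y1) (mw1 : measurable_fun setT w1).

(** Once the moments below [k] agree, the normalized remainders of the two transforms coincide along
    [h_], and so do their limits, the moments of order [k] over [k!]. *)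
Lemma eq_mom_of_laplace (h_ : nat -> R) : (forall n, h_ n != 0) -> (forall n, `|h_ n| <= 1) ->
  h_ n @[n --> \oo] --> (0 : R) -> expint m0 Y0 w0 2 -> expint m1 Y1 w1 2 ->
  (forall n, laplace m0 Y0 w0 (h_ n) = laplace m1 Y1 w1 (h_ n)) ->
  forall k, mom m0 Y0 w0 k = mom m1 Y1 w1 k.
Proof.
move=> hn0 hn1 hc e0 e1 hl; elim/ltn_ind => k IH.
have c0 := laplace_order mY0 mw0 (k := k) hn0 hn1 hc e0.
have c1 := laplace_order mY1 mw1 (k := k) hn0 hn1 hc e1.
have E : (fun n => (laplace m0 Y0 w0 (h_ n) -
      \sum_(0 <= j < k) h_ n ^+ j / j`!%:R * mom m0 Y0 w0 j) / h_ n ^+ k) =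
    (fun n => (laplace m1 Y1 w1 (h_ n) -
      \sum_(0 <= j < k) h_ n ^+ j / j`!%:R * mom m1 Y1 w1 j) / h_ n ^+ k).
  apply/funext => n; rewrite hl; congr ((_ - _) / _).
  by apply: eq_big_nat => j /andP[_ jk]; rewrite IH.
rewrite E in c0.
have e : mom m0 Y0 w0 k / k`!%:R = mom m1 Y1 w1 k / k`!%:R by exact: cvg_unique c0 c1.
by apply: (mulIf _ e); rewrite invr_eq0 pnatr_eq0 -lt0n fact_gt0.
Qed.

Lemma eq_laplace_of_mom h : h != 0 -> expint m0 Y0 w0 `|h| -> expint m1 Y1 w1 `|h| ->
  (forall k, mom m0 Y0 w0 k = mom m1 Y1 w1 k) -> laplace m0 Y0 w0 h = laplace m1 Y1 w1 h.
Proof.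
move=> h0 e0 e1 hm.
have c0 := laplace_cvg mY0 mw0 h0 e0; have c1 := laplace_cvg mY1 mw1 h0 e1.
have E : (fun k => \sum_(0 <= j < k) h ^+ j / j`!%:R * mom m0 Y0 w0 j) =
    (fun k => \sum_(0 <= j < k) h ^+ j / j`!%:R * mom m1 Y1 w1 j).
  by apply/funext => k; apply: eq_big_nat => j _; rewrite hm.
by rewrite E in c0; exact: cvg_unique c0 c1.
Qed.

End moment_problem.

(** * Recovering atoms from the output density *)

Section deconvolution.
Variable R : realType.
Notation leb := (@lebesgue_measure R).
Implicit Types mu nu : probability R R.

Lemma ae_point (P : R -> Prop) (a b : R) : a < b -> {ae leb, forall y, P y} ->
  exists2 z, a < z < b & P z.
Proof.
move=> ab [N [mN N0 sN]]; apply: contrapT => h.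
have sub : `]a, b[%classic `<=` N.
  move=> z /=; rewrite in_itv/= => abz; apply: sN => /= Pz.
  by apply: h; exists z.
have : (leb `]a, b[%classic <= leb N)%E by apply: le_measure; rewrite ?inE.
rewrite lebesgue_measure_itv/= lte_fin ab N0 -EFinB lee_fin; lra.
Qed.

Lemma integrable_bounded mu (f : R -> R) (c : R) : measurable_fun setT f ->
  (forall x, `|f x| <= c) -> mu.-integrable setT (EFin \o f).
Proof.
move=> mf fc; apply: (@integrable_dom _ _ _ mu f (cst c)) => //.
exact: finite_measure_integrable_cst.
Qed.

Lemma pY_laplace mu (y h : R) : pY mu (y + h) = phi 0 * expR (- h ^+ 2 / 2) *
  laplace mu (fun x => x - y) (fun x => expR (- (x - y) ^+ 2 / 2)) h.
Proof.
rewrite /laplace -RintegralZl//; last first.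
  apply: (@integrable_bounded _ _ (expR (h ^+ 2 / 2))); first by meas.
  move=> x; rewrite -expRD ger0_norm ?expR_ge0// ler_expR.
  rewrite -subr_ge0 (_ : _ - _ = (h - (x - y)) ^+ 2 / 2); last by field.
  by rewrite divr_ge0// sqr_ge0.
rewrite /pY; congr fine; apply: eq_integral => x _; congr EFin.
rewrite phiE -!mulrA -!expRD; congr (_ * expR _); by field.
Qed.

Lemma gaussian_bound (K u : R) : expR (K * `|u|) * expR (- u ^+ 2 / 2) <= expR (K ^+ 2 / 2).
Proof.
rewrite -expRD ler_expR -[u ^+ 2]real_normK ?num_real//.
rewrite -subr_ge0 (_ : _ - _ = (K - `|u|) ^+ 2 / 2); last by field.
by rewrite divr_ge0// sqr_ge0.
Qed.

(* Near x the output densities are Laplace transforms of the measures weighted by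
   exp (- (t - x)^2 / 2), so all weighted moments agree. This persists when the weight is
   multiplied by exp (- n (t - x)^2 / 4), and n -> oo isolates the mass of x. *)
Lemma eq_atoms mu nu : {ae leb, forall y, pY mu y = pY nu y} -> forall x, mu [set x] = nu [set x].
Proof.
move=> hp y.
have pick n : exists h : R, [/\ 0 < h, h <= n.+1%:R^-1 & pY mu (y + h) = pY nu (y + h)].
  have [|z /andP[z1 z2] hz] := @ae_point _ y (y + n.+1%:R^-1) _ hp.
    by rewrite ltrDl invr_gt0.
  exists (z - y); split; rewrite ?subr_gt0//; last by rewrite addrC subrK.
  by rewrite lerBlDl ltW.
pose h_ n := sval (cid (pick n)).
have hP n : [/\ 0 < h_ n, h_ n <= n.+1%:R^-1 & pY mu (y + h_ n) = pY nu (y + h_ n)].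
  by rewrite /h_; case: cid.
have hc : h_ n @[n --> \oo] --> (0 : R).
  apply: (@squeeze_cvgr _ _ _ _ (fun=> 0) (fun n => n.+1%:R^-1)).
  - by apply: nearW => n; have [h1 h2 _] := hP n; rewrite h2 ltW.
  - exact: cvg_cst.
  - exact: cvg_harmonic.
pose u (x : R) := x - y.
have mu_ : measurable_fun setT u by rewrite /u; meas.
pose g (x : R) := expR (- u x ^+ 2 / 2).
pose E (x : R) := expR (- (1 / 4) * u x ^+ 2).
have mg : measurable_fun setT g by rewrite /g; meas.
have mE : measurable_fun setT E by rewrite /E; meas.
have g01 x : 0 <= g x <= 1.
  by rewrite /g expR_ge0/= -[leRHS]expR0 ler_expR mulNr oppr_le0 divr_ge0// sqr_ge0.
have E01 x : 0 <= E x <= 1.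
  by rewrite /E expR_ge0/= -[leRHS]expR0 ler_expR mulNr oppr_le0 mulr_ge0// sqr_ge0.
have En01 n x : 0 <= E x ^+ n <= 1.
  by have /andP[e0 e1] := E01 x; rewrite exprn_ge0//= exprn_ile1.
have S n : forall j, (\int[mu]_x (u x ^+ j * (g x * E x ^+ n)))%R =
                     (\int[nu]_x (u x ^+ j * (g x * E x ^+ n)))%R.
  elim: n => [|n IH] j.
    under eq_Rintegral do rewrite expr0 mulr1.
    under [RHS]eq_Rintegral do rewrite expr0 mulr1.
    apply: (eq_mom_of_laplace mu_ mg mu_ mg (h_ := h_)) => //.
    - by move=> m; have [h1 _ _] := hP m; rewrite gt_eqF.
    - move=> m; have [h1 h2 _] := hP m; rewrite gtr0_norm// (le_trans h2)//.
      by rewrite invf_le1 ?ltr0n// ler1n.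
    - apply: (@integrable_bounded _ _ (expR (2 ^+ 2 / 2))); first by meas.
      move=> x; rewrite (ger0_norm (expR_ge0 _)) ger0_norm ?mulr_ge0 ?expR_ge0//.
      exact: gaussian_bound.
    - apply: (@integrable_bounded _ _ (expR (2 ^+ 2 / 2))); first by meas.
      move=> x; rewrite (ger0_norm (expR_ge0 _)) ger0_norm ?mulr_ge0 ?expR_ge0//.
      exact: gaussian_bound.
    - move=> m; have [_ _] := hP m; rewrite !pY_laplace => /mulfI; apply.
      by rewrite mulf_neq0// gt_eqF ?phi0_gt0 ?expR_gt0.
  (* Multiplying the weight by [E] amounts to a Laplace transform of [Y2] at -1/4. The moments of
     [Y2] are moments of [u] of order [2 k + j] at level [n], which is why all [j] are carried
     through the induction. *)
  pose Y2 (x : R) := u x ^+ 2.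
  pose w2 (x : R) := u x ^+ j * (g x * E x ^+ n).
  have mY2 : measurable_fun setT Y2 by rewrite /Y2; meas.
  have mw2 : measurable_fun setT w2 by rewrite /w2; meas.
  have lE m : (\int[m]_x (u x ^+ j * (g x * E x ^+ n.+1)))%R = laplace m Y2 w2 (- (1 / 4)).
    by apply: eq_Rintegral => x _; rewrite /w2 exprS -/(E x) [in RHS]mulrCA; congr (_ * _); rewrite mulrCA.
  have ex (m : probability R R) : expint m Y2 w2 `|- (1 / 4)|.
    have -> : `|- (1 / 4)| = 1 / 4 :> R by rewrite normrN gtr0_norm.
    apply: (@integrable_bounded _ _ (j`!%:R * expR 1)); first by meas.
    move=> x; rewrite normrM (ger0_norm (expR_ge0 _)) normr_id /Y2 (ger0_norm (sqr_ge0 _)).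
    rewrite /w2 !normrM normrX.
    have /andP[e0 e1] := En01 n x; have /andP[g0 g1] := g01 x.
    rewrite (ger0_norm e0) (ger0_norm g0).
    apply: (@le_trans _ _ (expR (1 / 4 * u x ^+ 2) * (`|u x| ^+ j * g x))).
      rewrite ler_wpM2l ?expR_ge0// ler_wpM2l ?exprn_ge0// ler_piMr//.
    apply: (@le_trans _ _ (expR (1 / 4 * u x ^+ 2) * ((j`!%:R * expR `|u x|) * g x))).
      by rewrite ler_wpM2l ?expR_ge0// ler_wpM2r// expr_le_expR.
    rewrite /g mulrCA -!mulrA; rewrite ler_wpM2l// -!expRD ler_expR.
    rewrite -[u x ^+ 2]real_normK ?num_real//.
    rewrite -subr_ge0 (_ : _ - _ = (`|u x| / 2 - 1) ^+ 2); last by field.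
    exact: sqr_ge0.
  rewrite !lE; apply: eq_laplace_of_mom => // k.
  have mE' m : mom m Y2 w2 k = (\int[m]_x (u x ^+ (2 * k + j) * (g x * E x ^+ n)))%R.
    by apply: eq_Rintegral => x _; rewrite /Y2 /w2 exprD exprM mulrA.
  by rewrite !mE'.
have lim (m : probability R R) : (\int[m]_x (u x ^+ 0 * (g x * E x ^+ n)))%R @[n --> \oo]
    --> fine (m [set y]).
  have -> : fine (m [set y]) = (\int[m]_x (if x == y then 1 else 0))%R.
    rewrite /Rintegral -[m [set y]]mul1e -integral_cst// integral_mkcond.
    congr fine; apply: eq_integral => x _; rewrite patchE.
    case: ifPn => [/set_mem -> /=|]; first by rewrite eqxx.
    by case: eqP => // -> /negP; rewrite mem_set.
  apply: (@dominated_Rcvg _ _ _ m _ _ (cst 1)).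
  - by move=> n; meas.
  - move=> x; under eq_fun do rewrite expr0 mul1r.
    case: eqP => [->|/eqP xy].
      have -> : (fun n => g y * E y ^+ n) = cst 1; last exact: cvg_cst.
      apply/funext => n; rewrite /g /E /u subrr expr0n/= oppr0 mul0r mulr0 expR0 mul1r.
      by rewrite expr1n.
    rewrite -(mulr0 (g x)); apply: cvgMr; apply: cvg_expr.
    have /andP[e0 _] := E01 x; rewrite ger0_norm// /E expR_lt1 mulNr oppr_lt0.
    by rewrite mulr_gt0// exprn_even_gt0//= subr_eq0.
  - exact: finite_measure_integrable_cst.
  - move=> n x; rewrite expr0 mul1r ger0_norm.
      have /andP[e0 e1] := En01 n x; have /andP[g0 g1] := g01 x.
      exact: mulr_ile1.
    have /andP[e0 e1] := En01 n x; have /andP[g0 g1] := g01 x.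
    exact: mulr_ge0.
have l1 := lim mu; have l2 := lim nu.
have SE : (fun n => (\int[mu]_x (u x ^+ 0 * (g x * E x ^+ n)))%R) =
   (fun n => (\int[nu]_x (u x ^+ 0 * (g x * E x ^+ n)))%R) by apply/funext => n; exact: S.
rewrite SE in l1.
have := cvg_unique _ l1 l2.
rewrite -(fineK (fin_num_measure mu _ (measurable_set1 y))) => h.
rewrite -(fineK (fin_num_measure nu _ (measurable_set1 y))); congr EFin.
exact: h.
Qed.

End deconvolution.

(** * The identity theorem for the contact condition *)

Section analytic_identity.
Variable R : realType.
Notation leb := (@lebesgue_measure R).
Implicit Types mu nu : probability R R.

Lemma integrable_exp_quarter : leb.-integrable setT (EFin \o (fun y : R => expR (- y ^+ 2 / 4))).
Proof.
have s2 : 0 < Num.sqrt 2 :> R by rewrite sqrtr_gt0.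
have c0 : normal_peak (Num.sqrt 2) != 0 :> R by rewrite gt_eqF// normal_peak_gt0// gt_eqF.
have := integrableZl measurableT (normal_peak (Num.sqrt 2))^-1 (integrable_normal_pdf (0 : R) (Num.sqrt 2)).
apply: eq_integrable => // y _ /=; rewrite -EFinM normal_pdfE ?gt_eqF// mulrA mulVf// mul1r.
rewrite /normal_fun subr0 sqr_sqrtr// -mulr_natr; congr (expR _)%:E; by field.
Qed.

Lemma integrable_gauss_poly (f : R -> R) (C K : R) : 0 <= C -> measurable_fun setT f ->
  (forall y, `|f y| <= (y ^+ 2 + C) * expR (K * `|y|) * expR (- y ^+ 2 / 2)) ->
  leb.-integrable setT (EFin \o f).
Proof.
move=> C0 mf hf.
(* From [y ^+ 2 + C <= (2 + C) exp |y|] and [(K + 1) |y| <= (K + 1) ^+ 2 + y ^+ 2 / 4]; the exponent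
   [- y ^+ 2 / 4] is left. *)
pose c := (2 + C) * expR ((K + 1) ^+ 2).
apply: (@integrable_dom _ _ _ leb f (fun y => c * expR (- y ^+ 2 / 4))) => //.
  exact: integrable_scale integrable_exp_quarter.
move=> y; apply: le_trans (hf y) _.
have h1 : y ^+ 2 + C <= (2 + C) * expR `|y|.
  rewrite mulrDl; apply: lerD.
    by rewrite -[y ^+ 2]real_normK ?num_real//; exact: (expr_le_expR 2).
  by rewrite ler_peMr// -[leLHS]expR0 ler_expR.
apply: (@le_trans _ _ ((2 + C) * expR `|y| * expR (K * `|y|) * expR (- y ^+ 2 / 2))).
  by rewrite ler_wpM2r ?expR_ge0// ler_wpM2r ?expR_ge0.
rewrite /c -!mulrA ler_wpM2l//; first by lra.
rewrite -!expRD ler_expR -[y ^+ 2]real_normK ?num_real//.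
rewrite -subr_ge0 (_ : _ - _ = (K + 1 - `|y| / 2) ^+ 2); last by field.
exact: sqr_ge0.
Qed.

Lemma phi_shift (x p y : R) :
  phi (y - x) = phi 0 * expR (- x ^+ 2 / 2) * (expR ((x - p) * y) * expR (p * y - y ^+ 2 / 2)).
Proof. by rewrite phiE -!mulrA -!expRD; congr (_ * expR _); field. Qed.

(* Up to a nonvanishing factor both sides are entire functions of x, so agreement on a
   set with an accumulation point propagates to the whole line. *)
Lemma D_identity nu (c l a b : R) :
  infinite_set ([set x | D nu x = c + l * x ^+ 2] `&` `[a, b]) ->
  forall x, D nu x = c + l * x ^+ 2.
Proof.
move=> inf.
have [|p] := infinite_bounded_limit_point_nonempty inf.
  exists (`|a| + `|b|); split; first exact: num_real.
  move=> M hM x [_]/=; rewrite in_itv/= => /andP[ax xb].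
  apply: le_trans (ltW hM); rewrite ler_norml.
  have := ler_norm (- a); have := ler_norm b; have := normr_ge0 a; have := normr_ge0 b.
  by rewrite normrN => h1 h2 h3 h4; apply/andP; split; lra.
move=> /limit_pointP[a_ [aZ ap ac]].
(* Chosen so that averaging [l * y ^+ 2 + c2] under N(x, 1), of second moment [1 + x ^+ 2], returns
   [c + 1 / 2 + l * x ^+ 2]. *)
pose c2 := c - l + 1 / 2.
have mL := measurable_Lf nu.
(* Expanding around the accumulation point [p] turns both sides into Laplace transforms at [x - p],
   up to a common positive factor. *)
pose e (y : R) := expR (p * y - y ^+ 2 / 2).
have me : measurable_fun setT e by rewrite /e; meas.
have e0 y : 0 <= e y by exact: expR_ge0.
have eb y : e y <= expR (`|p| * `|y|) * expR (- y ^+ 2 / 2).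
  by rewrite -expRD ler_expR mulNr lerD2r -normrM ler_norm.
pose w0 (y : R) := e y * Lf nu y.
pose w1 (y : R) := e y * (l * y ^+ 2 + c2).
have mw0 : measurable_fun setT w0 by rewrite /w0; meas.
have mw1 : measurable_fun setT w1 by rewrite /w1; meas.
have mid : measurable_fun setT (@idfun R) by exact: measurable_id.
have [C C0 LC] := Lf_upper_bound nu.
have ex0 (K : R) : expint leb (@idfun R) w0 K.
  apply: (@integrable_gauss_poly _ C (K + `|p|)) => //; first by meas.
  move=> y; rewrite normrM normr_id (ger0_norm (expR_ge0 _)) /w0 normrM (ger0_norm (e0 y)).
  rewrite (ger0_norm (Lf_ge0 _ _)) (mulrDl K) expRD /=.
  rewrite [leLHS](_ : _ = Lf nu y * expR (K * `|y|) * e y); last by rewrite mulrA mulrC mulrA.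
  rewrite -!mulrA; apply: ler_pM; rewrite ?Lf_ge0 ?mulr_ge0 ?expR_ge0//.
  by rewrite ler_wpM2l ?expR_ge0.
have ex1 (K : R) : expint leb (@idfun R) w1 K.
  pose M := `|l| + `|c2|.
  have M0 : 0 <= M by rewrite addr_ge0.
  have hM y : `|l * y ^+ 2 + c2| <= M * (y ^+ 2 + 1).
    apply: le_trans (ler_normD _ _) _; rewrite normrM (ger0_norm (sqr_ge0 y)) /M.
    have h1 := sqr_ge0 y; have h2 := normr_ge0 l; have h3 := normr_ge0 c2.
    have : 0 <= `|c2| * y ^+ 2 by rewrite mulr_ge0.
    by lra.
  have := @integrable_gauss_poly (fun y => (y ^+ 2 + 1) * expR ((K + `|p|) * `|y|) * expR (- y ^+ 2 / 2)) 1 (K + `|p|) ler01.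
  move=> /(_ ltac:(by meas) _) H.
  apply: (@integrable_dom _ _ _ leb _ (fun y => M * ((y ^+ 2 + 1) * expR ((K + `|p|) * `|y|) * expR (- y ^+ 2 / 2)))).
  - by meas.
  - apply: (integrable_scale M (H _)).
    by move=> y; rewrite ger0_norm// !mulr_ge0 ?expR_ge0// addr_ge0// sqr_ge0.
  - move=> y; rewrite normrM normr_id (ger0_norm (expR_ge0 _)) /w1 normrM (ger0_norm (e0 y)).
    rewrite [leLHS](_ : _ = `|l * y ^+ 2 + c2| * (expR (K * `|y|) * e y)); last by rewrite mulrA mulrC.
    rewrite (mulrDl K) expRD /=.
    rewrite [leRHS](_ : _ = M * (y ^+ 2 + 1) * (expR (K * `|y|) * (expR (`|p| * `|y|) * expR (- y ^+ 2 / 2)))); last first.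
      by rewrite !mulrA.
    apply: ler_pM; rewrite ?mulr_ge0 ?expR_ge0//.
    by rewrite ler_wpM2l ?expR_ge0.
have il0 x : leb.-integrable setT (EFin \o (fun y : R => expR ((x - p) * y) * w0 y)).
  by apply: (@integrable_laplace _ _ _ leb (@idfun R) w0 mid mw0 (x - p) `|x - p|).
have il1 x : leb.-integrable setT (EFin \o (fun y : R => expR ((x - p) * y) * w1 y)).
  by apply: (@integrable_laplace _ _ _ leb (@idfun R) w1 mid mw1 (x - p) `|x - p|).
have l0E x : D nu x + 1 / 2 = phi 0 * expR (- x ^+ 2 / 2) * laplace leb (@idfun R) w0 (x - p).
  apply: EFin_inj; rewrite -DgE /laplace -RintegralZl//.
  rewrite /Rintegral fineK; last first.
    by apply: integrable_fin_num => //; exact: (integrable_scale (phi 0 * expR (- x ^+ 2 / 2)) (il0 x)).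
  apply: eq_integral => y _; congr EFin.
  by rewrite /w0 (phi_shift x p) -/(e y) !mulrA.
have l1E x : c + 1 / 2 + l * x ^+ 2 = phi 0 * expR (- x ^+ 2 / 2) * laplace leb (@idfun R) w1 (x - p).
  have -> : c + 1 / 2 + l * x ^+ 2 = (\int[leb]_y (phi (y - x) * (l * y ^+ 2 + c2)))%R.
    have i1 : leb.-integrable setT (EFin \o (fun y : R => phi (y - x) * y ^+ 2)).
      apply: integrable_ge0; [by meas|by move=> y; nonneg|].
      by rewrite integral_phi_sqr ltry.
    have i2 := integrable_phi x; have i1' := integrable_scale l i1; have i2' := integrable_scale c2 i2.
    transitivity (\int[leb]_y (l * (phi (y - x) * y ^+ 2) + c2 * phi (y - x)))%R; last first.
      by apply: eq_Rintegral => y _; ring.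
    rewrite RintegralD// RintegralZl// RintegralZl//.
    by rewrite /Rintegral integral_phi_sqr integral_phi /c2/=; ring.
  rewrite /laplace -RintegralZl//.
  apply: eq_Rintegral => y _.
  by rewrite /w1 (phi_shift x p) -/(e y) !mulrA.
have f0 x : phi 0 * expR (- x ^+ 2 / 2) != 0 :> R.
  by rewrite mulf_neq0// gt_eqF ?phi0_gt0 ?expR_gt0.
pose h_ n := a_ n - p.
have hc : h_ n @[n --> \oo] --> (0 : R).
  by rewrite -(subrr p); apply: cvgB; [exact: ac|exact: cvg_cst].
have [N hN] : exists N, forall n, (N <= n)%N -> `|h_ n| <= 1.
  move/cvgrPdist_le : hc => /(_ 1 ltr01)[N _ h]; exists N => n Nn.
  by have /= := h n Nn; rewrite sub0r normrN.
have hm k : mom leb (@idfun R) w0 k = mom leb (@idfun R) w1 k.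
  apply: (@eq_mom_of_laplace _ _ _ _ R leb leb (@idfun R) w0 (@idfun R) w1 mid mw0 mid mw1 (fun n => h_ (n + N)%N)) => //.
  - by move=> n; rewrite subr_eq0.
  - by move=> n; apply: hN; rewrite leq_addl.
  - by rewrite cvg_shiftn.
  - move=> n; apply: (mulfI (f0 (a_ (n + N)%N))).
    rewrite -l0E -l1E.
    have /aZ[/= -> _] : (a_ @` setT) (a_ (n + N)%N) by exists (n + N)%N.
    by ring.
move=> x; suff : D nu x + 1 / 2 = c + 1 / 2 + l * x ^+ 2 by lra.
rewrite l0E l1E; congr (_ * _).
(* At [x = p] the transform is the moment of order 0; [eq_laplace_of_mom] covers the other
   points. *)
have [->|xp] := eqVneq (x - p) 0; last first.
  exact: (@eq_laplace_of_mom _ _ _ _ R leb leb (@idfun R) w0 (@idfun R) w1 mid mw0 mid mw1 (x - p) xp (ex0 _) (ex1 _) hm).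
have := hm 0%N; rewrite /mom /laplace.
under eq_Rintegral do rewrite expr0 mul1r.
under [in X in _ = X -> _]eq_Rintegral do rewrite expr0 mul1r.
move=> h.
under eq_Rintegral do rewrite mul0r expR0 mul1r.
by under [in RHS]eq_Rintegral do rewrite mul0r expR0 mul1r.
Qed.

End analytic_identity.

Lemma eq_measure_countable d (T : measurableType d) (R : realType)
  (m1 m2 : {measure set T -> \bar R}) (B : set T) :
  countable B -> (forall x : T, measurable [set x]) ->
  (forall x, B x -> m1 [set x] = m2 [set x]) -> m1 B = m2 B.
Proof.
move=> /countable_injP[f finj] m1x e.
pose F n := B `&` f @^-1` [set n].
have F01 n : F n = set0 \/ exists2 x, B x & F n = [set x].
  have [[x [Bx fx]]|/forallNP h] := pselect (exists x, F n x).
    right; exists x => //; apply/seteqP; split => [y [By fy]|y ->//].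
    by apply: finj; rewrite ?inE//; rewrite fx.
  by left; rewrite -subset0 => x /h.
have mF n : measurable (F n) by case: (F01 n) => [->|[x _ ->]].
have BE : B = \bigcup_n F n.
  by apply/seteqP; split => [x Bx|x [n _ []]//]; exists (f x).
have tF : trivIset setT F.
  by move=> i j _ _ [x [[_ /= <-] [_ /= <-]]].
have mB : measurable (\bigcup_n F n) by exact: bigcup_measurable.
rewrite BE !measure_semi_bigcup//; apply: eq_eseriesr => n _.
by case: (F01 n) => [->|[x Bx ->]]; [rewrite !measure0|exact: e].
Qed.

Lemma measure_countable0 d (T : measurableType d) (R : realType)
  (m : {measure set T -> \bar R}) (B : set T) :
  countable B -> (forall x : T, measurable [set x]) ->
  (forall x, B x -> m [set x] = 0%E) -> m B = 0%E.
Proof. exact: (@eq_measure_countable _ T R m (@mzero _ T R)). Qed.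

Lemma countable_locally_finite (R : realType) (B : set R) :
  (forall a b : R, finite_set (B `&` `[a, b])) -> countable B.
Proof.
move=> fB; apply: (@sub_countable _ _ _ (\bigcup_n (B `&` `[- n%:R, n%:R]%classic))).
  apply: subset_card_le => x Bx; exists (Num.truncn `|x|).+1 => //; split => //=.
  by rewrite in_itv/= -ler_norml; exact/ltW/truncnS_gt.
by apply: bigcup_countable => [|n _]; [exact: countableP|exact: finite_set_countable].
Qed.

(** * Purely atomic laws *)

Section atomic.
Variable R : realType.
Implicit Types mu nu : probability R R.

(** Agreement at points gives [nu S = mu S = 1], so [nu] is carried by [S] as well, and both laws
    are sums over its points. *)
Lemma eq_probability_atomic mu nu (S : set R) : countable S -> mu (~` S) = 0%E ->
  (forall x, mu [set x] = nu [set x]) -> forall A, measurable A -> nu A = mu A.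
Proof.
move=> cS muS e A mA.
have mS : measurable S by apply: countable_measurable.
have eS : nu S = mu S.
  by apply: eq_measure_countable => // x _; exact: esym (e x).
have nuS : nu (~` S) = 0%E.
  by rewrite probability_setC// eS -probability_setC.
have null (m : probability R R) : m (~` S) = 0%E -> m (A `\` S) = 0%E.
  move=> m0; apply/eqP; rewrite eq_le measure_ge0 andbT -m0.
  by apply: le_measure; rewrite ?inE//; [exact: measurableD|exact: measurableC].
have E (m : probability R R) : m (~` S) = 0%E -> m A = m (A `&` S).
  move=> m0; rewrite -[in LHS](setDUK (A := A `&` S) (B := A))//.
  rewrite measureU//; [|exact: measurableI|by apply: measurableD => //; exact: measurableI|].
    by rewrite setDIr setDv set0U [X in (_ + X)%E]null// adde0.
  by rewrite setDE setICA setICr setI0.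
rewrite (E mu)// (E nu)//; apply: eq_measure_countable => //; last by move=> x _; exact: esym (e x).
by apply: sub_countable cS; apply: subset_card_le => x [].
Qed.

End atomic.

(** * The Kuhn-Tucker conditions *)

Section extremal.
Variable R : realType.
Notation leb := (@lebesgue_measure R).
Implicit Types mu nu : probability R R.

Lemma integral_affine_sqr mu (c l e : R) : 0 <= c -> 0 <= l -> E2 mu = e%:E ->
  (\int[mu]_x (c + l * x ^+ 2)%:E = (c + l * e)%:E)%E.
Proof.
move=> c0 l0 eE; under eq_integral do rewrite EFinD EFinM.
rewrite ge0_integralD//; [|by move=> x _; rewrite mule_ge0 ?lee_fin ?sqr_ge0|by meas].
rewrite integral_cst_prob ge0_integralZl//; [|by meas|by move=> x _; rewrite lee_fin sqr_ge0].
by rewrite -/(E2 mu) eE -EFinM -EFinD.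
Qed.

Lemma J_le_of_D_le mu nu (c l e : R) : 0 <= c -> 0 <= l -> E2 mu = e%:E ->
  (forall x, D nu x <= c + l * x ^+ 2) -> (J mu nu <= (c + l * e + 1 / 2)%:E)%E.
Proof.
move=> c0 l0 eE h; have mD := measurable_D nu.
rewrite J_intD EFinD leeD2r// -(integral_affine_sqr c0 l0 eE).
apply: ge0_le_integral => //; try by meas.
- by move=> x _; rewrite lee_fin D_ge0.
- by move=> x _; rewrite lee_fin.
Qed.

Lemma J_of_D_eq mu nu (c l e : R) : 0 <= c -> 0 <= l -> E2 mu = e%:E ->
  (forall x, D nu x = c + l * x ^+ 2) -> J mu nu = (c + l * e + 1 / 2)%:E.
Proof.
move=> c0 l0 eE h; rewrite J_intD EFinD -(integral_affine_sqr c0 l0 eE).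
by congr (_ + _)%E; apply: eq_integral => x _; rewrite h.
Qed.

Lemma gaussian_self (v : R) : 0 <= v -> ln (1 + v) / 2 + (2 * (1 + v))^-1 * (1 + v) = ln (1 + v) / 2 + 1 / 2.
Proof. by move=> v0; rewrite invfM mulrAC -mulrA divff ?mulr1 ?mul1r//; apply: lt0r_neq0; lra. Qed.

(** A bound [D mu <= c] would cap the information of Gaussian inputs at [c], although it equals
    [ln (1 + v) / 2]; the variance is chosen to make this [c + 1]. *)
Lemma D_unbounded mu (c : R) : 0 <= c -> ~ (forall x, D mu x <= c).
Proof.
move=> c0 h.
have v0 : 0 <= expR (2 * (c + 1)) - 1 by rewrite subr_ge0 -[leLHS]expR0 ler_expR; lra.
have [nu [n1 n2 _]] := gaussian_reference v0.
have := gibbs nu mu; rewrite (n2 _ _ n1) gaussian_self// [1 + (_ - 1)]addrC subrK expRK.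
have /(J_le_of_D_le c0 (lexx 0) n1) h2 : forall x, D mu x <= c + 0 * x ^+ 2.
  by move=> x; rewrite mul0r addr0.
by move=> /le_trans/(_ h2); rewrite lee_fin; lra.
Qed.

Variables (g q : R) (mu0 : probability R R).
Hypotheses (q0 : 0 < q) (q1 : q < 1) (g0 : 0 < g).
Hypothesis L0 : Lambda g q mu0.
Hypothesis max0 : forall mu, Lambda g q mu -> (J mu mu <= J mu0 mu0)%E.

(** [l] prices power and [c - D mu0 0] prices a nonzero symbol. The value identity says that these
    prices, spent on the full budgets, return exactly the information; it yields complementary
    slackness here and the converse later. Contact is not claimed at 0, where the affine bound may
    be slack. *)
Lemma kkt : exists c l : R,
  [/\ 0 < l < 1 / 2, forall x, D mu0 x <= c + l * x ^+ 2,
      fine (J mu0 mu0) - 1 / 2 = q * D mu0 0 + (1 - q) * c + l * g, E2 mu0 = g%:E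
    & mu0 [set x | x != 0 /\ D mu0 x != c + l * x ^+ 2] = 0%E].
Proof.
have [q0' q1' g0'] : [/\ 0 < q, q < 1 & 0 < g] by split.
have [l l0 hD] := multiplier_exists (ltW q0) q1 g0 L0 max0.
move: hD; set i := fine (J mu0 mu0) - 1 / 2; set d0 := D mu0 0 => hD.
pose c := (i - q * d0) / (1 - q) - l * (g / (1 - q)).
have {}hD x : D mu0 x <= c + l * x ^+ 2.
  by apply: le_trans (hD x) _; rewrite /c le_eqVlt; apply/orP; left; apply/eqP; ring.
have iE : i = q * d0 + (1 - q) * c + l * g by rewrite /c; field; lra.
have d00 : 0 <= d0 by exact: D_ge0.
have cd0 : d0 <= c by have := hD 0; rewrite expr0n/= mulr0 addr0.
have c0 : 0 <= c by lra.
have E2f : (E2 mu0 < +oo)%E by exact: Lambda_E2_fin L0.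
have e2E : E2 mu0 = (fine (E2 mu0))%:E by rewrite fineK// ge0_fin_numE// E2_ge0.
have eg : fine (E2 mu0) <= g by rewrite -lee_fin -e2E; exact: L0.2.
have lpos : 0 < l.
  rewrite lt_neqAle l0 andbT; apply/eqP => l00.
  by apply: (@D_unbounded mu0 c c0) => x; have := hD x; rewrite -l00 mul0r addr0.
have iJ : J mu0 mu0 = (i + 1 / 2)%:E by rewrite /i subrK fineK// J_fin.
(* The chain is [l * g <= i <= ln (1 + g) / 2 < g / 2]. *)
have l12 : l < 1 / 2.
  have := J_self_le (ltW g0) L0.2; rewrite iJ lee_fin.
  have : ln (1 + g) < (1 + g) - 1 by apply: ln_lt_subr1; [lra|apply/eqP; lra].
  have : 0 <= (1 - q) * c by rewrite mulr_ge0//; lra.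
  have : 0 <= q * d0 by rewrite mulr_ge0//; lra.
  move=> h1 h2 h3 h4.
  have h5 : l * g < 1 / 2 * g by lra.
  by move: h5; rewrite ltr_pM2r.
pose E x := c + l * x ^+ 2 - D mu0 x.
have E0 x : 0 <= E x by rewrite /E subr_ge0.
have mD := measurable_D mu0.
pose E' x := if x == 0 then 0 else E x.
have E'0 x : 0 <= E' x by rewrite /E'; case: ifP.
have mE : measurable_fun setT E by rewrite /E; meas.
have mE' : measurable_fun setT E'.
  rewrite /E'; apply: measurable_fun_if => //; last exact: measurable_funTS.
  by apply: measurable_fun_eqr => //; exact: measurable_id.
pose m0 := fine (mu0 [set (0:R)]).
have m0E : mu0 [set (0 : R)] = m0%:E by rewrite /m0 fineK// fin_num_measure.
have qm0 : q <= m0 by rewrite -lee_fin -m0E; exact: L0.1.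
have tot : (\int[mu0]_x (E x)%:E = (c + l * fine (E2 mu0) - i)%:E)%E.
  have h : (\int[mu0]_x (c + l * x ^+ 2)%:E = \int[mu0]_x (D mu0 x)%:E + \int[mu0]_x (E x)%:E)%E.
    rewrite -ge0_integralD.
    - by apply: eq_integral => x _; rewrite -EFinD /E [in RHS]addrC subrK.
    - exact: measurableT.
    - by move=> x _; rewrite lee_fin D_ge0.
    - exact/measurable_EFinP.
    - by move=> x _; rewrite lee_fin.
    - exact/measurable_EFinP.
  move: h; rewrite (integral_affine_sqr c0 l0 e2E) integral_D iJ -EFinB addrK.
  move=> h; rewrite EFinB h addeAC subee// ?add0e//.
have spl : (\int[mu0]_x (E x)%:E = \int[mu0]_x (E' x)%:E + (E 0 * m0)%:E)%E.
  have -> : ((E 0 * m0)%:E = \int[mu0]_x (E 0 * \1_[set (0:R)] x)%:E)%E.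
    under eq_integral do rewrite EFinM.
    rewrite ge0_integralZl//; last by rewrite lee_fin.
      by rewrite integral_indic// setIT [X in (_ * X)%E]m0E EFinM.
    by apply/measurable_EFinP; exact: measurable_indic.
  rewrite -ge0_integralD//.
  - apply: eq_integral => x _; rewrite -EFinD /E' indicE; congr EFin.
    case: ifPn => [/eqP ->|x0]; first by rewrite mem_set// mulr1 add0r.
    by rewrite memNset ?mulr0 ?addr0// => /= /eqP; rewrite (negbTE x0).
  - by move=> x _; rewrite lee_fin.
  - by meas.
  - by move=> x _; rewrite lee_fin mulr_ge0.
  - by apply/measurable_EFinP; apply: measurable_funM; [exact: measurable_cst|exact: measurable_indic].
have E'i : (0 <= \int[mu0]_x (E' x)%:E)%E by apply: integral_ge0 => x _; rewrite lee_fin.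
have E'f : (\int[mu0]_x (E' x)%:E = (c + l * fine (E2 mu0) - i - E 0 * m0)%:E)%E.
  by rewrite EFinB -tot spl addeK.
(* The atom at 0 absorbs at least [q * (c - d0)] of the total slack; by the value identity at most
   [l * (fine (E2 mu0) - g)] remains. This forces equality in the power constraint and a zero
   integral of [E']. *)
have Em : q * (c - d0) <= E 0 * m0.
  rewrite /E expr0n/= mulr0 addr0 -/d0 mulrC; apply: ler_wpM2l => //; lra.
move: E'i; rewrite E'f lee_fin => E'i.
have le0 : 0 <= l * (fine (E2 mu0) - g).
  rewrite mulrBr; move: E'i Em; rewrite iE.
  move: (E 0 * m0) (l * fine _) (l * g) => u v w h1 h2; lra.
have e2g : fine (E2 mu0) = g.
  by apply/eqP; rewrite eq_le eg/=; move: le0; rewrite pmulr_rge0// subr_ge0.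
exists c, l; split=> //; first by rewrite lpos.
  by rewrite e2E e2g.
have meE' : measurable_fun setT (EFin \o E') by exact/measurable_EFinP.
have [+ _] := ae_eq_integral_abs mu0 measurableT meE'.
case.
  rewrite integral_norm_ge0// E'f e2g; apply/eqP; rewrite eq_le !lee_fin.
  move: E'i Em; rewrite e2g iE => E'i Em; apply/andP; split => //.
  move: (E 0 * m0) (l * g) E'i Em => u w h1 h2; lra.
move=> N [mN N0 sN]; apply/eqP; rewrite eq_le measure_ge0 andbT -N0.
apply: le_measure; rewrite ?inE//.
  rewrite (_ : [set x | _] = [set x | E' x != 0]).
    rewrite (_ : [set x | _] = E' @^-1` (~` [set 0])); last by apply/seteqP; split => x /= /eqP.
    rewrite -[X in measurable X]setTI; apply: mE' => //; exact: measurableC.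
  apply/seteqP; split => x /=; rewrite /E' /E; case: ifPn => //.
  - by move=> /eqP -> [/eqP].
  - by move=> x0 [_ h]; rewrite subr_eq0 eq_sym.
  - by rewrite eqxx.
  - by move=> x0; rewrite subr_eq0 eq_sym.
move=> x /= [x0 xD]; apply: sN => /= /(_ Logic.I)[] /eqP.
by rewrite /E' (negbTE x0) /E subr_eq0 eq_sym (negbTE xD).
Qed.

End extremal.

(** * Support, uniqueness and symmetry of the maximizer *)

Section structure_of_maximizer.
Variable R : realType.
Notation leb := (@lebesgue_measure R).
Implicit Types mu nu : probability R R.

(** If contact were an identity, [J nu mu] would depend only on the second moment of [nu]. For a
    Gaussian [nu] of the same power, [J nu mu = J mu mu <= J mu nu = J nu nu]: equality in Gibbs,
    hence the same output law and the same atoms, of which a Gaussian has none. *)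
Lemma contact_finite mu (c l g : R) : 0 <= c -> 0 <= l -> 0 < g -> E2 mu = g%:E ->
  (0 < mu [set 0%R])%E ->
  forall a b, finite_set ([set x | D mu x = c + l * x ^+ 2] `&` `[a, b]).
Proof.
move=> c0 l0 g0 eE m0 a b; apply: contrapT => /D_identity h.
have [nu [n1 n2 n3]] := gaussian_reference (ltW g0).
have e1 := J_of_D_eq c0 l0 n1 h; have e2 := J_of_D_eq c0 l0 eE h.
have le : (J nu mu <= J nu nu)%E by rewrite e1 -e2 (n2 _ _ n1) -(n2 _ _ eE) gibbs.
have fE : (E2 nu < +oo)%E by rewrite n1 ltry.
by move: m0; rewrite (eq_atoms (gibbs_eq fE le)) n3// ltxx.
Qed.

Lemma pY_le_bounded mu (K : R) : 0 <= K -> mu (~` `[- K, K]) = 0%E ->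
  forall y, pY mu y <= phi 0 * expR (K * `|y| - y ^+ 2 / 2).
Proof.
move=> K0 muK y; rewrite -lee_fin pYE -(integral_cst_prob mu (phi 0 * _)%:E).
apply: ae_ge0_le_integral => //.
- by move=> x _; nonneg.
- by meas.
- by move=> x _; rewrite lee_fin mulr_ge0 ?expR_ge0 ?phi_ge0.
exists (~` `[- K, K]); split => //; first exact: measurableC.
move=> x /= h xK; apply: h => _; rewrite lee_fin phiE ler_wpM2l ?phi_ge0// ler_expR.
move: xK; rewrite in_itv/= -ler_norml => xK.
have h1 : x * y <= K * `|y|.
  by apply: le_trans (ler_norm _) _; rewrite normrM ler_wpM2r.
have -> : - (y - x) ^+ 2 / 2 = x * y - x ^+ 2 / 2 - y ^+ 2 / 2 by field.
by have := sqr_ge0 x; lra.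
Qed.

Lemma D_ge_bounded mu (K l : R) : 0 <= K -> mu (~` `[- K, K]) = 0%E -> 0 <= l < 1 / 2 ->
  exists C, forall x, l * x ^+ 2 - C <= D mu x.
Proof.
move=> K0 muK /andP[l0 l1].
(* By completing the square, [y ^+ 2 / 2 - K * |y|] falls below [l * y ^+ 2] by at most half of this
   constant. *)
pose C := K ^+ 2 / (1 - 2 * l).
have C0 : 0 <= C by rewrite divr_ge0 ?sqr_ge0//; lra.
have hL y : l * y ^+ 2 <= Lf mu y + C.
  have h : y ^+ 2 / 2 - K * `|y| <= Lf mu y.
    rewrite Lf_ln; have p0 := pY_gt0 mu y; have f0 := @phi0_gt0 R.
    have pe : 0 < phi 0 * expR (K * `|y| - y ^+ 2 / 2) by apply: mulr_gt0 => //; exact: expR_gt0.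
    have := pY_le_bounded K0 muK y; rewrite -ler_ln ?posrE//.
    by rewrite lnM ?posrE ?expR_gt0// expRK; lra.
  apply: le_trans (lerD h (lexx C)).
  have d0 : 0 < 1 - 2 * l by lra.
  rewrite -subr_ge0 -[y ^+ 2]real_normK ?num_real//.
  rewrite (_ : _ - _ = ((1 - 2 * l) * `|y| - K) ^+ 2 / (2 * (1 - 2 * l)) + C / 2); last first.
    by rewrite /C; field; lra.
  by rewrite addr_ge0// divr_ge0 ?sqr_ge0//; lra.
exists (C + 1 / 2) => x; have mL := measurable_Lf mu.
have : ((l * (1 + x ^+ 2))%:E <= (D mu x + 1 / 2 + C)%:E)%E.
  rewrite EFinD -DgE EFinM -integral_phi_sqr -[X in (_ + X)%E]mule1 -(integral_phi x).
  rewrite -!ge0_integralZl//; try by meas.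
  all: try by move=> y _; nonneg.
  rewrite -ge0_integralD//; try by meas.
  all: try by move=> y _; rewrite -?EFinM lee_fin; apply: mulr_ge0 => //; rewrite ?phi_ge0 ?Lf_ge0.
  apply: ge0_le_integral => //; try by meas.
  - move=> y _; rewrite -EFinM lee_fin; apply: mulr_ge0 => //.
    by apply: mulr_ge0; [exact: phi_ge0|exact: sqr_ge0].
  - move=> y _; rewrite -!EFinM -EFinD lee_fin mulrCA [C * _]mulrC -mulrDr.
    by rewrite ler_wpM2l ?phi_ge0.
rewrite lee_fin => h; have : 0 <= l * 1 by rewrite mulr1.
by move: h; rewrite mulrDr; lra.
Qed.

Lemma no_bounded_support mu (K c l : R) : 0 <= K -> mu (~` `[- K, K]) = 0%E -> 0 <= l < 1 / 2 ->
  ~ (forall x, D mu x <= c + l * x ^+ 2).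
Proof.
move=> K0 muK /andP[l0 l1] h.
(* The growth rate halfway between [l] and 1/2 beats [l] by [1 / 4 - l / 2]. *)
have [|C hC] := D_ge_bounded K0 muK (l := (l + 1 / 2) / 2); first by lra.
pose x := (`|c| + `|C| + 1) / (1 / 4 - l / 2) + 1.
have d0 : 0 < 1 / 4 - l / 2 by lra.
have u0 : 0 < `|c| + `|C| + 1 by have := normr_ge0 c; have := normr_ge0 C; lra.
have x1 : (`|c| + `|C| + 1) / (1 / 4 - l / 2) <= x ^+ 2.
  have : 0 < (`|c| + `|C| + 1) / (1 / 4 - l / 2) by rewrite divr_gt0.
  rewrite /x; move: (_ / (_ - _)) => t t0; rewrite sqrrD1 -subr_ge0.
  have -> : t ^+ 2 + t *+ 2 + 1 - t = t ^+ 2 + t + 1 by rewrite mulr2n; ring.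
  by have := sqr_ge0 t; lra.
move: x1; rewrite ler_pdivrMr// => x1.
have := h x; have := hC x; have := ler_norm c; have := ler_norm C.
by move: (`|c|) (`|C|) (D mu x) x1 => *; lra.
Qed.

Lemma reflection_exists mu : exists nu : probability R R,
  [/\ forall A, nu A = mu [set - x | x in A], E2 nu = E2 mu & J nu nu = J mu mu].
Proof.
have mN : measurable_fun setT (fun x : R => - x) by meas.
have [nu [nuA nuI]] := pushforward_exists mu mN.
have pE y : pY nu y = pY mu (- y).
  apply: EFin_inj; rewrite !pYE nuI; [|by meas|by move=> x; nonneg].
  by apply: eq_integral => x _; rewrite -phiN; congr (phi _)%:E; ring.
exists nu; split.
- move=> A; rewrite nuA; congr (mu _); apply/seteqP; split => x /=.
    by move=> Ax; exists (- x) => //; rewrite opprK.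
  by move=> [y Ay <-]; rewrite opprK.
- rewrite /E2 nuI; [|by meas|by move=> x; nonneg].
  by apply: eq_integral => x _; rewrite sqrrN.
- rewrite /J -[RHS]ge0_integral_opp.
  + by apply: eq_integral => y _; rewrite /Lf !pE.
  + by have m1 := measurable_pY mu; have m2 := measurable_Lf mu; meas.
  + by move=> y; nonneg.
Qed.

Variables (g q : R) (mu0 : probability R R).
Hypotheses (q0 : 0 < q) (q1 : q < 1) (g0 : 0 < g).
Hypothesis L0 : Lambda g q mu0.
Hypothesis max0 : forall mu, Lambda g q mu -> (J mu mu <= J mu0 mu0)%E.

Lemma atom0_gt0 : (0 < mu0 [set 0%R])%E.
Proof. by apply: lt_le_trans (L0.1); rewrite lte_fin. Qed.

Lemma atoms_structure : [/\ mu0 (~` atoms mu0) = 0%E, infinite_set (atoms mu0)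
  & forall a b : R, finite_set (atoms mu0 `&` `[a, b])].
Proof.
have [c [l [/andP[l0 l1] hD iE eE null]]] := kkt q0 q1 g0 L0 max0.
have c0 : 0 <= c.
  by apply: le_trans (D_ge0 mu0 0) _; have := hD 0; rewrite expr0n/= mulr0 addr0.
have Zfin := contact_finite c0 (ltW l0) g0 eE atom0_gt0.
pose Z := [set x | D mu0 x = c + l * x ^+ 2].
pose N := [set x | x != 0 /\ D mu0 x != c + l * x ^+ 2].
have SN : ~` (Z `|` [set 0]) = N.
  apply/seteqP; split => x /=.
    by move=> /not_orP[h1 h2]; split; apply/eqP.
  by move=> [/eqP h1 /eqP h2]; apply/not_orP.
have mN : measurable N.
  rewrite -SN; apply: measurableC; apply: measurableU => //.
  by apply: countable_measurable => //; exact: countable_locally_finite.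
have aZ : atoms mu0 `<=` Z `|` [set 0].
  move=> x /= ax; apply: contrapT => xN.
  have {}xN : N x by rewrite -SN.
  suff : (mu0 [set x] <= mu0 N)%E by rewrite null leNgt ax.
  by apply: le_measure; rewrite ?inE// => y ->.
have fin a b : finite_set ((Z `|` [set 0]) `&` `[a, b]).
  rewrite setIUl finite_setU; split; first exact: Zfin.
  by apply: sub_finite_set (finite_set1 0) => x [].
have afin a b : finite_set (atoms mu0 `&` `[a, b]).
  by apply: sub_finite_set (fin a b) => x [/aZ].
have cS := countable_locally_finite fin.
have ca := countable_locally_finite afin.
have ma : measurable (atoms mu0).
  by apply: countable_measurable => //; exact: measurable_set1.
have mu_a : mu0 (~` atoms mu0) = 0%E.
  (* A contact point need not carry mass; those that do not are countable, hence jointly null. *)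
  have cD : countable ((Z `|` [set 0]) `\` atoms mu0).
    by apply: sub_countable cS; apply: subset_card_le => x [].
  have mD' : measurable ((Z `|` [set 0]) `\` atoms mu0).
    by apply: countable_measurable => //; exact: measurable_set1.
  apply/eqP; rewrite eq_le measure_ge0 andbT.
  apply: (@le_trans _ _ (mu0 (N `|` ((Z `|` [set 0]) `\` atoms mu0)))).
    apply: le_measure; rewrite ?inE; [exact: measurableC|exact: measurableU|].
    by rewrite -SN => x nax; have [h|h] := pselect ((Z `|` [set 0]) x); [right|left].
  apply: le_trans (measureU2 mu0 mN mD') _.
  have z0 : mu0 ((Z `|` [set 0]) `\` atoms mu0) = 0%E.
    apply: measure_countable0 => // x [_ /negP]; rewrite -leNgt => h.
    by apply/eqP; rewrite eq_le h measure_ge0.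
  by rewrite [X in (X + _)%E]null [X in (_ + X)%E]z0 adde0.
split => // fa.
have [K [K0 KA]] : exists K : R, 0 <= K /\ atoms mu0 `<=` `[- K, K].
  have [M [_ hM]] := compact_bounded (finite_compact fa).
  exists (`|M| + 1); split; first by rewrite addr_ge0.
  move=> x ax; rewrite /= in_itv/= -ler_norml; apply: hM => //.
  by have := ler_norm M; lra.
have muK : mu0 (~` `[- K, K]) = 0%E.
  apply/eqP; rewrite eq_le measure_ge0 andbT -mu_a.
  apply: le_measure; rewrite ?inE; [exact: measurableC|exact: measurableC|exact: subsetC].
by apply: (no_bounded_support K0 muK (l := l)) hD; rewrite (ltW l0).
Qed.

Lemma maximizer_unique mu : Lambda g q mu -> J mu mu = J mu0 mu0 ->
  forall A, measurable A -> mu A = mu0 A.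
Proof.
move=> Lm Jm; have [h1 _ h3] := atoms_structure.
have cS := countable_locally_finite h3.
apply: (eq_probability_atomic cS h1).
(* Optimality of [mu0] gives [J mu mu0 <= J mu0 mu0 = J mu mu], the equality case of Gibbs. *)
by apply/eq_atoms/gibbs_eq; [exact: Lambda_E2_fin Lm|rewrite Jm; exact: J_optimal L0 max0 _ Lm].
Qed.

Lemma maximizer_symmetric (A : set R) : measurable A -> mu0 [set - x | x in A] = mu0 A.
Proof.
have [nu [nuA nuE nuJ]] := reflection_exists mu0.
rewrite -nuA; apply: maximizer_unique => //; split; last by rewrite -/(E2 nu) nuE; exact: L0.2.
by rewrite nuA image_set1 oppr0; exact: L0.1.
Qed.

End structure_of_maximizer.

(** * Iterated integrals against product kernels *)

Section iterated_integrals.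
Variable R : realType.
Notation leb := (@lebesgue_measure R).

Definition nnm d (T : measurableType d) (F : T -> \bar R) :=
  measurable_fun setT F /\ forall z, (0 <= F z)%E.

(** The kernel is abstract so that the channel law [kphi] and the product output law [kout mu] are
    treated together; the latter ignores the input tuple, kept as a dummy argument. *)
Fixpoint iint (k : R -> R -> R) (n : nat) : (n.-tuple R -> \bar R) -> n.-tuple R -> \bar R :=
  match n return (n.-tuple R -> \bar R) -> n.-tuple R -> \bar R with
  | 0 => fun F _ => F [tuple]
  | n'.+1 => fun F x =>
      (\int[leb]_t ((k (thead x) t)%:E *
          iint k (fun y : n'.-tuple R => F [tuple of t :: y]) (behead_tuple x)))%E
  end.

Lemma gint_iint n (F : n.-tuple R -> \bar R) x : gint F x = iint (fun a t => phi (t - a)) F x.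
Proof.
by elim: n F x => // n IH F x /=; apply: eq_integral => t _; rewrite IH.
Qed.

Lemma measurable_tuple_cons d (T : measurableType d) n (f : T -> R) (h : T -> n.-tuple R) :
  measurable_fun setT f -> measurable_fun setT h ->
  measurable_fun setT (fun z => [tuple of f z :: h z]).
Proof. exact: measurable_cons. Qed.

Lemma nnm_cons n (F : n.+1.-tuple R -> \bar R) t :
  nnm F -> nnm (fun y : n.-tuple R => F [tuple of t :: y]).
Proof.
move=> [mF F0]; split => // .
by apply: (measurableT_comp mF); apply: measurable_tuple_cons.
Qed.

Definition density_kernel (k : R -> R -> R) := [/\ forall a, measurable_fun setT (k a),
  forall a t, 0 <= k a t & forall a, (\int[leb]_t (k a t)%:E = 1)%E].

Variable k : R -> R -> R.
Hypothesis Kk : density_kernel k.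

Let mk a : measurable_fun setT (k a). Proof. by case: Kk. Qed.
Let k0 a t : 0 <= k a t. Proof. by case: Kk. Qed.
Let k1 a : (\int[leb]_t (k a t)%:E = 1)%E. Proof. by case: Kk. Qed.

Lemma iint_ge0 n (F : n.-tuple R -> \bar R) x : (forall y, 0 <= F y)%E -> (0 <= iint k F x)%E.
Proof.
elim: n F x => [|n IH] F x F0 //=.
by apply: integral_ge0 => t _; rewrite mule_ge0 ?lee_fin// IH.
Qed.

(** The parameter space [T] is arbitrary because the induction step moves the first output letter
    into it. *)
Lemma measurable_iint_param n d (T : measurableType d) (F : T -> n.-tuple R -> \bar R) x :
  measurable_fun setT (fun z : T * n.-tuple R => F z.1 z.2) -> (forall s y, 0 <= F s y)%E ->
  measurable_fun setT (fun s => iint k (F s) x).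
Proof.
elim: n d T F x => [|n IH] d T F x mF F0 /=.
  have mc : measurable_fun setT (fun s : T => (s, [tuple] : 0.-tuple R)).
    by apply: measurable_fun_pair => //; exact: measurable_cst.
  exact: (measurableT_comp mF mc).
pose H (z : T * measurableTypeR R) : \bar R := ((k (thead x) z.2)%:E *
  iint k (fun y : n.-tuple R => F z.1 [tuple of z.2 :: y]) (behead_tuple x))%E.
apply: (@measurable_fun_fubini_tonelli_F _ _ _ _ _ leb H).
  apply: emeasurable_funM.
    apply/measurable_EFinP.
    exact: (measurableT_comp (mk (thead x)) (@measurable_snd _ _ T (measurableTypeR R))).
  apply: (IH _ _ (fun (z : T * measurableTypeR R) y => F z.1 [tuple of z.2 :: y])) => //.
  have h : measurable_fun setT (fun z : (T * measurableTypeR R) * n.-tuple R =>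
      (z.1.1, [tuple of z.1.2 :: z.2])).
    apply: measurable_fun_pair.
      exact: (measurableT_comp measurable_fst measurable_fst).
    apply: measurable_tuple_cons; last exact: measurable_snd.
    exact: (measurableT_comp measurable_snd measurable_fst).
  exact: (measurableT_comp mF h).
by move=> z; rewrite mule_ge0 ?lee_fin// iint_ge0.
Qed.

Lemma measurable_iint_cons n (F : n.+1.-tuple R -> \bar R) x : nnm F ->
  measurable_fun setT (fun t : R => iint k (fun y : n.-tuple R => F [tuple of t :: y]) x).
Proof.
move=> [mF F0]; apply: (measurable_iint_param (F := fun t y => F [tuple of t :: y])) => //.
apply: (measurableT_comp mF); apply: measurable_tuple_cons;
  [exact: measurable_fst|exact: measurable_snd].
Qed.

Lemma measurable_iint_step n (F : n.+1.-tuple R -> \bar R) a x : nnm F ->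
  measurable_fun setT (fun t : R => (k a t)%:E * iint k (fun y : n.-tuple R => F [tuple of t :: y]) x)%E.
Proof.
move=> nF; apply: emeasurable_funM; first exact/measurable_EFinP.
exact: measurable_iint_cons.
Qed.

Lemma eq_iint n (F G : n.-tuple R -> \bar R) x : (forall y, F y = G y) -> iint k F x = iint k G x.
Proof. by move=> h; congr (iint k _ x); apply/funext. Qed.

Lemma le_iint n (F G : n.-tuple R -> \bar R) x : nnm F -> nnm G ->
  (forall y, F y <= G y)%E -> (iint k F x <= iint k G x)%E.
Proof.
elim: n F G x => [|n IH] F G x nF nG h //=.
apply: ge0_le_integral => //.
- by move=> t _; rewrite mule_ge0 ?lee_fin// iint_ge0// => y; exact: nF.2.
- exact: measurable_iint_step.
- exact: measurable_iint_step.
- move=> t _; apply: lee_wpmul2l; first by rewrite lee_fin.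
  by apply: IH => //; exact: nnm_cons.
Qed.

Lemma iintD n (F G : n.-tuple R -> \bar R) x : nnm F -> nnm G ->
  (iint k (fun y => F y + G y) x = iint k F x + iint k G x)%E.
Proof.
elim: n F G x => [|n IH] F G x nF nG //=.
rewrite -ge0_integralD//.
- apply: eq_integral => t _; rewrite IH; [|exact: nnm_cons|exact: nnm_cons].
  by rewrite ge0_muleDr//; apply: iint_ge0 => y; [exact: nF.2|exact: nG.2].
- by move=> t _; rewrite mule_ge0 ?lee_fin// iint_ge0// => y; exact: nF.2.
- exact: measurable_iint_step.
- by move=> t _; rewrite mule_ge0 ?lee_fin// iint_ge0// => y; exact: nG.2.
- exact: measurable_iint_step.
Qed.

Lemma iintZl n (c : R) (F : n.-tuple R -> \bar R) x : 0 <= c -> nnm F ->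
  (iint k (fun y => c%:E * F y) x = c%:E * iint k F x)%E.
Proof.
move=> c0; elim: n F x => [|n IH] F x nF //=.
rewrite -ge0_integralZl//.
- apply: eq_integral => t _; rewrite (IH (fun y => F [tuple of t :: y])); last exact: nnm_cons.
  by rewrite muleCA.
- exact: measurable_iint_step.
- by move=> t _; rewrite mule_ge0 ?lee_fin// iint_ge0// => y; exact: nF.2.
Qed.

Lemma nnm_sum n (I : Type) (s : seq I) (F : I -> n.-tuple R -> \bar R) :
  (forall i, nnm (F i)) -> nnm (fun y => \sum_(i <- s) F i y)%E.
Proof.
move=> nF; split; last by move=> y; apply: sume_ge0 => i _; exact: (nF i).2.
by apply: emeasurable_sum => i; exact: (nF i).1.
Qed.

Lemma iint0 n x : iint k (fun _ : n.-tuple R => 0%E) x = 0%E.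
Proof.
elim: n x => //= n IH x; rewrite integral0_eq// => t _.
by rewrite IH mule0.
Qed.

Lemma iint_sum n (I : Type) (s : seq I) (F : I -> n.-tuple R -> \bar R) x :
  (forall i, nnm (F i)) ->
  (iint k (fun y => \sum_(i <- s) F i y) x = \sum_(i <- s) iint k (F i) x)%E.
Proof.
move=> nF; elim: s => [|i s IH].
  by rewrite big_nil (eq_iint (G := fun=> 0%E)) ?iint0// => y; rewrite big_nil.
rewrite big_cons -IH -iintD//; last exact: nnm_sum.
by apply: eq_iint => y; rewrite big_cons.
Qed.

Lemma iint_cst n (c : R) x : 0 <= c -> iint k (fun _ : n.-tuple R => c%:E) x = c%:E.
Proof.
move=> c0; elim: n x => //= n IH x.
under eq_integral do rewrite IH muleC.
rewrite ge0_integralZl//; [by rewrite k1 mule1|by apply/measurable_EFinP; exact: mk|].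
by move=> t _; rewrite lee_fin.
Qed.

End iterated_integrals.

(** * The converse *)

Section converse.
Variable R : realType.
Notation leb := (@lebesgue_measure R).
Implicit Types mu nu : probability R R.

(** Integrate [ln u <= u - 1] at [u = h * pY mu / (Z * phi)], where [Z] is the mean of [h] under the
    output law. The bounds on [h] keep [ln h] nonnegative and [Z] finite. *)
Lemma donsker_varadhan_letter mu (a B : R) (h : R -> R) : measurable_fun setT h ->
  (forall t, 1 <= h t <= B) ->
  (\int[leb]_t (phi (t - a) * ln (h t))%:E <=
    (D mu a + ln (fine (\int[leb]_t (pY mu t * h t)%:E)))%:E)%E.
Proof.
move=> mh hB.
have h0 t : 0 < h t by have /andP[+ _] := hB t; exact: lt_le_trans.
have lh0 t : 0 <= ln (h t) by have /andP[+ _] := hB t; exact: ln_ge0.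
have mp := measurable_pY mu; have mL := measurable_Lf mu.
set Ze := (\int[leb]_t (pY mu t * h t)%:E)%E; pose Z := fine Ze.
have Z1 : (1 <= Ze)%E.
  rewrite -[leLHS](integral_pY mu); apply: ge0_le_integral => //; try by meas.
  - by move=> t _; rewrite lee_fin pY_ge0.
  - by move=> t _; rewrite lee_fin ler_peMr ?pY_ge0//; have /andP[] := hB t.
have ZB : (Ze <= B%:E)%E.
  have B0 : 0 <= B by have /andP[h1 h2] := hB 0; lra.
  rewrite -[leRHS]mule1 -(integral_pY mu) -ge0_integralZl//; last 2 first.
  - by apply/measurable_EFinP.
  - by move=> t _; rewrite lee_fin pY_ge0.
  apply: ge0_le_integral => //; try by meas.
  - by move=> t _; rewrite lee_fin mulr_ge0 ?pY_ge0// ltW.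
  - by move=> t _; rewrite -EFinM lee_fin mulrC ler_wpM2r ?pY_ge0//; have /andP[] := hB t.
have Zf : Ze \is a fin_num.
  by rewrite ge0_fin_numE; [apply: le_lt_trans ZB _; rewrite ltry|apply: le_trans Z1].
have ZE : Ze = Z%:E by rewrite fineK.
have Zge1 : 1 <= Z by rewrite -lee_fin -ZE.
have Z0 : 0 < Z by lra.
have lZ0 : 0 <= ln Z by exact: ln_ge0.
pose A1 t := phi (t - a) * ln (h t).
pose A2 t := phi (t - a) * ((t - a) ^+ 2 / 2).
pose B1 t := phi (t - a) * Lf mu t.
(* Negative terms are moved across, so that both sides are sums of nonnegative functions. *)
have key t : A1 t + A2 t + phi (t - a) <= B1 t + ln Z * phi (t - a) + Z^-1 * (pY mu t * h t).
  have p0 := pY_gt0 mu t; have f0 := phi_gt0 (t - a).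
  have r0 : 0 < h t * pY mu t / (Z * phi (t - a)).
    by apply: divr_gt0; apply: mulr_gt0.
  have := le_ln1Dx (x := h t * pY mu t / (Z * phi (t - a)) - 1).
  rewrite [1 + _]addrC subrK => /(_ ltac:(by lra)).
  rewrite ln_div ?posrE; [|exact: mulr_gt0|exact: mulr_gt0].
  rewrite lnM ?posrE// lnM ?posrE// ln_phi.
  have e1 : phi (t - a) * (h t * pY mu t / (Z * phi (t - a))) = Z^-1 * (pY mu t * h t).
    by field; rewrite !gt_eqF.
  rewrite -(ler_pM2l f0) [X in _ <= X -> _]mulrBr e1 /A1 /A2 /B1 Lf_ln.
  move: (Z^-1 * _) (phi (t - a)) (ln (h t)) (ln (pY mu t)) (ln Z) (ln (phi 0)) ((t - a) ^+ 2 / 2).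
  by move=> u v x y z w s; lra.
have mA1 : measurable_fun setT A1 by rewrite /A1; meas.
have mA2 : measurable_fun setT A2 by rewrite /A2; meas.
have mB1 : measurable_fun setT B1 by rewrite /B1; meas.
have A10 t : 0 <= A1 t by rewrite /A1; nonneg.
have A20 t : 0 <= A2 t by rewrite /A2; nonneg.
have B10 t : 0 <= B1 t by rewrite /B1; nonneg.
have ph0 t : 0 <= pY mu t * h t by apply: mulr_ge0; [exact: pY_ge0|exact: ltW].
have Zi : 0 <= Z^-1 by rewrite invr_ge0 ltW.
have E : (\int[leb]_t (A1 t + A2 t + phi (t - a))%:E <=
   \int[leb]_t (B1 t + ln Z * phi (t - a) + Z^-1 * (pY mu t * h t))%:E)%E.
  by apply: ge0_le_integral => //; ig; move=> t _; rewrite lee_fin.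
have EA : (\int[leb]_t (A1 t + A2 t + phi (t - a))%:E = \int[leb]_t (A1 t)%:E + (1 / 2)%:E + 1)%E.
  under eq_integral do rewrite !EFinD.
  by rewrite ge0_integralD; ig; rewrite integral_phi ge0_integralD; ig; rewrite integral_phi_half.
have EB : (\int[leb]_t (B1 t + ln Z * phi (t - a) + Z^-1 * (pY mu t * h t))%:E =
    (D mu a + 1 / 2 + ln Z + 1)%:E)%E.
  under eq_integral do rewrite !EFinD.
  rewrite ge0_integralD; ig; rewrite ge0_integralD; ig; rewrite -/(Dg mu a) DgE.
  under [X in (_ + X + _)%E]eq_integral do rewrite EFinM.
  under [X in (_ + X)%E]eq_integral do rewrite EFinM.
  rewrite ge0_integralZl//; ig; rewrite ge0_integralZl//; ig.
  by rewrite -/Ze ZE integral_phi mule1 -EFinM mulVf ?gt_eqF.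
move: E; rewrite EA EB.
have : (0 <= \int[leb]_t (A1 t)%:E)%E.
  by apply: integral_ge0 => t _; rewrite lee_fin.
rewrite /A1; case: (\int[leb]_t _)%E => //= v _.
by rewrite -!EFinD !lee_fin -/Z; lra.
Qed.

Definition kphi (a t : R) : R := phi (t - a).
Definition kout mu (a t : R) : R := pY mu t.

Lemma kphi_kernel : density_kernel kphi.
Proof.
split=> [a|a t|a]; [by rewrite /kphi; meas|exact: phi_ge0|exact: integral_phi].
Qed.

Lemma kout_kernel mu : density_kernel (kout mu).
Proof. by split=> [a|a t|a]; [exact: measurable_pY|exact: pY_ge0|exact: integral_pY]. Qed.

Lemma iint_kout_indep mu n (F : n.-tuple R -> \bar R) x x' : iint (kout mu) F x = iint (kout mu) F x'.
Proof.
elim: n F x x' => [|n IH] F x x' //=.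
by apply: eq_integral => t _; rewrite (IH _ _ (behead_tuple x')).
Qed.

(** Induction on letters: with the first output fixed, the remaining ones give an inner integral
    [qf t], a function between 1 and [expR B], to which the one-letter inequality applies. *)
Lemma donsker_varadhan mu n (F : n.-tuple R -> R) (B : R) x : measurable_fun setT F ->
  (forall y, 0 <= F y <= B) ->
  (iint kphi (fun y => (F y)%:E) x <=
   (\sum_(a <- x) D mu a + ln (fine (iint (kout mu) (fun y => (expR (F y))%:E) x)))%:E)%E.
Proof.
elim: n F x => [|n IH] F x mF FB.
  by rewrite /= [x]tuple0 big_nil expRK add0r.
have nF : nnm (fun y => (F y)%:E).
  by split; [exact/measurable_EFinP|move=> y; rewrite lee_fin; have /andP[] := FB y].
have nE : nnm (fun y => (expR (F y))%:E).
  split; last by move=> y; rewrite lee_fin expR_ge0.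
  by apply/measurable_EFinP; apply: (measurableT_comp (@measurable_expR _)).
have B0 : 0 <= B by have /andP[h1 h2] := FB x; lra.
set x' := behead_tuple x.
pose qe (t : R) := iint (kout mu) (fun y : n.-tuple R => (expR (F [tuple of t :: y]))%:E) x'.
have mqe : measurable_fun setT qe.
  exact: (measurable_iint_cons (kout_kernel mu) x' nE).
have qb t : (1 <= qe t <= (expR B)%:E)%E.
  have nEt := nnm_cons t nE.
  have cst_nnm (c : R) : 0 <= c -> nnm (fun _ : n.-tuple R => c%:E).
    by move=> c0; split => // _; rewrite lee_fin.
  apply/andP; split.
    rewrite -[leLHS](iint_cst (kout_kernel mu) x' ler01).
    apply: (le_iint (kout_kernel mu) _ (cst_nnm _ ler01) nEt).
    by move=> y; rewrite lee_fin -[leLHS]expR0 ler_expR; have /andP[] := FB [tuple of t :: y].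
  rewrite -(iint_cst (kout_kernel mu) x' (expR_ge0 B)).
  apply: (le_iint (kout_kernel mu) _ nEt (cst_nnm _ (expR_ge0 B))).
  by move=> y; rewrite lee_fin ler_expR; have /andP[] := FB [tuple of t :: y].
pose qf t := fine (qe t).
have qfE t : qe t = (qf t)%:E.
  have /andP[h1 h2] := qb t; rewrite /qf fineK// ge0_fin_numE; last by apply: le_trans h1.
  by apply: le_lt_trans h2 _; rewrite ltry.
have qfb t : 1 <= qf t <= expR B by have := qb t; rewrite qfE !lee_fin.
have mqf : measurable_fun setT qf.
  by apply: (measurableT_comp (fine_measurable measurableT)).
pose S' := \sum_(a <- x') D mu a.
have S0 : 0 <= S' by apply: sumr_ge0 => a _; exact: D_ge0.
have lq0 t : 0 <= ln (qf t) by apply: ln_ge0; have /andP[] := qfb t.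
have step : (iint kphi (fun y => (F y)%:E) x <=
    S'%:E + \int[leb]_t (phi (t - thead x) * ln (qf t))%:E)%E.
  have -> : (S'%:E + \int[leb]_t (phi (t - thead x) * ln (qf t))%:E =
     \int[leb]_t (S'%:E * (phi (t - thead x))%:E + (phi (t - thead x) * ln (qf t))%:E))%E.
    by rewrite ge0_integralD; ig; rewrite ge0_integralZl; ig; rewrite integral_phi mule1.
  apply: ge0_le_integral => //.
  - by move=> t _; rewrite mule_ge0 ?lee_fin ?phi_ge0// (iint_ge0 kphi_kernel)// => y; exact: nF.2.
  - exact: (measurable_iint_step kphi_kernel (thead x) x' nF).
  - by meas.
  - move=> t _; have -> : (S'%:E * (phi (t - thead x))%:E + (phi (t - thead x) * ln (qf t))%:E =
        (phi (t - thead x))%:E * (S' + ln (qf t))%:E)%E.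
      by rewrite -!EFinM -EFinD; congr EFin; ring.
    apply: lee_wpmul2l; first by rewrite lee_fin phi_ge0.
    apply: IH => //.
    by apply: (measurableT_comp mF); apply: measurable_tuple_cons.
apply: le_trans step _.
apply: (@le_trans _ _ (S'%:E + (D mu (thead x) + ln (fine (\int[leb]_t (pY mu t * qf t)%:E)))%:E)%E).
  by rewrite leeD2l// (donsker_varadhan_letter _ _ mqf qfb).
rewrite [X in \sum_(a <- X) _](_ : _ = thead x :: x'); last by rewrite [in LHS](tuple_eta x).
rewrite big_cons -/S' -EFinD lee_fin addrA [S' + _]addrC lerD2l.
rewrite le_eqVlt; apply/orP; left; apply/eqP; congr (ln (fine _)).
by apply: eq_integral => t _; rewrite EFinM -qfE.
Qed.

Lemma sum_letters_le (s : seq R) (DD : R -> R) (c l : R) : (forall a, DD a <= c + l * a ^+ 2) ->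
  0 <= l ->
  \sum_(a <- s) DD a <= (size s)%:R * DD 0 + (c - DD 0) * (count (fun a => a != 0) s)%:R +
    l * \sum_(a <- s) a ^+ 2.
Proof.
move=> h l0; elim: s => [|a s IH].
  by rewrite !big_nil /= mulr0 mul0r mulr0 !addr0.
rewrite !big_cons /= -[(size s).+1]add1n !natrD.
move: IH; move: (\sum_(_ <- _) DD _) (\sum_(_ <- _) _ ^+ 2) => u v.
move: ((size s)%:R) ((count _ s)%:R) => x y IH.
have [->|a0] /= := eqVneq a 0.
  by rewrite expr0n/= !add0r; lra.
by have := h a; lra.
Qed.

Lemma nnm_indicator d (T : measurableType d) (A : T -> bool) : measurable [set y | A y] ->
  nnm (fun y => ((A y)%:R : R)%:E).
Proof.
move=> mA; split; last by move=> y; rewrite lee_fin ler0n.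
apply/measurable_EFinP; have := @measurable_indic _ T R setT [set y | A y] mA; congr (measurable_fun _ _).
apply/funext => y; rewrite indicE; congr (_%:R); congr nat_of_bool.
by apply/idP/idP; rewrite inE.
Qed.

(** Some decoding region has reference probability at most [1 / M]. Testing it with [ln M] times its
    indicator gives an exponential moment of at most 2, whence [ln 2]; examining this one codeword
    is enough because [S] bounds all of them. *)
Lemma fano_bound mu (n M : nat) (f : 'I_M -> n.-tuple R) (g : n.-tuple R -> 'I_M) (eps S : R) :
  (0 < M)%N -> (forall m, measurable (g @^-1` [set m])) ->
  (forall m, ((1 - eps)%:E <= gint (fun y => (g y == m)%:R%:E) (f m))%E) ->
  (forall m, \sum_(a <- f m) D mu a <= S) ->
  (1 - eps) * ln M%:R <= S + ln 2.
Proof.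
move=> M0 mg hg hS.
have M1 : 1 <= M%:R :> R by rewrite ler1n.
have nI m : nnm (fun y => ((g y == m)%:R : R)%:E).
  apply: nnm_indicator; rewrite (_ : [set _ | _] = g @^-1` [set m])//.
  by apply/seteqP; split => y /= /eqP.
pose m0 := Ordinal M0.
pose Q m := iint (kout mu) (fun y => ((g y == m)%:R : R)%:E) (f m0).
have Q1 : (\sum_m Q m = 1)%E.
  rewrite -(iint_sum (kout_kernel mu) _ (f m0) nI).
  rewrite -[RHS](iint_cst (kout_kernel mu) (f m0) ler01).
  apply: eq_iint => y; rewrite sumEFin; congr EFin.
  rewrite (bigD1 (g y))//= eqxx big1 ?addr0// => i /negbTE; by rewrite eq_sym => ->.
have Q0 m : (0 <= Q m)%E.
  by apply: (iint_ge0 (kout_kernel mu)) => y; rewrite lee_fin ler0n.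
have Qf m : Q m = (fine (Q m))%:E.
  rewrite fineK// ge0_fin_numE//; apply: (@le_lt_trans _ _ 1%E); last exact: ltry.
  by rewrite -Q1 (bigD1 m)//= leeDl// sume_ge0.
have [m hm] : exists m, fine (Q m) <= M%:R^-1.
  apply: contrapT => /forallNP h.
  suff : (1 < \sum_m fine (Q m))%R.
    by rewrite -lte_fin -sumEFin; under eq_bigr do rewrite -Qf; rewrite Q1 ltxx.
  apply: (@le_lt_trans _ _ (\sum_(m < M) M%:R^-1)).
    by rewrite sumr_const card_ord -[_ *+ M]mulr_natr mulVf// gt_eqF// ltr0n.
  apply: ltr_sum; first by apply/hasP; exists m0 => //; rewrite mem_index_enum.
  by move=> m _; rewrite ltNge; apply/negP/h.
pose th := ln M%:R : R.
have th0 : 0 <= th by exact: ln_ge0.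
pose F (y : n.-tuple R) := th * (g y == m)%:R.
have mF : measurable_fun setT F.
  apply: measurable_funM; first exact: measurable_cst.
  by apply/measurable_EFinP; exact: (nI m).1.
have FB y : 0 <= F y <= th.
  by rewrite /F; case: eqP => _; rewrite ?mulr1 ?mulr0 ?th0 ?lexx.
have := donsker_varadhan mu (f m) mF FB.
have -> : iint kphi (fun y => (F y)%:E) (f m) = (th%:E * gint (fun y => (g y == m)%:R%:E) (f m))%E.
  rewrite gint_iint -(iintZl kphi_kernel _ th0 (nI m)).
  by apply: eq_iint => y; rewrite -EFinM.
have -> : iint (kout mu) (fun y => (expR (F y))%:E) (f m) = (1 + (M%:R - 1) * fine (Q m))%:E.
  rewrite (iint_kout_indep _ _ _ (f m0)) EFinD EFinM -Qf.
  rewrite -(iintZl (kout_kernel mu) _ _ (nI m)); last by lra.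
  rewrite -[X in (X + _)%E](iint_cst (kout_kernel mu) (f m0) ler01).
  rewrite -(iintD (kout_kernel mu)).
  - apply: eq_iint => y; rewrite -EFinM -EFinD /F; congr EFin.
    case: eqP => _; rewrite ?mulr1 ?mulr0 ?expR0 ?addr0// lnK ?posrE ?ltr0n//.
    by rewrite addrC subrK.
  - by split => // _; rewrite lee_fin.
  - split; first by apply: emeasurable_funM => //; exact: (nI m).1.
    by move=> y; rewrite mule_ge0 ?lee_fin ?ler0n// subr_ge0.
move=> h.
have h2 : (((1 - eps) * th)%:E <= (S + ln 2)%:E)%E.
  rewrite mulrC EFinM; apply: (@le_trans _ _ (th%:E * gint (fun y => (g y == m)%:R%:E) (f m))%E).
    by apply: lee_wpmul2l; [rewrite lee_fin|exact: hg].
  apply: le_trans h _; rewrite lee_fin; apply: lerD; first exact: hS.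
  have Qm0 : 0 <= fine (Q m) by rewrite -lee_fin -Qf.
  have h3 : (M%:R - 1) * fine (Q m) <= 1.
    apply: (@le_trans _ _ (M%:R * M%:R^-1)); last by rewrite divff// gt_eqF// ltr0n.
    by apply: ler_pM => //; lra.
  have h4 : 0 <= (M%:R - 1) * fine (Q m) by apply: mulr_ge0 => //; lra.
  by rewrite /= ler_ln ?posrE; lra.
by move: h2; rewrite lee_fin.
Qed.

Variables (g q : R) (mu0 : probability R R).
Hypotheses (q0 : 0 < q) (q1 : q < 1) (g0 : 0 < g).
Hypothesis L0 : Lambda g q mu0.
Hypothesis max0 : forall mu, Lambda g q mu -> (J mu mu <= J mu0 mu0)%E.

(** Each nonzero letter is charged [c - D mu0 0] and each unit of energy [l]; the constraints bound
    both charges, and the value identity in [kkt] gives the total. *)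
Lemma codeword_sum_le n (x : n.-tuple R) :
  (count (fun a : R => a != 0) x)%:R <= (1 - q) * n%:R -> \sum_(a <- x) a ^+ 2 <= n%:R * g ->
  \sum_(a <- x) D mu0 a <= n%:R * (fine (J mu0 mu0) - 1 / 2).
Proof.
move=> hc hs; have [c [l [/andP[l0 l1] hD iE eE _]]] := kkt q0 q1 g0 L0 max0.
have cd : 0 <= c - D mu0 0 by rewrite subr_ge0; have := hD 0; rewrite expr0n/= mulr0 addr0.
apply: le_trans (sum_letters_le _ hD (ltW l0)) _.
rewrite size_tuple iE.
have h1 : (c - D mu0 0) * (count (fun a : R => a != 0) x)%:R <= (c - D mu0 0) * ((1 - q) * n%:R).
  by rewrite ler_wpM2l.
have h2 : l * \sum_(a <- x) a ^+ 2 <= l * (n%:R * g) by rewrite ler_wpM2l// ltW.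
apply: le_trans (lerD (lerD (lexx _) h1) h2) _.
by rewrite le_eqVlt; apply/orP; left; apply/eqP; ring.
Qed.

Lemma converse_bound r : achievable g q r -> r <= fine (J mu0 mu0) - 1 / 2.
Proof.
set I := fine (J mu0 mu0) - 1 / 2 => ach.
have I0 : 0 <= I.
  rewrite -lee_fin -(MI_I L0) MI_J -integral_D.
  by apply: integral_ge0 => x _; rewrite lee_fin D_ge0.
rewrite leNgt; apply/negP => Ir.
have r0 : 0 < r by lra.
(* With this error level [(1 - eps) * r] is the midpoint of [I] and [r]; [n] is then taken large
   enough for the surplus [(r - I) / 2] per letter to exceed [ln 2]. *)
pose eps := (r - I) / (2 * r).
have e0 : 0 < eps by rewrite divr_gt0//; lra.
have er : eps * r = (r - I) / 2 by rewrite /eps; field; lra.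
have e1 : eps < 1.
  by rewrite ltr_pdivrMr; lra.
have [N hN] := ach eps e0.
have d0 : 0 < (r - I) / 2 by lra.
pose n := maxn N (Num.truncn (ln 2 / ((r - I) / 2))).+1.
have [M [f [gd [hM [h1 h2 h3 h4]]]]] := hN n (leq_maxl _ _).
have M0 : (0 < M)%N by rewrite -(ltr0n R); apply: lt_le_trans hM; exact: expR_gt0.
have := fano_bound M0 h3 h4 (fun m => codeword_sum_le (h1 m) (h2 m)).
have : n%:R * r <= ln M%:R.
  by rewrite -[leLHS]expRK ler_ln ?posrE ?expR_gt0// ltr0n.
rewrite -/I => h5 h6.
have h7 : (1 - eps) * (n%:R * r) <= (1 - eps) * ln M%:R by rewrite ler_wpM2l//; lra.
have h8 : n%:R * ((r - I) / 2) <= ln 2.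
  have : (1 - eps) * (n%:R * r) = n%:R * r - n%:R * (eps * r) by ring.
  rewrite er; move: h6 h7; lra.
have : ln 2 < n%:R * ((r - I) / 2).
  rewrite -ltr_pdivrMr//; apply: lt_le_trans (truncnS_gt _) _.
  by rewrite ler_nat leq_maxr.
by rewrite ltNge h8.
Qed.

End converse.

(** * Finite input laws close to the maximizer *)

Section quantization.
Variable R : realType.
Notation leb := (@lebesgue_measure R).
Implicit Types mu nu : probability R R.

Definition mass mu (a : R) : R := fine (mu [set a]).

Lemma massE mu a : mu [set a] = (mass mu a)%:E.
Proof. by rewrite /mass fineK// fin_num_measure. Qed.

Lemma mass_ge0 mu a : 0 <= mass mu a.
Proof. by rewrite -lee_fin -massE. Qed.

Lemma integral_seq mu (s : seq R) (f : R -> R) : uniq s -> measurable_fun setT f ->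
  (forall x, 0 <= f x) ->
  (\int[mu]_(x in [set` s]) (f x)%:E = (\sum_(a <- s) mass mu a * f a)%:E)%E.
Proof.
move=> us mf f0; rewrite integral_mkcond.
transitivity (\int[mu]_x \sum_(a <- s) ((f a)%:E * (\1_[set a] x)%:E))%E.
  apply: eq_integral => x _; rewrite patchE; under eq_bigr do rewrite -EFinM.
  rewrite sumEFin.
  have E a : f a * \1_[set a] x = f x * (a == x)%:R.
    rewrite indicE; have [->|ax] := eqVneq a x; first by rewrite mem_set.
    by rewrite memNset ?mulr0// => xa; move: ax; rewrite xa eqxx.
  under eq_bigr do rewrite E.
  rewrite -mulr_sumr; case: ifPn => xs.
    move: xs; rewrite inE /= => xs.
    rewrite (bigD1_seq x)//= eqxx big1 ?addr0 ?mulr1// => a /negbTE -> //.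
  move: xs; rewrite notin_setE /= => xs.
  rewrite big_seq big1 ?mulr0// => a sa.
  by have [ax|//] := eqVneq a x; move: sa; rewrite ax => /xs.
rewrite ge0_integral_sum//.
- rewrite -sumEFin; apply: eq_bigr => a _; rewrite ge0_integralZl//.
  + by rewrite integral_indic// setIT [X in (_ * X)%E]massE -EFinM mulrC.
  + by apply/measurable_EFinP; exact: measurable_indic.
  + by rewrite lee_fin.
- move=> a; apply: emeasurable_funM; first exact: measurable_cst.
  by apply/measurable_EFinP; exact: measurable_indic.
- by move=> a x _; rewrite mule_ge0 ?lee_fin.
Qed.

Lemma sum_mass_le mu (s : seq R) (f : R -> R) (i : R) : uniq s -> measurable_fun setT f ->
  (forall x, 0 <= f x) -> (\int[mu]_x (f x)%:E <= i%:E)%E ->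
  \sum_(a <- s) mass mu a * f a <= i.
Proof.
move=> us mf f0 h; rewrite -lee_fin -(integral_seq _ us mf f0); apply: le_trans h.
apply: ge0_subset_integral => //.
- by apply: countable_measurable => //; apply: finite_set_countable; apply/finite_seqP; exists s.
- exact/measurable_EFinP.
- by move=> x _; rewrite lee_fin.
Qed.

Lemma atomic_approx mu (f : R -> R) (i : R) : mu (~` atoms mu) = 0%E ->
  (forall a b : R, finite_set (atoms mu `&` `[a, b])) ->
  measurable_fun setT f -> (forall x, 0 <= f x) -> (\int[mu]_x (f x)%:E = i%:E)%E ->
  forall d, 0 < d -> exists K : nat, forall k (s : seq R), (K <= k)%N -> uniq s ->
    [set` s] = atoms mu `&` `[- k%:R, k%:R] -> i - d <= \sum_(a <- s) mass mu a * f a.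
Proof.
move=> null fin mf f0 fi d d0.
have ma : measurable (atoms mu).
  by apply: countable_measurable => //; exact: countable_locally_finite.
pose F (k : nat) := atoms mu `&` `[- k%:R, k%:R]%classic.
have mF k : measurable (F k) by apply: measurableI.
have ndF : nondecreasing_seq F.
  move=> k k' kk'; apply/subsetPset => x [ax /=]; rewrite in_itv/= -ler_norml => xk.
  split => //=; rewrite in_itv/= -ler_norml; apply: le_trans xk _; by rewrite ler_nat.
have FU : \bigcup_k F k = atoms mu.
  apply/seteqP; split => [x [k _ []]//|x ax].
  exists (Num.truncn `|x|).+1 => //; split => //=.
  by rewrite in_itv/= -ler_norml; exact/ltW/truncnS_gt.
have mfe D : measurable_fun D (EFin \o f).
  by apply: measurable_funTS; apply/measurable_EFinP.
have := @ge0_nondecreasing_set_cvg_integral _ _ R F (EFin \o f) mu ndF mF (fun i => mfe (F i)) _.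
rewrite FU => /(_ (fun _ x _ => f0 x)).
have -> : (\int[mu]_(x in atoms mu) (EFin \o f) x = i%:E)%E.
  rewrite -fi -(setTI (atoms mu)) -[X in (_ = \int[_]_(x in X) _)%E](setvU (atoms mu)).
  rewrite [in LHS]setTI ge0_integral_setU//.
  - rewrite (@null_set_integral _ _ _ mu (~` atoms mu))// ?add0e//.
    exact: measurableC.
  - exact: measurableC.
  - by move=> x _; rewrite lee_fin.
  - by rewrite disj_set2E setICl.
move=> /fine_cvgP[_ /cvgrPdist_le /(_ d d0)[K _ hK]].
exists K => k s Kk us sE; have := hK k Kk.
rewrite /= -/(F k) /F -sE (integral_seq mu us mf f0) /= => h.
have := le_trans (ler_norm _) h; lra.
Qed.

Variables (g q : R) (mu0 : probability R R).
Hypotheses (q0 : 0 < q) (q1 : q < 1) (g0 : 0 < g).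
Hypothesis L0 : Lambda g q mu0.
Hypothesis max0 : forall mu, Lambda g q mu -> (J mu mu <= J mu0 mu0)%E.

(** The mass lost by truncation and by the factor [1 - eta] goes to 0, which makes both constraints
    strict. The excess at 0 is compared with the atom of [mu0] there, of mass at least [q], so the
    output density grows by a factor of at most [kap]. *)
Lemma good_weights (r' z : R) : r' < fine (J mu0 mu0) - 1 / 2 -> 1 < z ->
  exists (s : seq R) (w : R -> R) (kap : R),
  [/\ forall a, 0 <= w a, \sum_(a <- s) w a = 1, 0 <= kap < z
    & forall y, \sum_(a <- s) w a * phi (y - a) <= kap * pY mu0 y] /\
  [/\ r' < \sum_(a <- s) w a * D mu0 a, \sum_(a <- s) w a * a ^+ 2 < g
    & \sum_(a <- s) w a * (a != 0)%:R < 1 - q].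
Proof.
move=> r'I z1; have [null _ fin] := atoms_structure q0 q1 g0 L0 max0.
move: r'I; set I := fine (J mu0 mu0) - 1 / 2 => r'I.
have [q0' q1' g0'] : [/\ 0 < q, q < 1 & 0 < g] by split.
have mD := measurable_D mu0; have D0 := D_ge0 mu0.
have iD : (\int[mu0]_x (D mu0 x)%:E = I%:E)%E.
  by rewrite integral_D -(MI_I L0) MI_J.
have I0 : 0 <= I by rewrite -lee_fin -iD; apply: integral_ge0 => x _; rewrite lee_fin.
(* The three bounds keep [1 - eta] positive, the information lost by scaling at most a quarter of
   [I - r'], and [2 * eta / q] at most [(z - 1) / 2]. *)
pose eta := Num.min (1 / 2) (Num.min ((I - r') / (4 * (I + 1))) ((z - 1) * q / 4)).
have I4 : 0 < 4 * (I + 1) by lra.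
have eta0 : 0 < eta.
  by rewrite !lt_min !divr_gt0//= ?mulr_gt0//; lra.
have eta1 : eta <= 1 / 2 by rewrite ge_min lexx.
have eta2 : eta * (I + 1) <= (I - r') / 4.
  have : eta <= (I - r') / (4 * (I + 1)) by rewrite !ge_min lexx orbT.
  by rewrite ler_pdivlMr// => h; lra.
have eta3 : eta <= (z - 1) * q / 4 by rewrite !ge_min lexx !orbT.
have d0 : 0 < (I - r') / 4 by lra.
have [K1 hK1] := atomic_approx null fin mD D0 iD d0.
have [K2 hK2] := atomic_approx null fin (@measurable_cst _ _ _ _ setT (1 : R)) (fun=> ler01)
   (integral_cst_prob mu0 1%E) eta0.
pose k := maxn K1 K2.
have /finite_seqP[s0 s0E] := fin (- k%:R) k%:R.
pose s1 := undup s0.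
have us1 : uniq s1 by exact: undup_uniq.
have s1E : [set` s1] = atoms mu0 `&` `[- k%:R, k%:R].
  by rewrite s0E; apply/seteqP; split => x /=; rewrite mem_undup.
have h1 := hK1 k s1 (leq_maxl _ _) us1 s1E.
have := hK2 k s1 (leq_maxr _ _) us1 s1E; under eq_bigr do rewrite mulr1; move=> h2.
have s10 : 0 \in s1.
  have : [set` s1] 0 by rewrite s1E; split; [exact: atom0_gt0 q0 L0|rewrite /= in_itv/= oppr_le0 ler0n].
  by [].
have tot1 : \sum_(a <- s1) mass mu0 a <= 1.
  have := @sum_mass_le mu0 s1 (cst 1) 1 us1 (measurable_cst _) (fun=> ler01).
  have h : (\int[mu0]_x (cst 1 x : R)%:E <= 1)%E by rewrite (integral_cst_prob mu0 1%E).
  by move=> /(_ h); under eq_bigr do rewrite mulr1.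
pose m0 := mass mu0 0.
have qm0 : q <= m0 by rewrite -lee_fin -massE; exact: L0.1.
pose A := rem 0 s1.
have perm (f : R -> R) : \sum_(a <- s1) f a = f 0 + \sum_(a <- A) f a.
  by rewrite (perm_big _ (perm_to_rem s10)) big_cons.
have A0 a : a \in A -> a != 0.
  by move=> aA; apply/eqP => a0; move: aA; rewrite a0 mem_rem_uniqF.
pose SA := \sum_(a <- A) mass mu0 a.
have SA0 : 0 <= SA by apply: sumr_ge0 => a _; exact: mass_ge0.
move: h1 h2 tot1; rewrite !perm -/m0 -/SA => h1 h2 tot1.
pose w a := if a == 0 then 1 - (1 - eta) * SA else (1 - eta) * mass mu0 a.
have w0m : m0 <= 1 - (1 - eta) * SA.
  have : 0 <= eta * SA by rewrite mulr_ge0// ltW.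
  lra.
have wA (f : R -> R) : \sum_(a <- 0 :: A) w a * f a =
    (1 - (1 - eta) * SA) * f 0 + (1 - eta) * \sum_(a <- A) mass mu0 a * f a.
  rewrite big_cons /w eqxx; congr (_ + _); rewrite [RHS]mulr_sumr big_seq [RHS]big_seq.
  by apply: eq_bigr => a /A0/negbTE ->; rewrite mulrA.
exists (0 :: A), w, (1 + 2 * eta / q); split; split.
- move=> a; rewrite /w; case: ifP => _; first by lra.
  by rewrite mulr_ge0 ?mass_ge0//; lra.
- have := wA (fun=> 1); under eq_bigr do rewrite mulr1.
  by move=> ->; under eq_bigr do rewrite mulr1; rewrite -/SA; ring.
- apply/andP; split; first by apply: addr_ge0 => //; apply: divr_ge0; lra.
  have : 2 * eta / q <= (z - 1) / 2 by rewrite ler_pdivrMr//; lra.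
  lra.
- move=> y; rewrite wA subr0.
  have f0 := phi_ge0 y.
  have hp : m0 * phi y + \sum_(a <- A) mass mu0 a * phi (y - a) <= pY mu0 y.
    have := @sum_mass_le mu0 s1 (fun x => phi (y - x)) (pY mu0 y) us1.
    rewrite perm subr0; apply; [by meas|by move=> x; exact: phi_ge0|by rewrite pYE].
  have B0 : 0 <= \sum_(a <- A) mass mu0 a * phi (y - a).
    by apply: sumr_ge0 => a _; apply: mulr_ge0; [exact: mass_ge0|exact: phi_ge0].
  have e1 : eta * SA <= eta by rewrite ler_piMr//; lra.
  have fp : phi y <= pY mu0 y / q.
    rewrite ler_pdivlMr// mulrC; apply: le_trans hp.
    have : q * phi y <= m0 * phi y by rewrite ler_wpM2r.
    lra.
  apply: (@le_trans _ _ (2 * eta * phi y + pY mu0 y)).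
    have h3 : (1 - (1 - eta) * SA) * phi y <= (m0 + 2 * eta) * phi y by rewrite ler_wpM2r//; lra.
    have h4 : 0 <= eta * \sum_(a <- A) mass mu0 a * phi (y - a) by rewrite mulr_ge0// ltW.
    move: h3 hp h4; move: (phi y) (\sum_(_ <- _) _) (pY mu0 y) => u v p; lra.
  have h5 : 2 * eta * phi y <= 2 * eta * (pY mu0 y / q) by rewrite ler_wpM2l//; lra.
  move: h5; move: (phi y) (pY mu0 y) => u p h5.
  have -> : (1 + 2 * eta / q) * p = p + 2 * eta * (p / q) by field; rewrite gt_eqF.
  lra.
- rewrite wA.
  have h3 : m0 * D mu0 0 <= (1 - (1 - eta) * SA) * D mu0 0 by rewrite ler_wpM2r.
  have B0 : 0 <= \sum_(a <- A) mass mu0 a * D mu0 a.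
    by apply: sumr_ge0 => a _; rewrite mulr_ge0 ?mass_ge0.
  have Bi : m0 * D mu0 0 + \sum_(a <- A) mass mu0 a * D mu0 a <= I.
    by rewrite -(perm (fun a => mass mu0 a * D mu0 a)); apply: sum_mass_le => //; rewrite iD.
  have m00 : 0 <= m0 * D mu0 0 by rewrite mulr_ge0//; lra.
  move: h1 h3 B0 Bi m00; move: (\sum_(_ <- _) _) (m0 * _) ((_ - _ * SA) * _) => u v t h1 h3 B0 Bi m00.
  have : eta * u <= eta * I by rewrite ler_pM2l//; lra.
  lra.
- rewrite wA expr0n/= mulr0 add0r.
  have h3 : \sum_(a <- A) mass mu0 a * a ^+ 2 <= g.
    have := @sum_mass_le mu0 s1 (fun x => x ^+ 2) g us1.
    by rewrite perm expr0n/= mulr0 add0r; apply; [by meas|move=> x; exact: sqr_ge0|exact: L0.2].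
  have h4 : (1 - eta) * \sum_(a <- A) mass mu0 a * a ^+ 2 <= (1 - eta) * g by rewrite ler_wpM2l//; lra.
  apply: le_lt_trans h4 _.
  have : 0 < eta * g by rewrite mulr_gt0.
  lra.
- rewrite wA eqxx/= mulr0 add0r.
  have -> : \sum_(a <- A) mass mu0 a * (a != 0)%:R = SA.
    by rewrite /SA big_seq [RHS]big_seq; apply: eq_bigr => a /A0 ->; rewrite mulr1.
  have h3 : (1 - eta) * SA <= (1 - eta) * (1 - q) by rewrite ler_wpM2l//; lra.
  apply: le_lt_trans h3 _.
  have : 0 < eta * (1 - q) by rewrite mulr_gt0//; lra.
  lra.
Qed.

End quantization.

(** * Exponential moments of one letter *)

Section chernoff.
Variable R : realType.
Notation leb := (@lebesgue_measure R).

(** The exponent [|u y| / 16] is at most [A / 16 + y ^+ 2 / 8], and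
    [a * y <= y ^+ 2 / 8 + 2 * a ^+ 2]; a Gaussian of exponent [- y ^+ 2 / 4] remains. *)
Lemma integrable_phi_exp (a A : R) (u : R -> R) : measurable_fun setT u ->
  (forall y, `|u y| <= A + 2 * y ^+ 2) ->
  leb.-integrable setT (EFin \o (fun y => phi (y - a) * expR (`|u y| / 16))).
Proof.
move=> mu uA.
pose c := phi 0 * expR (A / 16 + 2 * a ^+ 2).
apply: (@integrable_dom _ _ _ leb _ (fun y => c * expR (- y ^+ 2 / 4))).
- by meas.
- exact: integrable_scale (integrable_exp_quarter R).
- move=> y; rewrite ger0_norm; last by apply: mulr_ge0; rewrite ?phi_ge0 ?expR_ge0.
  rewrite phiE /c -!mulrA ler_wpM2l ?phi_ge0// -!expRD ler_expR.
  have := uA y; have := sqr_ge0 (y - 4 * a).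
  have -> : - (y - a) ^+ 2 / 2 = - y ^+ 2 / 2 + a * y - a ^+ 2 / 2 by field.
  have -> : (y - 4 * a) ^+ 2 = y ^+ 2 - 8 * (a * y) + 16 * a ^+ 2 by ring.
  have := sqr_ge0 a; move: (`|u y|) (a * y) (y ^+ 2) (a ^+ 2) => *; lra.
Qed.

Lemma integrable_phi_mul (a A : R) (u : R -> R) : measurable_fun setT u ->
  (forall y, `|u y| <= A + 2 * y ^+ 2) ->
  leb.-integrable setT (EFin \o (fun y => phi (y - a) * u y)).
Proof.
move=> mu uA; have ig := integrable_phi_exp a mu uA.
apply: (@integrable_dom _ _ _ leb _ (fun y => 16 * (phi (y - a) * expR (`|u y| / 16)))).
- by meas.
- exact: integrable_scale ig.
- move=> y; rewrite normrM (ger0_norm (phi_ge0 _)) mulrCA ler_wpM2l ?phi_ge0//.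
  have := expR_ge1Dx (`|u y| / 16); lra.
Qed.

(* Integrates exp v <= 1 + v + v^2 exp |v| at v = th * u y. *)
Lemma chernoff_letter (a A : R) (u : R -> R) : measurable_fun setT u ->
  (forall y, `|u y| <= A + 2 * y ^+ 2) -> exists2 B : R, 0 <= B &
  forall th, 0 <= th <= 1 / 32 ->
  (\int[leb]_y (phi (y - a) * expR (th * u y))%:E <=
    (1 + th * (\int[leb]_y (phi (y - a) * u y))%R + th ^+ 2 * B)%:E)%E.
Proof.
move=> mu uA; have ig := integrable_phi_exp a mu uA.
pose G y := phi (y - a) * expR (`|u y| / 16).
(* The rate 1/16 is split in two: one 1/32 dominates [u ^+ 2], the other allows [th] up to 1/32. *)
have [c [c0 usq]] : exists c : R, 0 <= c /\ forall y, u y ^+ 2 <= c * expR (`|u y| / 32).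
  exists (2 * 32 ^+ 2); split; first by apply: mulr_ge0; [exact: ler0n|exact: sqr_ge0].
  move=> y; have := @expr_le_expR R 2 (`|u y| / 32) _; rewrite divr_ge0// => /(_ isT).
  rewrite expr_div_n real_normK ?num_real// ler_pdivrMr ?exprn_gt0// => h.
  by apply: le_trans h _; rewrite (_ : 2`! = 2%N)// mulrAC.
pose B := (c * \int[leb]_y G y)%R.
have iphi := integrable_phi a.
have iu := integrable_phi_mul a mu uA.
exists B.
  by rewrite mulr_ge0//; apply: Rintegral_ge0 => y _; apply: mulr_ge0; rewrite ?phi_ge0 ?expR_ge0.
move=> th /andP[th0 th1].
have pt y : phi (y - a) * expR (th * u y) <=
    phi (y - a) + th * (phi (y - a) * u y) + th ^+ 2 * (c * G y).
  have f0 := phi_ge0 (y - a).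
  have h : expR (th * u y) <= 1 + th * u y + th ^+ 2 * (c * expR (`|u y| / 16)).
    have := le_trans (ler_norm _) (expsum_remainder 2 (th * u y)).
    rewrite /expsum !big_nat_recr//= big_nil expr0 expr1 !divr1 add0r.
    have : `|th * u y| ^+ 2 * expR `|th * u y| <= th ^+ 2 * (c * expR (`|u y| / 16)).
      rewrite real_normK ?num_real// exprMn -mulrA ler_wpM2l ?sqr_ge0//.
      have -> : `|u y| / 16 = `|u y| / 32 + `|u y| / 32 by field.
      rewrite expRD mulrA; apply: ler_pM; rewrite ?sqr_ge0 ?expR_ge0//.
      rewrite ler_expR normrM (ger0_norm th0) mulrC ler_wpM2l//; lra.
    by move=> h1 h2; rewrite -lerBlDl; exact: le_trans h2 h1.
  have := ler_wpM2l f0 h; rewrite /G.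
  move: (phi (y - a)) (expR (`|u y| / 16)) (u y) (expR (th * u y)) => *; lra.
have ige : leb.-integrable setT (EFin \o (fun y => phi (y - a) * expR (th * u y))).
  apply: (@integrable_dom _ _ _ leb _ G) => //; first by meas.
  move=> y; rewrite ger0_norm; last by apply: mulr_ge0; rewrite ?phi_ge0 ?expR_ge0.
  rewrite ler_wpM2l ?phi_ge0// ler_expR.
  apply: le_trans (ler_norm _) _; rewrite normrM (ger0_norm th0) mulrC ler_wpM2l//; lra.
have -> : (\int[leb]_y (phi (y - a) * expR (th * u y))%:E =
   (\int[leb]_y (phi (y - a) * expR (th * u y)))%R%:E)%E.
  by rewrite /Rintegral fineK//; exact: integrable_fin_num ige.
rewrite lee_fin.
have i2 := integrable_scale th iu; have i3 := integrable_scale c ig.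
have i4 := integrable_scale (th ^+ 2) i3.
have i12 : leb.-integrable setT (EFin \o (fun y => phi (y - a) + th * (phi (y - a) * u y))).
  by apply: eq_integrable (integrableD measurableT iphi i2) => // y _ /=; rewrite -EFinD.
have i124 : leb.-integrable setT (EFin \o
    (fun y => phi (y - a) + th * (phi (y - a) * u y) + th ^+ 2 * (c * G y))).
  by apply: eq_integrable (integrableD measurableT i12 i4) => // y _ /=; rewrite -EFinD.
apply: le_trans (le_Rintegral measurableT ige i124 (fun y _ => pt y)) _.
have e1 := Rintegral_scale th iu; have e2 := Rintegral_scale c ig.
have e3 := Rintegral_scale (th ^+ 2) i3.
by rewrite RintegralD// RintegralD// Rintegral_phi e1 e3 e2.
Qed.

Lemma chernoff_exponent (s : seq R) (w : R -> R) (u : R -> R -> R) (A : R -> R) :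
  (forall a, measurable_fun setT (u a)) -> (forall a y, `|u a y| <= A a + 2 * y ^+ 2) ->
  (forall a, 0 <= w a) -> \sum_(a <- s) w a = 1 ->
  \sum_(a <- s) w a * (\int[leb]_y (phi (y - a) * u a y))%R < 0 ->
  exists (th : R) (rho : R) (h : R -> R), [/\ 0 < th, 0 <= rho < 1,
    forall a, (\int[leb]_y (phi (y - a) * expR (th * u a y))%:E = (h a)%:E)%E,
    forall a, 0 <= h a & \sum_(a <- s) w a * h a <= rho].
Proof.
move=> mu uA w0 w1 neg.
pose m a := (\int[leb]_y (phi (y - a) * u a y))%R.
have /choice[B hB] : forall a, exists b : R, 0 <= b /\ forall th : R, 0 <= th <= 1 / 32 ->
  (\int[leb]_y (phi (y - a) * expR (th * u a y))%:E <= (1 + th * m a + th ^+ 2 * b)%:E)%E.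
  by move=> a; have [b b0 hb] := chernoff_letter a (mu a) (uA a); exists b.
pose SB := \sum_(a <- s) w a * B a.
have SB0 : 0 <= SB by apply: sumr_ge0 => a _; rewrite mulr_ge0// (hB a).1.
pose M := - \sum_(a <- s) w a * m a.
have M0 : 0 < M by rewrite oppr_gt0.
(* The second bound makes the quadratic term at most half of the linear gain [th * M], so that
   [1 - th * M / 2] can serve as [rho]. *)
pose th := Num.min (1 / 32) (M / (2 * (SB + 1))).
have t2 : 0 < 2 * (SB + 1) by lra.
have th0 : 0 < th by rewrite lt_min divr_gt0//= divr_gt0.
have th1 : th <= 1 / 32 by rewrite ge_min lexx.
have th2 : th * (2 * (SB + 1)) <= M.
  by rewrite -ler_pdivlMr// ge_min lexx orbT.
pose h a := fine (\int[leb]_y (phi (y - a) * expR (th * u a y))%:E)%E.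
have i0 a : (0 <= \int[leb]_y (phi (y - a) * expR (th * u a y))%:E)%E.
  by apply: integral_ge0 => y _; rewrite lee_fin; apply: mulr_ge0; rewrite ?phi_ge0 ?expR_ge0.
have th01 : 0 <= th <= 1 / 32 by rewrite th1 ltW.
have hE a : (\int[leb]_y (phi (y - a) * expR (th * u a y))%:E = (h a)%:E)%E.
  rewrite /h fineK// ge0_fin_numE//; apply: le_lt_trans ((hB a).2 th th01) _.
  by rewrite ltry.
have hle a : h a <= 1 + th * m a + th ^+ 2 * B a by rewrite -lee_fin -hE (hB a).2.
have h0 a : 0 <= h a by rewrite -lee_fin -hE.
have sle : \sum_(a <- s) w a * h a <= 1 - th * M / 2.
  apply: (@le_trans _ _ (\sum_(a <- s) (w a + th * (w a * m a) + th ^+ 2 * (w a * B a)))).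
    apply: ler_sum => a _; have := ler_wpM2l (w0 a) (hle a).
    move: (w a) (m a) (B a) (h a) => *; lra.
  rewrite !big_split/= w1 -!mulr_sumr -/SB.
  have -> : \sum_(a <- s) w a * m a = - M by rewrite opprK.
  have h1 : th * (th * (2 * (SB + 1))) <= th * M by rewrite ler_pM2l.
  have h2 : 0 <= th * th by rewrite mulr_ge0 ?ltW.
  by rewrite expr2; lra.
exists th, (1 - th * M / 2), h; split => //.
have : 0 < th * M by rewrite mulr_gt0.
have : 0 <= \sum_(a <- s) w a * h a by apply: sumr_ge0 => a _; rewrite mulr_ge0.
by move=> h1 h2; apply/andP; split; lra.
Qed.

End chernoff.

(** * Averages over random codewords *)

Section input_average.
Variable R : realType.
Notation leb := (@lebesgue_measure R).
Variables (s : seq R) (w : R -> R).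
Hypothesis w0 : forall a, 0 <= w a.

(** Expectation over codewords with independent letters of law [w] on [s]; the alphabet is finite,
    so nested sums replace a product measure. *)
Fixpoint wavg (n : nat) : (n.-tuple R -> \bar R) -> \bar R :=
  match n return (n.-tuple R -> \bar R) -> \bar R with
  | 0 => fun H => H [tuple]
  | n'.+1 => fun H => (\sum_(a <- s) (w a)%:E * wavg (fun x => H [tuple of a :: x]))%E
  end.

Lemma wavg_ge0 n (H : n.-tuple R -> \bar R) : (forall x, 0 <= H x)%E -> (0 <= wavg H)%E.
Proof.
elim: n H => [|n IH] H H0 //=.
by apply: sume_ge0 => a _; rewrite mule_ge0 ?lee_fin// IH.
Qed.

Lemma le_wavg n (H G : n.-tuple R -> \bar R) : (forall x, H x <= G x)%E -> (wavg H <= wavg G)%E.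
Proof.
elim: n H G => [|n IH] H G HG //=.
by apply: lee_sum => a _; rewrite lee_wpmul2l ?lee_fin// IH.
Qed.

Lemma eq_wavg n (H G : n.-tuple R -> \bar R) : (forall x, H x = G x) -> wavg H = wavg G.
Proof. by move=> h; congr wavg; apply/funext. Qed.

Lemma wavgD n (H G : n.-tuple R -> \bar R) : (forall x, 0 <= H x)%E -> (forall x, 0 <= G x)%E ->
  (wavg (fun x => H x + G x) = wavg H + wavg G)%E.
Proof.
elim: n H G => [|n IH] H G H0 G0 //=.
rewrite -big_split/=; apply: eq_bigr => a _.
by rewrite IH// ge0_muleDr//; apply: wavg_ge0.
Qed.

Lemma wavgZl n (c : R) (H : n.-tuple R -> \bar R) : 0 <= c -> (forall x, 0 <= H x)%E ->
  (wavg (fun x => c%:E * H x) = c%:E * wavg H)%E.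
Proof.
move=> c0; elim: n H => [|n IH] H H0 //=.
rewrite ge0_sume_distrr//; last by move=> a _; rewrite mule_ge0 ?lee_fin// wavg_ge0.
by apply: eq_bigr => a _; rewrite IH// muleCA.
Qed.

Lemma wavg_prod n (h : R -> R) : (forall a, 0 <= h a) ->
  wavg (fun x : n.-tuple R => (\prod_(a <- x) h a)%:E) = ((\sum_(a <- s) w a * h a) ^+ n)%:E.
Proof.
move=> h0; elim: n => [|n IH] /=; first by rewrite big_nil.
transitivity (\sum_(a <- s) (w a * h a * (\sum_(a <- s) w a * h a) ^+ n)%:E)%E.
  apply: eq_bigr => a _.
  rewrite (eq_wavg (G := fun x => ((h a)%:E * (\prod_(a <- x) h a)%:E)%E)); last first.
    by move=> x; rewrite big_cons EFinM.
  rewrite wavgZl//; last by move=> x; rewrite lee_fin prodr_ge0.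
  by rewrite IH -!EFinM mulrA.
by rewrite sumEFin -mulr_suml -exprS.
Qed.

Lemma wavg_cst n (c : R) : \sum_(a <- s) w a = 1 -> 0 <= c -> wavg (fun _ : n.-tuple R => c%:E) = c%:E.
Proof.
move=> w1 c0; elim: n => [|n IH] //=.
transitivity (\sum_(a <- s) (w a * c)%:E)%E; first by apply: eq_bigr => a _; rewrite IH EFinM.
by rewrite sumEFin -mulr_suml w1 mul1r.
Qed.

Lemma measurable_wavg n (H : n.-tuple R -> R -> \bar R) :
  (forall x, measurable_fun setT (H x)) -> measurable_fun setT (fun t => wavg (fun x => H x t)).
Proof.
elim: n H => [|n IH] H mH /=; first exact: mH.
apply: emeasurable_sum => a; apply: emeasurable_funM; first exact: measurable_cst.
exact: (IH (fun x t => H [tuple of a :: x] t)).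
Qed.

Lemma wavg_integral n (H : n.-tuple R -> R -> \bar R) :
  (forall x, measurable_fun setT (H x)) -> (forall x t, 0 <= H x t)%E ->
  wavg (fun x => \int[leb]_t H x t)%E = (\int[leb]_t wavg (fun x => H x t))%E.
Proof.
elim: n H => [|n IH] H mH H0 //=.
rewrite ge0_integral_sum//.
- apply: eq_bigr => a _.
  rewrite (IH (fun x t => H [tuple of a :: x] t))// ge0_integralZl//; last 2 first.
  + by move=> t _; apply: wavg_ge0.
  + by rewrite lee_fin.
  exact: (measurable_wavg (H := fun x t => H [tuple of a :: x] t)).
- move=> a; apply: emeasurable_funM; first exact: measurable_cst.
  exact: (measurable_wavg (H := fun x t => H [tuple of a :: x] t)).
- by move=> a t _; rewrite mule_ge0 ?lee_fin// wavg_ge0.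
Qed.

Lemma behead_cons n (a : R) (x : n.-tuple R) : behead_tuple [tuple of a :: x] = x.
Proof. exact: val_inj. Qed.

(** The letterwise domination of output densities tensorizes: averaged over random codewords, a set
    that is rare under the reference output law is hit rarely, up to [kap ^+ n]. *)
Lemma wavg_output (mu : probability R R) (kap : R) n (F : n.-tuple R -> \bar R) x0 : 0 <= kap ->
  (forall y, \sum_(a <- s) w a * phi (y - a) <= kap * pY mu y) -> nnm F ->
  (wavg (iint (@kphi R) F) <= (kap ^+ n)%:E * iint (kout mu) F x0)%E.
Proof.
move=> kap0 hk; elim: n F x0 => [|n IH] F x0 nF.
  by rewrite /= expr0 mul1e.
pose W (t : R) := wavg (fun x => iint (@kphi R) (fun y : n.-tuple R => F [tuple of t :: y]) x).
have mi x : measurable_fun setT (fun t : R => iint (@kphi R) (fun y : n.-tuple R => F [tuple of t :: y]) x).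
  exact: (measurable_iint_cons (@kphi_kernel R)).
have ig0 x t : (0 <= iint (@kphi R) (fun y : n.-tuple R => F [tuple of t :: y]) x)%E.
  by apply: (iint_ge0 (@kphi_kernel R)) => y; exact: nF.2.
have mW : measurable_fun setT W by apply: measurable_wavg.
have W0 t : (0 <= W t)%E by exact: wavg_ge0.
have mp a : measurable_fun setT (fun t : R => (phi (t - a))%:E) by meas.
have -> : wavg (iint (@kphi R) F) = (\int[leb]_t \sum_(a <- s) (w a)%:E * ((phi (t - a))%:E * W t))%E.
  rewrite ge0_integral_sum//.
  - rewrite [LHS]/=; apply: eq_bigr => a _.
    transitivity ((w a)%:E * wavg (fun x => \int[leb]_t ((phi (t - a))%:E *
        iint (@kphi R) (fun y : n.-tuple R => F [tuple of t :: y]) x)))%E.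
      by congr (_ * _)%E; apply: eq_wavg => x; rewrite /= behead_cons.
    rewrite wavg_integral; last 2 first.
    + by move=> x; apply: emeasurable_funM.
    + by move=> x t; rewrite mule_ge0 ?lee_fin ?phi_ge0.
    rewrite ge0_integralZl//.
    + congr (_ * _)%E; apply: eq_integral => t _.
      by rewrite wavgZl ?phi_ge0.
    + exact: (emeasurable_funM (mp a) mW).
    + by move=> t _; rewrite mule_ge0 ?lee_fin ?phi_ge0.
    + by rewrite lee_fin.
  - move=> a; apply: emeasurable_funM; first exact: measurable_cst.
    exact: (emeasurable_funM (mp a) mW).
  - by move=> a t _; rewrite !mule_ge0 ?lee_fin ?phi_ge0.
have mo : measurable_fun setT (fun t : R => (kout mu (thead x0) t)%:E *
    iint (kout mu) (fun y : n.-tuple R => F [tuple of t :: y]) (behead_tuple x0))%E.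
  exact: (measurable_iint_step (kout_kernel mu)).
have o0 (t : R) : (0 <= (kout mu (thead x0) t)%:E *
    iint (kout mu) (fun y : n.-tuple R => F [tuple of t :: y]) (behead_tuple x0))%E.
  rewrite mule_ge0 ?lee_fin ?pY_ge0//.
  by apply: (iint_ge0 (kout_kernel mu)) => y; exact: nF.2.
rewrite [X in (_ <= _ * X)%E]/= -ge0_integralZl//; last by rewrite lee_fin exprn_ge0.
apply: ge0_le_integral => //.
- by move=> t _; apply: sume_ge0 => a _; rewrite !mule_ge0 ?lee_fin ?phi_ge0.
- apply: emeasurable_sum => a; apply: emeasurable_funM; first exact: measurable_cst.
  exact: (emeasurable_funM (mp a) mW).
- by apply: emeasurable_funM => //; exact: measurable_cst.
- move=> t _.
  apply: (@le_trans _ _ ((kap * pY mu t)%:E * W t)%E).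
    have -> : (\sum_(a <- s) (w a)%:E * ((phi (t - a))%:E * W t) =
        (\sum_(a <- s) w a * phi (t - a))%:E * W t)%E.
      rewrite -sumEFin ge0_sume_distrl; last first.
        by move=> a _; rewrite lee_fin; apply: mulr_ge0 => //; exact: phi_ge0.
      by apply: eq_bigr => a _; rewrite muleA -EFinM.
    by apply: lee_wpmul2r => //; rewrite lee_fin.
  apply: (@le_trans _ _ ((kap * pY mu t)%:E * ((kap ^+ n)%:E *
      iint (kout mu) (fun y : n.-tuple R => F [tuple of t :: y]) (behead_tuple x0)))%E).
    apply: lee_wpmul2l; first by rewrite lee_fin; apply: mulr_ge0 => //; exact: pY_ge0.
    by apply: IH; exact: nnm_cons.
  by rewrite muleA -EFinM [X in (_ <= X)%E]muleA -EFinM exprS /kout -mulrA mulrCA [_ * pY mu t]mulrC mulrCA.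
Qed.

End input_average.

(** * Letter sums, information density and Chernoff bounds *)

Section letter_sums.
Variable R : realType.
Notation leb := (@lebesgue_measure R).
Implicit Types (u v : R -> R -> R).

Definition tsum u n (x y : n.-tuple R) : R := \sum_(z <- zip x y) u z.1 z.2.

Lemma tsum_cons u n (x : n.+1.-tuple R) t (y : n.-tuple R) :
  tsum u x [tuple of t :: y] = u (thead x) t + tsum u (behead_tuple x) y.
Proof. by rewrite /tsum {1}(tuple_eta x) /= big_cons. Qed.

Lemma tsum0 u (x y : 0.-tuple R) : tsum u x y = 0.
Proof. by rewrite /tsum [x]tuple0 [y]tuple0 big_nil. Qed.

Lemma measurable_tsum u n (x : n.-tuple R) : (forall a, measurable_fun setT (u a)) ->
  measurable_fun setT (tsum u x).
Proof.
move=> mu; elim: n x => [|n IH] x.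
  by rewrite (_ : tsum u x = cst 0)//; apply/funext => y; exact: tsum0.
rewrite (_ : tsum u x = fun y => u (thead x) (thead y) + tsum u (behead_tuple x) [tuple of behead y]).
  apply: measurable_funD.
    by apply: (measurableT_comp (mu _)); exact: measurable_tnth.
  by apply: (measurableT_comp (IH _)); exact: measurable_behead.
by apply/funext => y; rewrite {1}(tuple_eta y) tsum_cons.
Qed.

Lemma tsumZ u n (x y : n.-tuple R) (c : R) : tsum (fun a t => c * u a t) x y = c * tsum u x y.
Proof. by rewrite /tsum mulr_sumr. Qed.

Lemma tsumDc u n (x y : n.-tuple R) (c : R) :
  tsum (fun a t => c + u a t) x y = n%:R * c + tsum u x y.
Proof.
elim: n x y => [|n IH] x y; first by rewrite !tsum0 mul0r addr0.
by rewrite [y]tuple_eta !tsum_cons IH -natr1; ring.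
Qed.

Lemma tsum_fst (f : R -> R) n (x y : n.-tuple R) : tsum (fun a _ => f a) x y = \sum_(a <- x) f a.
Proof.
elim: n x y => [|n IH] x y; first by rewrite tsum0 [x]tuple0 big_nil.
by rewrite [y]tuple_eta tsum_cons IH [in RHS](tuple_eta x) /= big_cons.
Qed.

Lemma nnm_exp_tsum u n (x : n.-tuple R) : (forall a, measurable_fun setT (u a)) ->
  nnm (fun y => (expR (tsum u x y))%:E).
Proof.
move=> mu; split; last by move=> y; rewrite lee_fin expR_ge0.
by apply/measurable_EFinP; apply: (measurableT_comp (@measurable_expR _)); exact: measurable_tsum.
Qed.

Lemma iint_exp_tsum u (h : R -> R) n (x : n.-tuple R) : (forall a, measurable_fun setT (u a)) ->
  (forall a, (\int[leb]_t (phi (t - a) * expR (u a t))%:E = (h a)%:E)%E) -> (forall a, 0 <= h a) ->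
  iint (@kphi R) (fun y => (expR (tsum u x y))%:E) x = (\prod_(a <- x) h a)%:E.
Proof.
move=> mu hE h0; elim: n x => [|n IH] x.
  by rewrite /= tsum0 expR0 [x]tuple0 big_nil.
have mx := mu (thead x).
transitivity (\int[leb]_t ((\prod_(a <- behead_tuple x) h a)%:E * (phi (t - thead x) * expR (u (thead x) t))%:E))%E.
  rewrite [LHS]/=; apply: eq_integral => t _.
  rewrite (eq_iint _ (G := fun y => ((expR (u (thead x) t))%:E * (expR (tsum u (behead_tuple x) y))%:E)%E)); last first.
    by move=> y; rewrite tsum_cons expRD EFinM.
  rewrite (iintZl (@kphi_kernel R) _ (expR_ge0 _) (nnm_exp_tsum _ mu)).
  by rewrite IH muleA -EFinM muleC.
rewrite ge0_integralZl//.
- by rewrite hE -EFinM [in RHS](tuple_eta x) /= big_cons mulrC.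
- by meas.
- by move=> t _; rewrite lee_fin; apply: mulr_ge0; rewrite ?phi_ge0 ?expR_ge0.
- by rewrite lee_fin; apply: prodr_ge0.
Qed.

(** Minus the information density. With this sign its exponential is the density of the reference
    law relative to the channel, and low information density reads [0 <= tsum] after a shift. *)
Definition llr (mu : probability R R) (a t : R) : R := ln (pY mu t) - ln (phi (t - a)).

Lemma measurable_llr mu a : measurable_fun setT (llr mu a).
Proof. by have mp := measurable_pY mu; rewrite /llr; meas. Qed.

Lemma exp_llr mu a t : phi (t - a) * expR (llr mu a t) = pY mu t.
Proof.
rewrite /llr expRB !lnK ?posrE ?pY_gt0 ?phi_gt0// mulrC divfK//.
by rewrite gt_eqF// phi_gt0.
Qed.

Lemma change_of_measure mu n (F : n.-tuple R -> \bar R) x : nnm F ->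
  iint (kout mu) F x = iint (@kphi R) (fun y => (expR (tsum (llr mu) x y))%:E * F y)%E x.
Proof.
elim: n F x => [|n IH] F x nF; first by rewrite /= tsum0 expR0 mul1e.
rewrite /=; apply: eq_integral => t _.
have nFt := nnm_cons t nF.
rewrite [X in _ = (_ * X)%E](eq_iint _ (G := fun y => ((expR (llr mu (thead x) t))%:E *
    ((expR (tsum (llr mu) (behead_tuple x) y))%:E * F [tuple of t :: y]))%E)); last first.
  by move=> y; rewrite tsum_cons expRD EFinM muleA.
have nE := nnm_exp_tsum (behead_tuple x) (measurable_llr mu).
rewrite (iintZl (@kphi_kernel R) _ (expR_ge0 _)).
  by rewrite -IH// muleA -EFinM exp_llr.
split; first by apply: emeasurable_funM; [exact: nE.1|exact: nFt.1].
by move=> y; rewrite mule_ge0 ?lee_fin ?expR_ge0//; exact: nFt.2.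
Qed.

Lemma nnm_mem n (A : set (n.-tuple R)) : measurable A -> nnm (fun y => ((y \in A)%:R : R)%:E).
Proof.
move=> mA; apply: nnm_indicator; rewrite (_ : [set y | y \in A] = A)//.
by apply/seteqP; split => y /=; rewrite inE.
Qed.

Lemma measurable_tsum_ge0 u n (x : n.-tuple R) : (forall a, measurable_fun setT (u a)) ->
  measurable [set y | 0 <= tsum u x y].
Proof.
move=> mu; rewrite (_ : [set y | _] = tsum u x @^-1` `[0, +oo[); last first.
  by apply/seteqP; split => y /=; rewrite in_itv/= andbT.
by rewrite -[X in measurable X]setTI; exact: measurable_tsum.
Qed.

Lemma nnm_tsum_ge0 u n (x : n.-tuple R) : (forall a, measurable_fun setT (u a)) ->
  nnm (fun y => ((0 <= tsum u x y)%R%:R : R)%:E).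
Proof. by move=> mu; apply: nnm_indicator; exact: measurable_tsum_ge0. Qed.

(** Markov's inequality for the exponential of the letter sum, averaged over codewords and noise
    together; by independence the bound is a power of the one-letter average. *)
Lemma chernoff_tail (s : seq R) (w : R -> R) u (A : R -> R) :
  (forall a, measurable_fun setT (u a)) -> (forall a y, `|u a y| <= A a + 2 * y ^+ 2) ->
  (forall a, 0 <= w a) -> \sum_(a <- s) w a = 1 ->
  \sum_(a <- s) w a * (\int[leb]_y (phi (y - a) * u a y))%R < 0 ->
  exists2 rho : R, 0 <= rho < 1 & forall n,
   (wavg s w (fun x : n.-tuple R => iint (@kphi R) (fun y => ((0 <= tsum u x y)%R%:R : R)%:E) x) <= (rho ^+ n)%:E)%E.
Proof.
move=> mu uA w0 w1 neg.
have [th [rho [h [th0 rho01 hE h0 hrho]]]] := chernoff_exponent mu uA w0 w1 neg.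
exists rho => // n.
have mthu a : measurable_fun setT (fun t => th * u a t) by have m := mu a; meas.
have s0 : 0 <= \sum_(a <- s) w a * h a by apply: sumr_ge0 => a _; rewrite mulr_ge0.
apply: (@le_trans _ _ ((\sum_(a <- s) w a * h a) ^+ n)%:E); last first.
  by rewrite lee_fin lerXn2r// nnegrE; have /andP[] := rho01.
rewrite -(wavg_prod s w0 n h0); apply: le_wavg => // x.
rewrite -(iint_exp_tsum (u := fun a t => th * u a t) x mthu hE h0).
apply: (le_iint (@kphi_kernel R)); [exact: nnm_tsum_ge0|exact: nnm_exp_tsum|].
move=> y; rewrite lee_fin tsumZ; have [hy|_] := boolP (0 <= tsum u x y); last exact: expR_ge0.
by rewrite -[leLHS]expR0 ler_expR mulr_ge0// ltW.
Qed.

End letter_sums.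

(** * Feinstein's greedy construction *)

Section feinstein.
Variable R : realType.
Notation leb := (@lebesgue_measure R).
Variables (mu : probability R R) (s : seq R) (w : R -> R) (kap : R).
Hypotheses (w0 : forall a, 0 <= w a) (w1 : \sum_(a <- s) w a = 1) (kap0 : 0 <= kap).
Hypothesis hk : forall y, \sum_(a <- s) w a * phi (y - a) <= kap * pY mu y.
Variables (r' : R) (f2 f3 : R -> R) (rho1 rho2 rho3 : R).
Let u1 a t := r' + llr mu a t.
Let tail (u : R -> R -> R) (rho : R) := forall n,
  (wavg s w (fun x : n.-tuple R => iint (@kphi R) (fun y => ((0 <= tsum u x y)%R%:R : R)%:E) x)
    <= (rho ^+ n)%:E)%E.
Hypotheses (t1 : tail u1 rho1) (t2 : tail (fun a _ => f2 a) rho2) (t3 : tail (fun a _ => f3 a) rho3).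

Let Kphi := @kphi_kernel R.

Lemma measurable_u1 a : measurable_fun setT (u1 a).
Proof. by have m := measurable_llr mu a; rewrite /u1; meas. Qed.

(** Outputs whose information density exceeds [r'] per letter. *)
Definition decoding_set n (x : n.-tuple R) : set (n.-tuple R) := [set y | tsum u1 x y < 0].

Lemma measurable_decoding_set n (x : n.-tuple R) : measurable (decoding_set x).
Proof.
rewrite (_ : decoding_set x = ~` [set y | 0 <= tsum u1 x y]).
  by apply: measurableC; apply: measurable_tsum_ge0 => a; exact: measurable_u1.
by apply/seteqP; split => y /=; rewrite /decoding_set /= ltNge => /negP.
Qed.

(** If no input worked, then for every [x] the probabilities of falling in [B], of low information
    density and of violating either constraint would add up to at least [eps]; averaging over random
    codewords contradicts the last hypothesis. *)
Lemma exists_good_input n (B : set (n.-tuple R)) (eps b : R) x0 : measurable B -> 0 < eps <= 1 ->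
  0 <= b -> (iint (kout mu) (fun y => ((y \in B)%:R : R)%:E) x0 <= b%:E)%E ->
  kap ^+ n * b + (rho1 ^+ n + rho2 ^+ n + rho3 ^+ n) < eps ->
  exists x : n.-tuple R, [/\ \sum_(a <- x) f2 a < 0, \sum_(a <- x) f3 a < 0
    & ((1 - eps)%:E <= iint (@kphi R) (fun y => ((y \in decoding_set x `\` B)%:R : R)%:E) x)%E].
Proof.
move=> mB /andP[eps0 eps1] b0 hb small; apply: contrapT => none.
pose T1 (x : n.-tuple R) := iint (@kphi R) (fun y => ((0 <= tsum u1 x y)%R%:R : R)%:E) x.
pose T2 (x : n.-tuple R) := iint (@kphi R) (fun y => ((0 <= tsum (fun a _ => f2 a) x y)%R%:R : R)%:E) x.
pose T3 (x : n.-tuple R) := iint (@kphi R) (fun y => ((0 <= tsum (fun a _ => f3 a) x y)%R%:R : R)%:E) x.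
pose T0 (x : n.-tuple R) := iint (@kphi R) (fun y => ((y \in B)%:R : R)%:E) x.
have n1 x := nnm_tsum_ge0 (n := n) x measurable_u1.
have n0 := nnm_mem mB.
have T00 x : (0 <= T0 x)%E by apply: (iint_ge0 Kphi) => y; rewrite lee_fin ler0n.
have T10 x : (0 <= T1 x)%E by apply: (iint_ge0 Kphi) => y; rewrite lee_fin ler0n.
have T20 x : (0 <= T2 x)%E by apply: (iint_ge0 Kphi) => y; rewrite lee_fin ler0n.
have T30 x : (0 <= T3 x)%E by apply: (iint_ge0 Kphi) => y; rewrite lee_fin ler0n.
(* A violated constraint does not depend on the output, so its tail event has probability 1. *)
have full (f : R -> R) (x : n.-tuple R) : 0 <= \sum_(a <- x) f a ->
    iint (@kphi R) (fun y => ((0 <= tsum (fun a _ => f a) x y)%R%:R : R)%:E) x = 1%E.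
  move=> hf; rewrite -[RHS](iint_cst Kphi x ler01).
  by apply: eq_iint => y; rewrite tsum_fst hf.
have key x : (eps%:E <= T0 x + T1 x + (T2 x + T3 x))%E.
  have [h2|h2] := leP 0 (\sum_(a <- x) f2 a).
    apply: (@le_trans _ _ 1%E); first by rewrite lee_fin.
    rewrite -(full f2 x h2) -/(T2 x); apply: (@le_trans _ _ (T2 x + T3 x)%E); first by rewrite leeDl.
    by rewrite leeDr// adde_ge0.
  have [h3|h3] := leP 0 (\sum_(a <- x) f3 a).
    apply: (@le_trans _ _ 1%E); first by rewrite lee_fin.
    rewrite -(full f3 x h3) -/(T3 x); apply: (@le_trans _ _ (T2 x + T3 x)%E); first by rewrite leeDr.
    by rewrite leeDr// adde_ge0.
  apply: (@le_trans _ _ (T0 x + T1 x)%E); last by rewrite leeDl// adde_ge0.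
  pose G := iint (@kphi R) (fun y => ((y \in decoding_set x `\` B)%:R : R)%:E) x.
  have mG : measurable (decoding_set x `\` B).
    by apply: measurableD => //; exact: measurable_decoding_set.
  have hG : (G < (1 - eps)%:E)%E.
    by rewrite ltNge; apply/negP => hG; apply: none; exists x.
  have nG := nnm_mem mG.
  have one : (1 <= G + (T0 x + T1 x))%E.
    rewrite /T0 /T1 -(iintD Kphi)// /G -(iintD Kphi)//; last first.
      by split; [apply: emeasurable_funD; [exact: n0.1|exact: (n1 x).1]
        |move=> y; rewrite -EFinD lee_fin addr_ge0].
    rewrite -[leLHS](iint_cst Kphi x ler01).
    apply: (le_iint Kphi).
    - by split => // y; rewrite lee_fin.
    - split; last by move=> y; rewrite -!EFinD lee_fin !addr_ge0.
      apply: emeasurable_funD; first exact: nG.1.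
      by apply: emeasurable_funD; [exact: n0.1|exact: (n1 x).1].
    - move=> y; rewrite -!EFinD lee_fin.
      have nn (c : bool) : 0 <= c%:R :> R by [].
      have p1 := nn (y \in decoding_set x `\` B); have p2 := nn (y \in B).
      have p3 := nn (0 <= tsum u1 x y).
      have [yB|yB] := boolP (y \in B); first by move: p1 p3; rewrite [true%:R]/=; lra.
      have [hy|hy] := leP 0 (tsum u1 x y); first by move: p1; rewrite [true%:R]/= [false%:R]/=; lra.
      have -> : (y \in decoding_set x `\` B) = true.
        by apply: mem_set; split => // By; move: yB; rewrite mem_set.
      by rewrite [true%:R]/= [false%:R]/=; lra.
  have G0 : (0 <= G)%E by apply: (iint_ge0 Kphi) => y; rewrite lee_fin ler0n.
  move: one hG G0; case: G => [v| |]//.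
  move: (T0 x + T1 x)%E => [t| |]; rewrite ?leey// -?EFinD ?lee_fin ?lte_fin//; lra.
have avg : (eps%:E <= wavg s w T0 + wavg s w T1 + (wavg s w T2 + wavg s w T3))%E.
  rewrite -!wavgD//; [|by move=> x; exact: adde_ge0|by move=> x; exact: adde_ge0].
  rewrite -(wavg_cst n w1 (ltW eps0)); apply: le_wavg => //.
have b1 : (wavg s w T0 <= (kap ^+ n * b)%:E)%E.
  apply: le_trans (wavg_output w0 x0 kap0 hk n0) _; rewrite EFinM.
  by apply: lee_wpmul2l => //; rewrite lee_fin exprn_ge0.
have := le_trans avg (leeD (leeD b1 (t1 n)) (leeD (t2 n) (t3 n))).
by rewrite -!EFinD lee_fin addrA; lra.
Qed.

(** On the decoding set the density of the reference law relative to the channel is below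
    [exp (- n r')]. *)
Lemma output_decoding_set_le n (x : n.-tuple R) (A : set (n.-tuple R)) x0 : measurable A ->
  A `<=` decoding_set x ->
  (iint (kout mu) (fun y => ((y \in A)%:R : R)%:E) x0 <= (expR (- (n%:R * r')))%:E)%E.
Proof.
move=> mA Ad; have nA := nnm_mem mA.
rewrite (iint_kout_indep _ _ _ x) change_of_measure//.
rewrite -(iint_cst Kphi x (expR_ge0 _)).
have nE := nnm_exp_tsum x (measurable_llr mu).
apply: (le_iint Kphi).
- split; first by apply: emeasurable_funM; [exact: nE.1|exact: nA.1].
  by move=> y; rewrite mule_ge0 ?lee_fin ?expR_ge0.
- by split => // y; rewrite lee_fin expR_ge0.
move=> y; rewrite -EFinM lee_fin; have [yA|_] := boolP (y \in A); last first.
  by rewrite mulr0 expR_ge0.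
rewrite mulr1 ler_expR; move: yA; rewrite inE => /Ad; rewrite /decoding_set /= tsumDc; lra.
Qed.

(** The regions already chosen have total reference probability at most [M exp (- n r')], small
    enough for [exists_good_input]; the new region is a decoding set minus their union, which keeps
    all regions disjoint. *)
Lemma greedy_code n (eps : R) (x0 : n.-tuple R) : 0 < eps <= 1 -> forall M : nat,
  M%:R * (kap ^+ n * expR (- (n%:R * r'))) + (rho1 ^+ n + rho2 ^+ n + rho3 ^+ n) < eps ->
  exists (f : nat -> n.-tuple R) (B : nat -> set (n.-tuple R)),
    (forall j, (j < M)%N -> [/\ measurable (B j), B j `<=` decoding_set (f j),
       \sum_(a <- f j) f2 a < 0, \sum_(a <- f j) f3 a < 0
     & ((1 - eps)%:E <= iint (@kphi R) (fun y => ((y \in B j)%:R : R)%:E) (f j))%E]) /\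
    (forall i j, (i < j < M)%N -> B i `&` B j = set0).
Proof.
move=> eps01; elim=> [|M IH] small; first by exists (fun=> x0), (fun=> set0); split => // i j; rewrite ltn0 andbF.
have e0 : 0 <= kap ^+ n * expR (- (n%:R * r')) by rewrite mulr_ge0 ?exprn_ge0 ?expR_ge0.
have smallM : M%:R * (kap ^+ n * expR (- (n%:R * r'))) + (rho1 ^+ n + rho2 ^+ n + rho3 ^+ n) < eps.
  apply: le_lt_trans small; rewrite lerD2r ler_wpM2r// ler_nat.
  by rewrite leqnSn.
have [f [B [hB dB]]] := IH smallM.
pose U := \bigcup_(j in `I_M) B j.
have mU : measurable U.
  by apply: fin_bigcup_measurable => [|j jM]; [exact: finite_II|have [] := hB j jM].
have hU : (iint (kout mu) (fun y => ((y \in U)%:R : R)%:E) x0 <= (M%:R * expR (- (n%:R * r')))%:E)%E.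
  have nB (j : 'I_M) : nnm (fun y => ((y \in B j)%:R : R)%:E).
    by apply: nnm_mem; have [] := hB j (ltn_ord j).
  apply: (@le_trans _ _ (iint (kout mu) (fun y => \sum_(j : 'I_M) ((y \in B j)%:R : R)%:E) x0)%E).
    apply: (le_iint (kout_kernel mu)); [exact: nnm_mem|exact: nnm_sum|].
    move=> y; rewrite sumEFin lee_fin; have [|_] := boolP (y \in U); last first.
      by apply: sumr_ge0 => j _; rewrite ler0n.
    rewrite inE => -[j jM Bj]; rewrite (bigD1 (Ordinal jM))//= mem_set// lerDl.
    by apply: sumr_ge0 => i _; rewrite ler0n.
  rewrite (iint_sum (kout_kernel mu) _ x0 nB).
  apply: (@le_trans _ _ (\sum_(j : 'I_M) (expR (- (n%:R * r')))%:E)%E).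
    apply: lee_sum => j _; have [h1 h2 _ _ _] := hB j (ltn_ord j).
    exact: output_decoding_set_le h2.
  by rewrite sumEFin sumr_const card_ord [M%:R * _]mulr_natl.
have b0 : 0 <= M%:R * expR (- (n%:R * r')) by rewrite mulr_ge0 ?expR_ge0.
have [|x [x2 x3 xG]] := exists_good_input mU eps01 b0 hU.
  by rewrite mulrCA.
pose Bx := decoding_set x `\` U.
have mBx : measurable Bx by apply: measurableD => //; exact: measurable_decoding_set.
exists (fun j => if j == M then x else f j), (fun j => if j == M then Bx else B j); split.
  move=> j; rewrite ltnS leq_eqVlt; case: eqP => [_ _|_ /= jM]; last exact: hB.
  by split => // y [].
move=> i j /andP[ij]; rewrite ltnS leq_eqVlt.
case: eqP => [jM _|_ /= jM]; last first.
  by rewrite ltn_eqF ?(ltn_trans ij)//; apply: dB; rewrite ij.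
have iM : (i < M)%N by rewrite -jM.
rewrite ltn_eqF// -subset0 => y [yi [_ nU]]; apply: nU; by exists i.
Qed.

End feinstein.

(** * Achievability and the capacity formula *)

Section achievability.
Variable R : realType.
Notation leb := (@lebesgue_measure R).

Lemma llr_Lf (mu : probability R R) a t : llr mu a t = (t - a) ^+ 2 / 2 - Lf mu t.
Proof. by rewrite /llr ln_phi Lf_ln; ring. Qed.

Lemma info_letter_bound (mu : probability R R) (r : R) : exists A : R -> R, forall a t,
  `|r + llr mu a t| <= A a + 2 * t ^+ 2.
Proof.
have [C C0 hC] := Lf_upper_bound mu.
exists (fun a => `|r| + a ^+ 2 + C) => a t; rewrite llr_Lf.
have h1 := Lf_ge0 mu t; have h2 := hC t.
apply: le_trans (ler_normD _ _) _; rewrite -!addrA lerD2l.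
have := sqr_ge0 (t - a); have := sqr_ge0 (t + a).
have -> : (t + a) ^+ 2 = 2 * t ^+ 2 + 2 * a ^+ 2 - (t - a) ^+ 2 by ring.
move: ((t - a) ^+ 2) (t ^+ 2) (a ^+ 2) (Lf mu t) h1 h2 => x y z l *.
by rewrite ler_norml; apply/andP; split; lra.
Qed.

Lemma info_letter_mean (mu : probability R R) (r a : R) :
  (\int[leb]_t (phi (t - a) * (r + llr mu a t)))%R = r - D mu a.
Proof.
have [A hA] := info_letter_bound mu 0.
have ml := measurable_llr mu a.
have il : leb.-integrable setT (EFin \o (fun t => phi (t - a) * llr mu a t)).
  by apply: (@integrable_phi_mul R a (A a)) => // y; have := hA a y; rewrite add0r.
have iphi := integrable_phi a; have ir := integrable_scale r iphi.
transitivity (\int[leb]_t (r * phi (t - a) + phi (t - a) * llr mu a t))%R.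
  by apply: eq_Rintegral => t _; ring.
rewrite RintegralD// Rintegral_scale// Rintegral_phi mulr1; congr (_ + _).
have := Rintegral_scale (-1) il; rewrite mulN1r => /eqP; rewrite -eqr_oppLR => /eqP <-; congr (- _).
apply: EFin_inj; rewrite -dens_D /Rintegral fineK.
  apply: eq_integral => t _; rewrite -EFinM /llr ln_div ?posrE ?pY_gt0 ?phi_gt0//.
  by congr EFin; ring.
by apply: integrable_fin_num => //; exact: (integrable_scale (-1) il).
Qed.

Lemma cst_letter_mean (c a : R) : (\int[leb]_t (phi (t - a) * c))%R = c.
Proof.
transitivity (\int[leb]_t (c * phi (t - a)))%R; first by apply: eq_Rintegral => t _; rewrite mulrC.
by rewrite Rintegral_scale ?Rintegral_phi ?mulr1//; exact: integrable_phi.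
Qed.

Lemma cst_letter_tail (s : seq R) (w : R -> R) (f : R -> R) : (forall a, 0 <= w a) ->
  \sum_(a <- s) w a = 1 -> \sum_(a <- s) w a * f a < 0 ->
  exists2 rho : R, 0 <= rho < 1 & forall n,
   (wavg s w (fun x : n.-tuple R => iint (@kphi R)
      (fun y => ((0 <= tsum (fun a _ => f a) x y)%R%:R : R)%:E) x) <= (rho ^+ n)%:E)%E.
Proof.
move=> w0 w1 neg; apply: (chernoff_tail (A := fun a => `|f a|)) => //.
- by move=> a y; rewrite lerDl mulr_ge0// sqr_ge0.
- by under eq_bigr do rewrite cst_letter_mean.
Qed.

Lemma sum_sub_cst (s : seq R) (f : R -> R) (c : R) :
  \sum_(a <- s) (f a - c) = \sum_(a <- s) f a - (size s)%:R * c.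
Proof.
elim: s => [|a s IH]; first by rewrite !big_nil mul0r subr0.
by rewrite !big_cons IH /= -natr1; ring.
Qed.

Lemma sum_neq0_count (s : seq R) : \sum_(a <- s) (a != 0)%:R = (count (fun a : R => a != 0) s)%:R :> R.
Proof. by elim: s => [|a s IH]; rewrite ?big_nil// big_cons IH /= natrD. Qed.

Lemma code_of_disjoint_sets (g q eps : R) n M (f : nat -> n.-tuple R) (B : nat -> set (n.-tuple R)) :
  (forall j, (j < M.+1)%N -> [/\ measurable (B j),
     \sum_(a <- f j) ((a != 0)%:R - (1 - q)) < 0, \sum_(a <- f j) (a ^+ 2 - g) < 0
   & ((1 - eps)%:E <= iint (@kphi R) (fun y => ((y \in B j)%:R : R)%:E) (f j))%E]) ->
  (forall i j, (i < j < M.+1)%N -> B i `&` B j = set0) ->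
  exists (f' : 'I_M.+1 -> n.-tuple R) (d : n.-tuple R -> 'I_M.+1), good_code g q eps f' d.
Proof.
move=> hB dB.
(* Outputs in no region are decoded as [ord0], so only the preimage of [ord0] gains the complement
   of the union. *)
pose d (y : n.-tuple R) : 'I_M.+1 := odflt ord0 [pick j : 'I_M.+1 | y \in B j].
have uniqB (i j : 'I_M.+1) y : y \in B i -> y \in B j -> i = j.
  rewrite !inE => yi yj; apply/val_inj/eqP; rewrite eqn_leq; apply/andP.
  by split; rewrite leqNgt; apply/negP => h;
    [have : (B j `&` B i) y by []|have : (B i `&` B j) y by []]; rewrite dB//= h ltn_ord.
have dB' (j : 'I_M.+1) y : y \in B j -> d y = j.
  move=> yj; rewrite /d; case: pickP => [i yi|/(_ j)]; last by rewrite yj.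
  exact: uniqB yi yj.
have mpre m : measurable (d @^-1` [set m]).
  have -> : d @^-1` [set m] = B m `|` (if m == ord0 then ~` \bigcup_(j in `I_M.+1) B j else set0).
    apply/seteqP; split => y /=.
      rewrite /d; case: pickP => [i yi /= <-|none /= <-]; first by left; rewrite -in_setE.
      right; rewrite eqxx => -[j jM yj]; have := none (Ordinal jM).
      by rewrite mem_set.
    case=> [ym|]; first by apply: dB'; rewrite inE.
    case: eqP => // -> nU; rewrite /d; case: pickP => // i; rewrite inE => yi.
    by exfalso; apply: nU; exists i => //=; exact: ltn_ord.
  apply: measurableU; first by have [] := hB m (ltn_ord m).
  case: ifP => // _; apply: measurableC.
  by apply: fin_bigcup_measurable => [|j jM]; [exact: finite_II|have [] := hB j jM].
exists (fun j => f j), d; split => //.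
- move=> m; have [_ h _ _] := hB m (ltn_ord m).
  by move: h; rewrite sum_sub_cst sum_neq0_count size_tuple subr_lt0 mulrC => /ltW.
- move=> m; have [_ _ h _] := hB m (ltn_ord m).
  by move: h; rewrite sum_sub_cst size_tuple subr_lt0 => /ltW.
- move=> m; have [mB _ _ h] := hB m (ltn_ord m).
  apply: le_trans h _; rewrite gint_iint.
  apply: (le_iint (@kphi_kernel R)); first exact: nnm_mem.
    apply: nnm_indicator; rewrite (_ : [set _ | _] = d @^-1` [set m])//.
    by apply/seteqP; split => y /= /eqP.
  move=> y; rewrite lee_fin; have [/dB' ->|_] := boolP (y \in B m); first by rewrite eqxx.
  by rewrite ler0n.
Qed.

Lemma achievable_le (g q r1 r2 : R) : r1 <= r2 -> achievable g q r2 -> achievable g q r1.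
Proof.
move=> r12 ach eps eps0; have [N hN] := ach eps eps0; exists N => n Nn.
have [M [f [d [hM hg]]]] := hN n Nn; exists M, f, d; split => //.
by apply: le_trans hM; rewrite ler_expR ler_wpM2l.
Qed.

Variables (g q : R) (mu0 : probability R R).
Hypotheses (q0 : 0 < q) (q1 : q < 1) (g0 : 0 < g).
Hypothesis L0 : Lambda g q mu0.
Hypothesis max0 : forall mu, Lambda g q mu -> (J mu mu <= J mu0 mu0)%E.
Local Notation I := (fine (J mu0 mu0) - 1 / 2).

Lemma max_information_gt0 : 0 < I.
Proof.
have [c [l [/andP[l0 _] hD -> _ _]]] := kkt q0 q1 g0 L0 max0.
have d0 := D_ge0 mu0 0.
have cd : D mu0 0 <= c by have := hD 0; rewrite expr0n/= mulr0 addr0.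
have h1 : 0 <= q * D mu0 0 by rewrite mulr_ge0// ltW.
have c0 := le_trans d0 cd.
have h2 : 0 <= (1 - q) * c by rewrite mulr_ge0// subr_ge0 ltW.
have h3 : 0 < l * g by rewrite mulr_gt0.
by move: h1 h2 h3; move: (q * _) ((1 - q) * c) (l * g) => *; lra.
Qed.

Lemma nonneg_rate_achievable r : 0 <= r < I -> achievable g q r.
Proof.
move=> /andP[r0 rI].
(* Aiming at the midpoint leaves a margin: [kap < exp (r' - r)] makes [b] less than 1, which absorbs
   [kap ^+ n]. *)
pose r' := (r + I) / 2.
have r'I : r' < I by rewrite /r'; move: rI; move: I => i rI; lra.
have rr' : r < r' by rewrite /r'; move: rI; move: I => i rI; lra.
have z1 : 1 < expR (r' - r) by rewrite -expR0 ltr_expR subr_gt0.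
have [s [w [kap [[w0 w1 /andP[kap0 kapz] hk] [hD hg hc]]]]] := good_weights q0 q1 g0 L0 max0 r'I z1.
have [A hA] := info_letter_bound mu0 r'.
have mu1 a : measurable_fun setT (fun t => r' + llr mu0 a t).
  by have m := measurable_llr mu0 a; meas.
have meanw (f : R -> R) (c : R) : \sum_(a <- s) w a * (f a - c) = \sum_(a <- s) w a * f a - c.
  under eq_bigr do rewrite mulrBr.
  by rewrite sumrB -mulr_suml w1 mul1r.
have [rho1 /andP[rho10 rho11] t1] : exists2 rho : R, 0 <= rho < 1 & forall n,
   (wavg s w (fun x : n.-tuple R => iint (@kphi R)
      (fun y => ((0 <= tsum (fun a t => r' + llr mu0 a t) x y)%R%:R : R)%:E) x) <= (rho ^+ n)%:E)%E.
  apply: (chernoff_tail mu1 hA w0 w1).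
  under eq_bigr do rewrite info_letter_mean -opprB mulrN.
  by rewrite sumrN meanw oppr_lt0 subr_gt0.
have [rho2 /andP[rho20 rho21] t2] := cst_letter_tail (f := fun a => (a != 0)%:R - (1 - q)) w0 w1
  ltac:(by rewrite meanw subr_lt0).
have [rho3 /andP[rho30 rho31] t3] := cst_letter_tail (f := fun a => a ^+ 2 - g) w0 w1
  ltac:(by rewrite meanw subr_lt0).
move=> eps0' eps0.
(* The greedy construction asks for an error level of at most 1; a smaller level than requested is
   harmless. *)
pose eps := Num.min eps0' 1.
have eps01 : 0 < eps <= 1 by rewrite lt_min eps0 ltr01/= ge_min lexx orbT.
pose b := kap * expR (r - r').
have b0 : 0 <= b by rewrite mulr_ge0 ?expR_ge0.
have b1 : b < 1.
  by rewrite /b -opprB expRN ltr_pdivrMr ?expR_gt0// mul1r.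
have cv (x : R) : 0 <= x -> x < 1 -> x ^+ n @[n --> \oo] --> (0 : R).
  by move=> x0 x1; apply: cvg_expr; rewrite ger0_norm.
have lim : 2 * b ^+ n + (rho1 ^+ n + rho2 ^+ n + rho3 ^+ n) @[n --> \oo] --> (0 : R).
  have -> : (0 : R) = 2 * 0 + (0 + 0 + 0) by rewrite mulr0 !addr0.
  apply: cvgD; first by apply: cvgMr; exact: cv.
  by apply: cvgD; [apply: cvgD|]; exact: cv.
have [/andP[e0 e1]] := eps01; have [N _ hN] := cvgr_lt _ lim _ e0.
exists N => n Nn.
have small := hN n Nn.
(* One more than the integer part guarantees the rate, and costs at most a factor 2 because [r] is
   nonnegative. *)
pose m := Num.truncn (expR (n%:R * r)).
have mle : (m.+1)%:R <= 2 * expR (n%:R * r).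
  have h1 : 1 <= expR (n%:R * r) by rewrite -[leLHS]expR0 ler_expR mulr_ge0.
  have h2 : m%:R <= expR (n%:R * r) by rewrite truncn_le ?expR_ge0.
  by rewrite -natr1; lra.
have smallM : (m.+1)%:R * (kap ^+ n * expR (- (n%:R * r'))) +
    (rho1 ^+ n + rho2 ^+ n + rho3 ^+ n) < eps.
  apply: le_lt_trans small; rewrite lerD2r.
  apply: le_trans (ler_wpM2r _ mle) _; first by rewrite mulr_ge0 ?exprn_ge0 ?expR_ge0.
  rewrite -mulrA ler_pM2l// mulrCA -expRD exprMn -expRM_natl ler_wpM2l ?exprn_ge0// ler_expR.
  by rewrite mulrBr.
have [f [B [hB dB]]] := greedy_code w0 w1 kap0 hk t1 t2 t3 [tuple of nseq n 0] eps01 smallM.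
have [|f' [d [h1 h2 h3 h4]]] := code_of_disjoint_sets (g := g) (q := q) (eps := eps0') (f := f) (B := B) _ dB.
  move=> j /hB[k1 _ k3 k4 k5]; split => //; apply: le_trans k5.
  by rewrite lee_fin lerD2l lerN2 ge_min lexx.
exists m.+1, f', d; split => //.
exact/ltW/truncnS_gt.
Qed.

Lemma achievability_bound r : r < I -> achievable g q r.
Proof.
move=> rI; apply: (@achievable_le _ _ _ (Num.max r 0)); first by rewrite le_max lexx.
by apply: nonneg_rate_achievable; rewrite le_max lexx orbT/= gt_max rI max_information_gt0.
Qed.

Lemma capacity_MI : capacity g q = MI mu0.
Proof.
rewrite (MI_I L0); apply/eqP; rewrite eq_le; apply/andP; split.
  apply: ge_ereal_sup => _ [r ach <-]; rewrite lee_fin.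
  exact: converse_bound q0 q1 g0 L0 max0 _ ach.
apply/lee_subgt0Pr => e e0; apply: ereal_sup_ubound; exists (I - e) => //=.
by apply: achievability_bound; rewrite ltrBlDr ltrDl.
Qed.

End achievability.

Theorem theorem1 (R : realType) (gamma q : R) (hgamma : 0 < gamma)
  (hq0 : 0 < q) (hq1 : q < 1) :
  exists mu0 : probability R R,
    [/\ (* capacity = max over Lambda of I, attained at mu0 *)
        [/\ mu0 \in Lambda gamma q,
             (forall mu, mu \in Lambda gamma q -> (MI mu <= MI mu0)%E)
           & capacity gamma q = MI mu0],
        (* (a) uniqueness of the maximizer *)
        (forall mu, mu \in Lambda gamma q -> MI mu = MI mu0 ->
           forall A : set R, measurable A -> mu A = mu0 A),
        (* (b) symmetry and power constraint met with equality *)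
        ((forall A : set R, measurable A -> mu0 [set - x | x in A] = mu0 A) /\
         (\int[mu0]_x (x ^+ 2)%:E = gamma%:E)%E)
      & (* (c) discrete, infinitely many atoms, finitely many in bounded sets *)
        [/\ mu0 (~` atoms mu0) = 0%E,
            infinite_set (atoms mu0)
          & forall a b : R, finite_set (atoms mu0 `&` `[a, b])]].
Proof.
have [mu0 [L0 max0]] := maximizer_exists (ltW hgamma) (ltW hq1).
exists mu0; split.
- split; first by rewrite inE.
    by move=> mu; rewrite inE => Lm; rewrite !MI_J leeD2r// max0.
  exact: capacity_MI.
- move=> mu; rewrite inE => Lm; rewrite !MI_J => e; apply: (maximizer_unique hq0 hq1 hgamma L0 max0 Lm).
  by have := congr1 (fun x => x + (1 / 2)%:E)%E e; rewrite !subeK.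
- split; first by move=> A; exact: maximizer_symmetric L0 max0 A.
  by have [c [l [_ _ _ + _]]] := kkt hq0 hq1 hgamma L0 max0.
- exact: atoms_structure L0 max0.
Qed.
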